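(* Let $D\geq 1$ be an odd square-free integer. There exists $K_0=K_0(D)$ such that for every even integer $K\geq K_0$ the following holds: if $\ell$ is an integer with $3\leq \ell\leq\frac{K-4}{2}$ and $\chi_1,\dots,\chi_n$ are primitive Dirichlet characters mod $D$ such that $\chi_i(-1)=(-1)^{\ell}$ for all $i$ and the values $\chi_1(2),\dots,\chi_n(2)$ are pairwise distinct, then the twisted periods $r_{\ell,\chi_1},\dots,r_{\ell,\chi_n}$, viewed as elements of $\mathrm{Hom}_{\mathbb{C}}(S_K,\mathbb{C})$, are linearly independent over $\mathbb{C}$.
   Context: $S_K$ is the space of cusp forms of weight $K$ for $\mathrm{SL}_2(\mathbb{Z})$, $q=e^{2\pi i z}$. For $f(z)=\sum_{n\ge1}a_f(n)q^n\in S_K$ and a Dirichlet character $\chi$, put $f_\chi(z)=\sum_{n\geq1}\chi(n)a_f(n)q^n$ and $L(f,\chi,s)=\sum_{n\ge1}\chi(n)a_f(n)n^{-s}$ (analytically continued to $\mathbb{C}$). For a primitive Dirichlet character $\chi$ mod $D$ and $0\leq m\leq K-2$, the $m$-th twisted period is the linear functional on $S_K$ given by $r_{m,\chi}(f)=\int_0^{i\infty}f_\chi(z)z^m\,dz=\frac{m!}{(-2\pi i)^{m+1}}L(f,\chi,m+1)$. *)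

(* Defs.v *)
From HB Require Import structures.
From mathcomp Require Import all_boot all_order all_algebra.
From mathcomp Require Import complex.
From mathcomp Require Import all_classical all_reals all_analysis.

Set Implicit Arguments.
Unset Strict Implicit.
Unset Printing Implicit Defensive.

Import Order.TTheory GRing.Theory Num.Theory.
Import numFieldNormedType.Exports.

Local Open Scope classical_set_scope.
Local Open Scope ring_scope.

(* R[i] seen as a numClosedFieldType, so that it carries the topology given by
   its norm and [derivable _ _ 1] is complex differentiability. *)
Definition CC (R : realType) : numClosedFieldType := R[i]%C.

Section complex_functions.
Variable R : realType.

Definition mkC (x y : R) : CC R := Complex x y.

Definition cexp (z : CC R) : CC R :=
  mkC (expR (complex.Re z) * cos (complex.Im z))
      (expR (complex.Re z) * sin (complex.Im z)).

(* q = e^{2 pi i z} *)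
Definition nome (z : CC R) : CC R := cexp (mkC 0 (2 * pi) * z).

Definition upper_half_plane : set (CC R) := [set z | 0 < complex.Im z].

(* Lebesgue integral over ]0, +oo[ of a complex-valued function. *)
Definition Cintegral (g : R -> CC R) : CC R :=
  mkC (Rintegral (@lebesgue_measure R) `]0, +oo[ (fun t => complex.Re (g t)))
      (Rintegral (@lebesgue_measure R) `]0, +oo[ (fun t => complex.Im (g t))).

End complex_functions.

Section cusp_forms.
Variable R : realType.

Definition is_qexpansion (f : CC R -> CC R) (a : nat -> CC R) : Prop :=
  a 0%N = 0 /\
  forall z, upper_half_plane z ->
    (fun N : nat => \sum_(1 <= n < N) a n * nome z ^+ n) @ \oo --> f z.

(* A function on the upper half-plane is represented by its extension by 0 to
   CC R, so that equality of functions on CC R is equality of cusp forms. *)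
Record is_cusp_form (K : nat) (f : CC R -> CC R) : Prop := IsCuspForm {
  cusp_form_out : forall z, ~ upper_half_plane z -> f z = 0;
  cusp_form_holo : forall z, upper_half_plane z -> derivable f z 1;
  cusp_form_modular : forall a b c d : int, a * d - b * c = 1 ->
    forall z, upper_half_plane z ->
      f ((a%:~R * z + b%:~R) / (c%:~R * z + d%:~R))
      = (c%:~R * z + d%:~R) ^+ K * f z;
  cusp_form_qexp : exists a, is_qexpansion f a }.

(* The space S_K for SL_2(Z). *)
Record cusp_form (K : nat) := CuspForm {
  cusp_fun :> CC R -> CC R;
  cusp_formP : is_cusp_form K cusp_fun }.

(* n |-> a_f(n); a cusp form has exactly one q-expansion. *)
Definition qcoef (f : CC R -> CC R) : nat -> CC R := get (is_qexpansion f).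

End cusp_forms.

Section dirichlet_characters.
Variable R : realType.

Record dirichlet_character (D : nat) (chi : int -> CC R) : Prop :=
  DirichletCharacter {
    dirichlet1 : chi 1 = 1;
    dirichletM : forall m n : int, chi (m * n) = chi m * chi n;
    dirichlet_periodic : forall n : int, chi (n + D%:Z) = chi n;
    dirichlet_eq0 : forall n : int, (chi n == 0) = ~~ coprimez n D%:Z }.

(* chi is not induced by a character modulo a proper divisor of D. *)
Definition primitive_character (D : nat) (chi : int -> CC R) : Prop :=
  dirichlet_character D chi /\
  forall d : nat, (d %| D)%N -> (d < D)%N ->
    ~ exists chi0 : int -> CC R, dirichlet_character d chi0 /\
        forall n : int, coprimez n D%:Z -> chi n = chi0 n.

End dirichlet_characters.

Section twisted_periods.
Variable R : realType.

Definition twist (chi : int -> CC R) (f : CC R -> CC R) (z : CC R) : CC R :=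
  lim ((fun N : nat =>
    \sum_(1 <= n < N) chi n%:Z * qcoef f n * nome z ^+ n) @ \oo).

(* int_0^{i oo} f_chi(z) z^m dz, along z = i t, dz = i dt, 0 < t < +oo. *)
Definition twisted_period (K m : nat) (chi : int -> CC R) :
    cusp_form R K -> (CC R)^o :=
  fun f => Cintegral (fun t : R =>
    twist chi f (mkC 0 t) * mkC 0 t ^+ m * mkC 0 1).

End twisted_periods.

Definition squarefree (D : nat) : Prop :=
  forall d : nat, (d ^ 2 %| D)%N -> d = 1%N.

Definition linearly_independent (F : fieldType) (V : lmodType F) (n : nat)
    (v : 'I_n -> V) : Prop :=
  forall c : 'I_n -> F, \sum_(i < n) c i *: v i = 0 -> forall i, c i = 0.

(* Main.v *)
(** The functional r_{l,chi} is tested on F = Delta^m E_4^c E_6^b, whose q-expansion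
starts with q^m. By Fourier inversion of the primitive character chi, the twist
F_chi is a combination, with Gauss sum weights tau(a), of the translates
F(z + a/D), (a, D) = 1. Split the period integral over i t at t = 1/D. For
t <= 1/D, a modular substitution sends it + a/D to i/(D^2 t) - (1/a)/D, so that
this part is, up to a factor common to all chi, sum_a tau(a) zeta^(-m/a) plus an
error. The part t >= 1/D and all the tails of the q-expansion are O(1/K)
relative to that factor: the ratio of the two halves is (2 pi m/D)^(L-l) l!/L!
with L = K - l - 2 >= l + 2. Finally sum_a tau(a) zeta^(-m/a) equals kappa_chi /
chi(m) with |kappa_chi| >= 1/D. Hence a relation sum_i c_i r_{l,chi_i} = 0, tested
at m = 2^j for 0 <= j < phi(D), gives sum_i c_i kappa_i chi_i(2)^(-j) =
O(max |c_i| / K); as the chi_i(2) are distinct phi(D)-th roots of unity,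
orthogonality gives c_k = O(max |c_i| / K) for every k, so c = 0 once K is
large. *)

Require Import Defs.
From HB Require Import structures.
From mathcomp Require Import all_boot all_order all_algebra.
From mathcomp Require Import complex.
From mathcomp Require Import all_classical all_reals all_analysis.
From mathcomp Require Import ring lra zify measurable_realfun.
From mathcomp Require cyclic.
Import Order.TTheory GRing.Theory Num.Theory.
Import numFieldNormedType.Exports.
Local Open Scope ring_scope.
Set Implicit Arguments.
Unset Strict Implicit.
Unset Printing Implicit Defensive.

(** * The real-valued modulus on [CC R] *)

(** The difficulty is uniformity in [l] and [K]. The coefficients of F are controlled at two radii
    only: at 1/K the sum of |a_n| K^(-n) stays bounded, and at r = exp(-pi/D) the corresponding sum
    is at most beta^K with beta free of K. Terms with m < n < N use the first bound, terms with n >=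
    N the second. Relative to the main term, q^n loses (m/n)^(L+1) near 0, where 2(L+1) >= K; so a
    fixed N >= 4 beta^2 m beats beta^K, and (m/(m+1))^(K/2) beats the factor K^N. Incomplete gamma
    integrals are avoided: the main term and all errors are extended from their side of t = 1/D to
    majorants on the whole half-line. The weights on the translates stay arbitrary on residues prime
    to D, so a whole linear relation is tested as one weighted sum. Powers of 2 serve as m because D
    is odd and chi(2^j) = chi(2)^j. E_4 and E_6 are lattice sums; their q-expansions come from the
    Lipschitz formula, proved by a Herglotz argument: the two sides differ by something with a pole
    of lower order, which the duplication formula forces to vanish. *)

Section Modulus.
Variable R : realType.
Implicit Types (x y : R) (z w : CC R).

(* The norm of [CC R] takes its values in [CC R]; [nm] is the underlying real. *)
Definition rr x : CC R := mkC x 0.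
Definition nm z : R := complex.Re `|z|.

Lemma rr_is_additive : zmod_morphism rr.
Proof. by move=> x y; rewrite /rr /mkC /=; congr (Complex _ _); rewrite subr0. Qed.
Lemma rr_is_multiplicative : monoid_morphism rr.
Proof.
by split=> // x y; rewrite /rr /mkC; congr (Complex _ _); rewrite !(mulr0, mul0r, subr0, addr0).
Qed.
HB.instance Definition _ := GRing.isZmodMorphism.Build R (CC R) rr rr_is_additive.
HB.instance Definition _ := GRing.isMonoidMorphism.Build R (CC R) rr rr_is_multiplicative.

Lemma nmE z : `|z| = rr (nm z).
Proof. by rewrite /nm (normc_def z). Qed.

Lemma nm_def z : nm z = Num.sqrt ((complex.Re z) ^+ 2 + (complex.Im z) ^+ 2).
Proof. by rewrite /nm (normc_def z). Qed.

Lemma rr_inj : injective rr. Proof. by move=> x y []. Qed.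
Lemma rr_eq0 x : (rr x == 0) = (x == 0).
Proof. exact: fmorph_eq0. Qed.
Lemma rr_le x y : (rr x <= rr y) = (x <= y). Proof. exact: (lecR x y). Qed.
Lemma rr_lt x y : (rr x < rr y) = (x < y). Proof. exact: (ltcR x y). Qed.
Lemma rr_gt0 z : 0 < z -> exists2 x, 0 < x & z = rr x.
Proof.
case: z => x y; rewrite (ltcE (0 : R[i]) (Complex x y)) /= => /andP[/eqP ->] h.
by exists x.
Qed.

Lemma nm_ge0 z : 0 <= nm z.
Proof. by rewrite -rr_le -nmE rmorph0. Qed.
Lemma nmM z w : nm (z * w) = nm z * nm w.
Proof. by apply: rr_inj; rewrite rmorphM -!nmE normrM. Qed.
Lemma nm0 : nm 0 = 0.
Proof. by apply: rr_inj; rewrite -nmE normr0 rmorph0. Qed.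
Lemma nm1 : nm 1 = 1.
Proof. by apply: rr_inj; rewrite -nmE normr1 rmorph1. Qed.
Lemma nmN z : nm (- z) = nm z.
Proof. by apply: rr_inj; rewrite -!nmE normrN. Qed.
Lemma nmV z : nm z^-1 = (nm z)^-1.
Proof. by apply: rr_inj; rewrite fmorphV -!nmE normfV. Qed.
Lemma nmX z n : nm (z ^+ n) = nm z ^+ n.
Proof. by apply: rr_inj; rewrite rmorphXn -!nmE normrX. Qed.
Lemma nm_eq0 z : (nm z == 0) = (z == 0).
Proof. by rewrite -rr_eq0 -nmE normr_eq0. Qed.
Lemma nm_gt0 z : (0 < nm z) = (z != 0).
Proof. by rewrite lt_neqAle nm_ge0 andbT eq_sym nm_eq0. Qed.
Lemma nmD z w : nm (z + w) <= nm z + nm w.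
Proof. by rewrite -rr_le rmorphD -!nmE ler_normD. Qed.
Lemma nmDB z w : nm (z - w) <= nm z + nm w.
Proof. by rewrite -(nmN w) nmD. Qed.
Lemma nm_lbD z w : nm z - nm w <= nm (z + w).
Proof. by rewrite lerBlDr -[X in nm X <= _](addrK w) nmDB. Qed.
Lemma nm_sum (I : Type) (s : seq I) (P : pred I) (F : I -> CC R) :
  nm (\sum_(i <- s | P i) F i) <= \sum_(i <- s | P i) nm (F i).
Proof.
elim/big_ind2: _ => [|a b c d h1 h2|//]; first by rewrite nm0.
by apply: le_trans (nmD _ _) _; apply: lerD.
Qed.
Lemma nm_rr x : nm (rr x) = `|x|.
Proof. by rewrite nm_def /= expr0n addr0 sqrtr_sqr. Qed.
Lemma nm_nat n : nm n%:R = n%:R.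
Proof. by rewrite -(rmorph_nat rr) nm_rr normr_nat. Qed.
Lemma nm_int (n : int) : nm n%:~R = `|n%:~R : R|.
Proof. by rewrite -(rmorph_int rr) nm_rr. Qed.

Lemma ReD z w : complex.Re (z + w) = complex.Re z + complex.Re w.
Proof. by case: z => ? ?; case: w. Qed.
Lemma ImD z w : complex.Im (z + w) = complex.Im z + complex.Im w.
Proof. by case: z => ? ?; case: w. Qed.
Lemma ReN z : complex.Re (- z) = - complex.Re z.
Proof. by case: z => ? ?. Qed.
Lemma ImN z : complex.Im (- z) = - complex.Im z.
Proof. by case: z => ? ?. Qed.
Lemma ReM z w : complex.Re (z * w) =
  complex.Re z * complex.Re w - complex.Im z * complex.Im w.
Proof. by case: z => ? ?; case: w. Qed.
Lemma ImM z w : complex.Im (z * w) =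
  complex.Re z * complex.Im w + complex.Im z * complex.Re w.
Proof. by case: z => ? ?; case: w => ? ? /=; rewrite addrC. Qed.
Lemma Re_rr x : complex.Re (rr x) = x. Proof. by []. Qed.
Lemma Re_int (n : int) : complex.Re (n%:~R : CC R) = n%:~R.
Proof. by rewrite -(rmorph_int rr). Qed.
Lemma Im_int (n : int) : complex.Im (n%:~R : CC R) = 0.
Proof. by rewrite -(rmorph_int rr). Qed.
Lemma Re_sum (I : Type) (s : seq I) (P : pred I) (F : I -> CC R) :
  complex.Re (\sum_(i <- s | P i) F i) = \sum_(i <- s | P i) complex.Re (F i).
Proof. by elim/big_ind2: _ => // a b c d <- <-; rewrite ReD. Qed.
Lemma Im_sum (I : Type) (s : seq I) (P : pred I) (F : I -> CC R) :
  complex.Im (\sum_(i <- s | P i) F i) = \sum_(i <- s | P i) complex.Im (F i).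
Proof. by elim/big_ind2: _ => // a b c d <- <-; rewrite ImD. Qed.

Lemma CC_eq z w : complex.Re z = complex.Re w -> complex.Im z = complex.Im w -> z = w.
Proof. by case: z => ? ?; case: w => ? ? /= -> ->. Qed.
Lemma mkCE x y : mkC x y = rr x + mkC 0 1 * rr y.
Proof. by apply: CC_eq; rewrite ?(ReD, ImD, ReM, ImM) /=; ring. Qed.

Lemma Re_le_nm z : `|complex.Re z| <= nm z.
Proof. by rewrite nm_def -sqrtr_sqr ler_wsqrtr // lerDl sqr_ge0. Qed.
Lemma Im_le_nm z : `|complex.Im z| <= nm z.
Proof. by rewrite nm_def -sqrtr_sqr ler_wsqrtr // lerDr sqr_ge0. Qed.
Lemma nm_i : nm (mkC 0 1) = 1.
Proof. by rewrite nm_def /= expr0n add0r expr1n sqrtr1. Qed.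
Lemma nm_le z : nm z <= `|complex.Re z| + `|complex.Im z|.
Proof.
by case: z => a b; rewrite /= -[Complex a b]/(mkC a b) mkCE; apply: le_trans (nmD _ _) _;
  rewrite nmM nm_i mul1r !nm_rr.
Qed.
Lemma nm_sqr z : nm z ^+ 2 = complex.Re z ^+ 2 + complex.Im z ^+ 2.
Proof. by rewrite nm_def sqr_sqrtr // addr_ge0 // sqr_ge0. Qed.

End Modulus.

(** * Unordered summation *)

Section UnorderedSums.
Variable R : realType.
Implicit Types (I J : eqType) (s t : CC R).

(** Convergence along the net of finite duplicate-free lists: series over [int], [int * int] or
    [nat + nat] can then be reindexed and regrouped without choosing an order. *)
Definition hsum I (f : I -> CC R) s := forall e : R, 0 < e ->
  exists A : seq I, forall B, uniq B -> {subset A <= B} ->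
    nm (s - \sum_(i <- B) f i) < e.
(** Absolute summability with its bound kept explicit, since the later estimates must follow this
    bound as the weight grows. *)
Definition absb I (f : I -> CC R) (M : R) :=
  forall B : seq I, uniq B -> \sum_(i <- B) nm (f i) <= M.

Lemma ler_sum_subset I (g : I -> R) (A B : seq I) : (forall i, 0 <= g i) ->
  uniq A -> uniq B -> {subset A <= B} -> \sum_(i <- A) g i <= \sum_(i <- B) g i.
Proof.
move=> g0 uA uB AB; rewrite (bigID (mem A) predT (r := B)) /= -[X in _ <= X + _]big_filter.
rewrite (@perm_big _ _ _ _ [seq i <- B | i \in A] A) /=; first by rewrite lerDl sumr_ge0.
apply: uniq_perm => //; first exact: filter_uniq.
by move=> i; rewrite mem_filter; case: (boolP (i \in A)) => // /AB ->.
Qed.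

Lemma hsum_ext I (f g : I -> CC R) s : (forall i, f i = g i) -> hsum f s -> hsum g s.
Proof. by move=> fg; rewrite (_ : g = f) //; apply/funext => i. Qed.

Lemma absb_le I (f g : I -> CC R) M : (forall i, nm (f i) <= nm (g i)) ->
  absb g M -> absb f M.
Proof. by move=> fg bg B /bg; apply: le_trans; apply: ler_sum => i _. Qed.

Lemma absb_ge0 I (f : I -> CC R) M : absb f M -> 0 <= M.
Proof. by move=> /(_ [::] isT); rewrite big_nil. Qed.

Lemma absbW I (f : I -> CC R) M N : M <= N -> absb f M -> absb f N.
Proof. by move=> MN bf B /bf/le_trans; apply. Qed.

Lemma hsum_uniq I (f : I -> CC R) s t : hsum f s -> hsum f t -> s = t.
Proof.
move=> fs ft; apply/eqP; rewrite -subr_eq0 -nm_eq0; apply/eqP.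
have := nm_ge0 (s - t); rewrite le_eqVlt => /orP[/eqP <- //|d0].
have d2 : 0 < nm (s - t) / 2 by rewrite divr_gt0.
have [A fA] := fs _ d2; have [B fB] := ft _ d2.
have uC := undup_uniq (A ++ B).
have /fA-/(_ uC) : {subset A <= undup (A ++ B)}.
  by move=> i iA; rewrite mem_undup mem_cat iA.
have /fB-/(_ uC) : {subset B <= undup (A ++ B)}.
  by move=> i iA; rewrite mem_undup mem_cat iA orbT.
set S := \sum_(i <- _) _ => h1 h2.
have : nm (s - t) <= nm (s - S) + nm (t - S).
  by rewrite (_ : s - t = (s - S) - (t - S)) ?nmDB //; ring.
by move: h1 h2; lra.
Qed.

Lemma hsumD I (f g : I -> CC R) s t :
  hsum f s -> hsum g t -> hsum (fun i => f i + g i) (s + t).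
Proof.
move=> fs gt e e0; have e2 : 0 < e / 2 by rewrite divr_gt0.
have [A fA] := fs _ e2; have [B gB] := gt _ e2.
exists (A ++ B) => C uC ABC; rewrite big_split /=.
have h1 : {subset A <= C} by move=> i iA; apply: ABC; rewrite mem_cat iA.
have h2 : {subset B <= C} by move=> i iA; apply: ABC; rewrite mem_cat iA orbT.
have := fA _ uC h1; have := gB _ uC h2.
set X := \sum_(i <- C) g i; set Y := \sum_(i <- C) f i => h3 h4.
have : nm (s + t - (Y + X)) <= nm (s - Y) + nm (t - X).
  by rewrite (_ : s + t - (Y + X) = (s - Y) + (t - X)) ?nmD //; ring.
by lra.
Qed.

Lemma hsumZ I (f : I -> CC R) s c : hsum f s -> hsum (fun i => c * f i) (c * s).
Proof.
move=> fs e e0.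
have c1 : 0 < 1 + nm c by rewrite ltr_pwDl // nm_ge0.
have [A fA] := fs _ (divr_gt0 e0 c1); exists A => B uB AB.
rewrite -mulr_sumr -mulrBr nmM.
have := fA _ uB AB; rewrite ltr_pdivlMr // => h.
by apply: le_lt_trans h; rewrite mulrC ler_wpM2l ?nm_ge0 // lerDr.
Qed.

Lemma hsumN I (f : I -> CC R) s : hsum f s -> hsum (fun i => - f i) (- s).
Proof.
by move=> /(hsumZ (-1)); rewrite mulN1r; apply: hsum_ext => i; rewrite mulN1r.
Qed.

Lemma hsumB I (f g : I -> CC R) s t :
  hsum f s -> hsum g t -> hsum (fun i => f i - g i) (s - t).
Proof. by move=> fs /hsumN; apply: hsumD. Qed.

Lemma hsum_bigD I (T : Type) (r : seq T) (f : T -> I -> CC R) (s : T -> CC R) :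
  (forall j, hsum (f j) (s j)) ->
  hsum (fun i => \sum_(j <- r) f j i) (\sum_(j <- r) s j).
Proof.
move=> fs; elim: r => [|a r IH].
  rewrite big_nil; apply: (@hsum_ext _ (fun=> 0)); first by move=> i; rewrite big_nil.
  by move=> e e0; exists [::] => B _ _; rewrite big1 // subr0 nm0.
rewrite big_cons; apply: hsum_ext (hsumD (fs a) IH) => i.
by rewrite big_cons.
Qed.

Lemma hsum_le I (f : I -> CC R) s M : hsum f s -> absb f M -> nm s <= M.
Proof.
move=> fs bf; apply/ler_addgt0Pr => e e0.
have [A fA] := fs _ e0.
have h := fA _ (undup_uniq A) (fun i (iA : i \in A) => etrans (mem_undup A i) iA).
have h2 := bf _ (undup_uniq A).
have := nm_sum (undup A) predT f.
have := nmD (s - \sum_(i <- undup A) f i) (\sum_(i <- undup A) f i).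
rewrite subrK; lra.
Qed.

Lemma hsum_supp I (f : I -> CC R) (A : seq I) : uniq A ->
  (forall i, i \notin A -> f i = 0) -> hsum f (\sum_(i <- A) f i).
Proof.
move=> uA fA e e0; exists A => B uB AB.
rewrite [X in _ - X](bigID (mem A)) /= [X in _ - (_ + X)]big1; last by move=> i /fA.
rewrite addr0 -[X in _ - X]big_filter (@perm_big _ _ _ _ [seq i <- B | i \in A] A) /=.
  by rewrite subrr nm0.
apply: uniq_perm => //; first exact: filter_uniq.
by move=> i; rewrite mem_filter; case: (boolP (i \in A)) => // /AB ->.
Qed.

(** The sum is the supremum of the finite partial sums. *)
Lemma hsum_nneg I (g : I -> R) (M : R) : (forall i, 0 <= g i) ->
  (forall B, uniq B -> \sum_(i <- B) g i <= M) ->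
  exists x : R, hsum (fun i => rr (g i)) (rr x) /\
    forall B, uniq B -> \sum_(i <- B) g i <= x.
Proof.
move=> g0 gM.
pose E : set R := [set x | exists2 B, uniq B & x = \sum_(i <- B) g i]%classic.
have supE : has_sup E.
  split; first by exists 0, [::] => //; rewrite big_nil.
  by exists M => _ [B uB ->]; exact: gM.
have ub B : uniq B -> \sum_(i <- B) g i <= sup E.
  by move=> uB; apply: sup_upper_bound => //; exists B.
exists (sup E); split=> // e e0.
have [_ [A uA ->] hA] := sup_adherent e0 supE.
exists A => B uB AB; rewrite -rmorph_sum -rmorphB nm_rr ger0_norm ?subr_ge0 ?ub //.
by have := ler_sum_subset g0 uA uB AB; move: hA; lra.
Qed.

Lemma hsum_real I (g : I -> R) M : (forall B, uniq B -> \sum_(i <- B) `|g i| <= M) ->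
  exists x : R, hsum (fun i => rr (g i)) (rr x).
Proof.
move=> gM.
have [s1 [h1 _]] := hsum_nneg (fun i => normr_ge0 (g i)) gM.
(* [g] is the difference of the two non-negative families [|g| + g] and [|g|]. *)
have p2 i : 0 <= `|g i| + g i by have := ler_norm (- g i); rewrite normrN; lra.
have [||s2 [h2 _]] := @hsum_nneg I (fun i => `|g i| + g i) (2 * M) => // [B uB|].
  apply: le_trans (_ : \sum_(i <- B) 2 * `|g i| <= _).
    by apply: ler_sum => i _; have := ler_norm (g i); lra.
  by rewrite -mulr_sumr ler_pM2l // gM.
exists (s2 - s1); rewrite rmorphB; apply: hsum_ext (hsumB h2 h1) => i.
by rewrite -rmorphB /= [X in rr (X - _)]addrC addrK.
Qed.

Lemma hsum_ex I (f : I -> CC R) M : absb f M -> exists s, hsum f s.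
Proof.
move=> fM.
have [|s1 h1] := @hsum_real I (fun i => complex.Re (f i)) M.
  by move=> B /fM; apply: le_trans; apply: ler_sum => i _; exact: Re_le_nm.
have [|s2 h2] := @hsum_real I (fun i => complex.Im (f i)) M.
  by move=> B /fM; apply: le_trans; apply: ler_sum => i _; exact: Im_le_nm.
exists (rr s1 + mkC 0 1 * rr s2); apply: hsum_ext (hsumD h1 (hsumZ (mkC 0 1) h2)) => i.
by rewrite -mkCE; case: (f i).
Qed.

Lemma hsum_reindex I J (h : J -> I) (f : I -> CC R) s : injective h ->
  (forall i, exists j, i = h j) -> hsum f s -> hsum (fun j => f (h j)) s.
Proof.
move=> hi hs fs e e0; have [A fA] := fs _ e0.
have [A' eA] : exists A' : seq J, A = map h A'.
  elim: A {fA} => [|a A [A' ->]]; first by exists [::].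
  by have [j ->] := hs a; exists (j :: A').
exists A' => B uB AB; rewrite -(big_map h predT f); apply: fA.
  by rewrite map_inj_uniq.
by rewrite eA => _ /mapP[j /AB jB ->]; apply: map_f.
Qed.

Lemma absb_inj I J (h : J -> I) (f : I -> CC R) M : injective h ->
  absb f M -> absb (fun j => f (h j)) M.
Proof.
by move=> hi fM B uB; rewrite -(big_map h predT (fun i => nm (f i))) fM // map_inj_uniq.
Qed.

Lemma fubini_finite I J (f : I * J -> CC R) (g : I -> CC R) (B : seq I) :
  (forall i, hsum (fun j => f (i, j)) (g i)) -> forall e, 0 < e ->
  exists A : seq J, forall C, uniq C -> {subset A <= C} ->
    nm (\sum_(i <- B) g i - \sum_(i <- B) \sum_(j <- C) f (i, j)) < e.
Proof.
move=> fg e e0; have [A hA] := hsum_bigD B fg e0; exists A => C uC AC.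
by rewrite exchange_big /=; exact: hA.
Qed.

Lemma hsum_fubini I J (f : I * J -> CC R) (g : I -> CC R) s :
  (forall i, hsum (fun j => f (i, j)) (g i)) -> hsum f s -> hsum g s.
Proof.
move=> fg fs e e0; have e2 : 0 < e / 2 by rewrite divr_gt0.
have [A fA] := fs _ e2; exists (map fst A) => B uB AB.
have [C hC] := fubini_finite B fg e2.
(* The rectangle with sides [B] and [C'] contains [A], and [C'] contains the list [C] that
   approximates the row sums, so both estimates apply to it. *)
pose C' := undup (C ++ map snd A).
have uC' : uniq C' by exact: undup_uniq.
have {hC} h1 : nm (\sum_(i <- B) g i - \sum_(i <- B) \sum_(j <- C') f (i, j)) < e / 2.
  by apply: hC => // j jC; rewrite mem_undup mem_cat jC.
have h2 : nm (s - \sum_(p <- [seq (i, j) | i <- B, j <- C']) f p) < e / 2.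
  apply: fA; first by apply: allpairs_uniq => // -[? ?] [? ?] _ _ [-> ->].
  move=> [i j] ijA; apply: allpairs_f.
    by apply: AB; apply: (map_f fst ijA).
  by rewrite mem_undup mem_cat (map_f snd ijA) orbT.
rewrite big_allpairs in h2.
move: h1 h2; set X := \sum_(i <- B) g i; set Y := \sum_(i <- B) _ => h1 h2.
have : nm (s - X) <= nm (s - Y) + nm (X - Y).
  by rewrite (_ : s - X = (s - Y) - (X - Y)) ?nmDB //; ring.
by lra.
Qed.

Lemma absb_fubini I J (f : I * J -> CC R) (g : I -> CC R) M :
  (forall i, hsum (fun j => f (i, j)) (g i)) -> absb f M -> absb g M.
Proof.
move=> fg fM B uB.
have abs i : exists t, hsum (fun j => rr (nm (f (i, j)))) t /\ t = rr (complex.Re t) /\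
    nm (g i) <= complex.Re t.
  have bi : absb (fun j => f (i, j)) M by apply: (@absb_inj _ _ (pair i)) fM => ? ? [].
  have [t [ht bt]] := hsum_nneg (fun j => nm_ge0 (f (i, j))) bi.
  exists (rr t); split=> //; split=> //; exact: hsum_le (fg i) bt.
pose t i := projT1 (cid (abs i)).
have [ht tg] : (forall i, hsum (fun j => rr (nm (f (i, j)))) (t i)) /\
    forall i, t i = rr (complex.Re (t i)) /\ nm (g i) <= complex.Re (t i).
  by split=> i; rewrite /t; case: (cid _) => /= x [? []].
apply: le_trans (_ : \sum_(i <- B) complex.Re (t i) <= _).
  by apply: ler_sum => i _; have [] := tg i.
apply/ler_addgt0Pr => e e0.
have [C hC] := fubini_finite (f := fun p => rr (nm (f p))) B ht e0.
have {}hC : nm (\sum_(i <- B) t i - \sum_(i <- B) \sum_(j <- undup C) rr (nm (f (i, j)))) < e.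
  by apply: hC; [exact: undup_uniq | move=> j; rewrite mem_undup].
have := fM [seq (i, j) | i <- B, j <- undup C].
rewrite allpairs_uniq ?undup_uniq //; last by move=> [? ?] [? ?] _ _ [-> ->].
rewrite big_allpairs => /(_ isT).
have -> : \sum_(i <- B) complex.Re (t i) = complex.Re (\sum_(i <- B) t i) by rewrite Re_sum.
set Y := \sum_(i <- B) _ => hY.
have eY : \sum_(i <- B) \sum_(j <- undup C) rr (nm (f (i, j))) = rr Y.
  by rewrite rmorph_sum; apply: eq_bigr => i _; rewrite rmorph_sum.
rewrite eY in hC; have := Re_le_nm (\sum_(i <- B) t i - rr Y).
by rewrite ReD ReN Re_rr ler_norml; lra.
Qed.

Lemma hsum_swap I J (f : I * J -> CC R) s : hsum f s -> hsum (fun p => f (p.2, p.1)) s.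
Proof.
apply: (@hsum_reindex _ _ (fun p : J * I => (p.2, p.1))).
  by move=> [? ?] [? ?] [-> ->].
by move=> [i j]; exists (j, i).
Qed.

Lemma absb_swap I J (f : I * J -> CC R) M : absb f M -> absb (fun p => f (p.2, p.1)) M.
Proof.
apply: (@absb_inj _ _ (fun p : J * I => (p.2, p.1))).
by move=> [? ?] [? ?] [-> ->].
Qed.

(** Regrouping along the fibres of [phi], where [A j] lists the part of the fibre over [j] on which
    [f] may be non-zero. The family is moved to the graph of [phi] in [I * J] and summed in both
    orders. *)
Lemma hsum_fiber I J (phi : I -> J) (A : J -> seq I) (f : I -> CC R) s M :
  (forall j, uniq (A j)) -> (forall j i, i \in A j -> phi i = j) ->
  (forall i, f i != 0 -> i \in A (phi i)) -> absb f M -> hsum f s ->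
  hsum (fun j => \sum_(i <- A j) f i) s /\ absb (fun j => \sum_(i <- A j) f i) M.
Proof.
move=> uA Aphi fA fM fs.
pose F (p : I * J) := if phi p.1 == p.2 then f p.1 else 0.
have rowF i : hsum (fun j => F (i, j)) (f i).
  have := @hsum_supp J (fun j => F (i, j)) [:: phi i] isT.
  rewrite big_seq1 /F /= eqxx; apply=> j.
  by rewrite inE eq_sym; case: eqP.
have FM : absb F M.
  move=> B uB; rewrite (bigID (fun p => phi p.1 == p.2)) /= [X in _ + X]big1; last first.
    by move=> p; rewrite /F; case: eqP; rewrite ?nm0.
  rewrite addr0 -big_filter.
  apply: le_trans (_ : \sum_(p <- [seq i <- B | phi i.1 == i.2]) nm (f p.1) <= _).
    apply: ler_sum => p _; rewrite /F; case: eqP => // _; by rewrite nm0 nm_ge0.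
  rewrite -(big_map fst predT (fun i => nm (f i))); apply: fM.
  rewrite map_inj_in_uniq ?filter_uniq // => -[i j] [i' j'].
  rewrite !mem_filter /= => /andP[/eqP <- _] /andP[/eqP <- _] /= -> //.
have [s' Fs'] := hsum_ex FM.
have es : s' = s by apply: hsum_uniq (hsum_fubini rowF Fs') fs.
rewrite es in Fs'.
have colF j : hsum (fun i => (fun p => F (p.2, p.1)) (j, i)) (\sum_(i <- A j) f i).
  have -> : \sum_(i <- A j) f i = \sum_(i <- A j) F (i, j).
    rewrite big_seq [RHS]big_seq; apply: eq_bigr => i iA.
    by rewrite /F /= (Aphi _ _ iA) eqxx.
  apply: (@hsum_supp I (fun i => F (i, j))) => // i iA; rewrite /F /=.
  case: eqP => // pij; apply/eqP; apply: contraNT iA => /fA; by rewrite pij.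
split; first exact: hsum_fubini colF (hsum_swap Fs').
exact: absb_fubini colF (absb_swap FM).
Qed.

Lemma absb_mul I J (f : I -> CC R) (g : J -> CC R) M N : absb f M -> absb g N ->
  absb (fun p => f p.1 * g p.2) (M * N).
Proof.
move=> fM gN B uB.
pose B1 := undup (map fst B); pose B2 := undup (map snd B).
apply: le_trans (_ : \sum_(p <- [seq (i, j) | i <- B1, j <- B2]) nm (f p.1 * g p.2) <= _).
  apply: ler_sum_subset => //.
  - by move=> i; exact: nm_ge0.
  - by apply: allpairs_uniq; rewrite ?undup_uniq // => -[? ?] [? ?] _ _ [-> ->].
  move=> [i j] ijB; apply: allpairs_f; rewrite mem_undup.
    exact: (map_f fst ijB).
  exact: (map_f snd ijB).
rewrite big_allpairs.
have -> : \sum_(i <- B1) \sum_(j <- B2) nm (f i * g j) =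
    (\sum_(i <- B1) nm (f i)) * \sum_(j <- B2) nm (g j).
  rewrite mulr_suml; apply: eq_bigr => i _; rewrite mulr_sumr.
  by apply: eq_bigr => j _; rewrite nmM.
by apply: ler_pM; rewrite ?sumr_ge0 ?fM ?gN ?undup_uniq // => i _; exact: nm_ge0.
Qed.

Lemma hsum_mul I J (f : I -> CC R) (g : J -> CC R) s t M N : hsum f s -> hsum g t ->
  absb f M -> absb g N -> hsum (fun p => f p.1 * g p.2) (s * t).
Proof.
move=> fs gt fM gN; have [r hr] := hsum_ex (absb_mul fM gN).
suff -> : s * t = r by [].
have h2 : hsum (fun i => f i * t) (s * t).
  by rewrite mulrC; apply: hsum_ext (hsumZ t fs) => i; rewrite mulrC.
apply: hsum_uniq h2 _; apply: hsum_fubini hr => i; exact: hsumZ.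
Qed.

Lemma hsum_sum I J (f : I + J -> CC R) s t : hsum (fun i => f (inl i)) s ->
  hsum (fun j => f (inr j)) t -> hsum f (s + t).
Proof.
move=> fs ft e e0; have e2 : 0 < e / 2 by rewrite divr_gt0.
have [A hA] := fs _ e2; have [A' hA'] := ft _ e2.
exists (map inl A ++ map inr A') => B uB AB.
pose B1 := pmap (fun x : I + J => if x is inl i then Some i else None) B.
pose B2 := pmap (fun x : I + J => if x is inr i then Some i else None) B.
have -> : \sum_(i <- B) f i = \sum_(i <- B1) f (inl i) + \sum_(i <- B2) f (inr i).
  rewrite /B1 /B2; elim: B {uB AB B1 B2} => [|[i|j] B IH] /=.
  - by rewrite !big_nil addr0.
  - by rewrite !big_cons IH addrA.
  - by rewrite !big_cons IH addrCA.
have m1 i : (i \in B1) = (inl i \in B).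
  rewrite /B1; elim: B {uB AB B1 B2} => [|[i'|j'] B IH] //=; rewrite !inE IH //.
have m2 i : (i \in B2) = (inr i \in B).
  rewrite /B2; elim: B {uB AB B1 B2 m1} => [|[i'|j'] B IH] //=; rewrite !inE IH //.
have u1 : uniq B1.
  apply: (@pmap_uniq _ _ _ inl) => //; by case.
have u2 : uniq B2.
  apply: (@pmap_uniq _ _ _ inr) => //; by case.
have h1 : nm (s - \sum_(i <- B1) f (inl i)) < e / 2.
  by apply: hA => // i iA; rewrite m1; apply: AB; rewrite mem_cat map_f.
have h2 : nm (t - \sum_(i <- B2) f (inr i)) < e / 2.
  by apply: hA' => // i iA; rewrite m2; apply: AB; rewrite mem_cat map_f ?orbT.
set X := \sum_(i <- B1) _ in h1 *; set Y := \sum_(i <- B2) _ in h2 *.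
have : nm (s + t - (X + Y)) <= nm (s - X) + nm (t - Y).
  by rewrite (_ : s + t - (X + Y) = (s - X) + (t - Y)) ?nmD //; ring.
by lra.
Qed.

Lemma hsum_nat (f : nat -> CC R) s : hsum f s -> forall e, 0 < e ->
  exists N0, forall N, (N0 <= N)%N -> nm (s - \sum_(0 <= i < N) f i) < e.
Proof.
move=> fs e e0; have [A hA] := fs _ e0; exists (\max_(i <- A) i).+1 => N hN.
apply: hA; first exact: iota_uniq.
move=> i iA; rewrite mem_index_iota /=; apply: leq_trans hN; rewrite ltnS.
exact: (leq_bigmax_seq (F := id)).
Qed.

Lemma absb_nat (f : nat -> CC R) M : (forall N, \sum_(0 <= i < N) nm (f i) <= M) ->
  absb f M.
Proof.
move=> fM B uB; apply: le_trans (fM (\max_(i <- B) i).+1).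
apply: ler_sum_subset => //; [by move=> i; exact: nm_ge0|exact: iota_uniq|].
move=> i iA; rewrite mem_index_iota /= ltnS; exact: (leq_bigmax_seq (F := id)).
Qed.

Lemma hsum_shift (f : nat -> CC R) s :
  hsum (fun n => f n.+1) s -> hsum f (f 0%N + s).
Proof.
move=> fs; pose g (x : unit + nat) := if x is inr n then f n.+1 else f 0%N.
have gs : hsum g (f 0%N + s).
  apply: hsum_sum => //; have := @hsum_supp unit (fun=> f 0%N) [:: tt] isT.
  by rewrite big_seq1; apply; case.
pose h n : unit + nat := if n is m.+1 then inr m else inl tt.
apply: (@hsum_ext _ (fun n => g (h n))); first by case.
apply: hsum_reindex gs; first by case=> [|m] [|n] // [->].
by case=> [[]|n]; [exists 0%N | exists n.+1].
Qed.

End UnorderedSums.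

(** * The complex exponential and the nome *)

Section Exponential.
Variable R : realType.
Implicit Types (x y : R) (z w : CC R).

Lemma cexpD z w : cexp (z + w) = cexp z * cexp w.
Proof.
apply: CC_eq; rewrite ?ReM ?ImM /= ?ReD ?ImD expRD ?cosD ?sinD; ring.
Qed.
Lemma cexp0 : cexp (0 : CC R) = 1.
Proof. by apply: CC_eq; rewrite /= expR0 ?cos0 ?sin0 ?mulr1 ?mulr0. Qed.
Lemma nm_cexp z : nm (cexp z) = expR (complex.Re z).
Proof.
apply/eqP; rewrite -(@eqrXn2 _ 2) ?nm_ge0 ?expR_ge0 // nm_sqr /=.
apply/eqP; rewrite !exprMn -mulrDr cos2Dsin2 mulr1 //.
Qed.

Definition tpi : CC R := mkC 0 (2 * pi).

Lemma nmtpi : nm tpi = 2 * pi.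
Proof. by rewrite nm_def /= expr0n add0r sqrtr_sqr ger0_norm // mulr_ge0 // pi_ge0. Qed.

Lemma tpi_neq0 : tpi != 0.
Proof. by rewrite -nm_eq0 nmtpi mulf_neq0 // gt_eqF // pi_gt0. Qed.

Lemma nomeD z w : nome (z + w) = nome z * nome w.
Proof. by rewrite /nome mulrDr cexpD. Qed.
Lemma nome0 : nome (0 : CC R) = 1.
Proof. by rewrite /nome mulr0 cexp0. Qed.
Lemma nome1 : nome (1 : CC R) = 1.
Proof.
rewrite /nome mulr1; apply: CC_eq; rewrite /= expR0 mul1r mulr_natl ?cos2pi ?sin2pi //.
Qed.
Lemma nome_natM n z : nome (n%:R * z) = nome z ^+ n.
Proof.
elim: n => [|n IH]; first by rewrite mul0r nome0.
by rewrite -natr1 mulrDl mul1r nomeD IH exprSr.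
Qed.
Lemma nome_neq0 z : nome z != 0.
Proof. by rewrite -nm_eq0 /nome nm_cexp gt_eqF // expR_gt0. Qed.
Lemma nomeN z : nome (- z) = (nome z)^-1.
Proof.
apply: (mulIf (nome_neq0 z)); by rewrite -nomeD addNr nome0 mulVf // nome_neq0.
Qed.
Lemma nome_nat n : nome (n%:R : CC R) = 1.
Proof. by rewrite -[n%:R]mulr1 nome_natM nome1 expr1n. Qed.
Lemma nome_int (n : int) : nome (n%:~R : CC R) = 1.
Proof.
case: n => n; first exact: nome_nat.
by rewrite NegzE rmorphN nomeN nome_nat invr1.
Qed.
Lemma Re_tpi z : complex.Re (mkC 0 (2 * pi) * z) = - (2 * pi * complex.Im z).
Proof. by rewrite ReM /= mul0r sub0r. Qed.
Lemma nm_nome z : nm (nome z) = expR (- (2 * pi * complex.Im z)).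
Proof. by rewrite /nome nm_cexp Re_tpi. Qed.
Lemma nome_imag y : nome (mkC 0 y) = rr (expR (- (2 * pi * y))).
Proof.
rewrite /nome; apply: CC_eq; rewrite /= !mul0r sub0r mulr0 addr0 ?cos0 ?sin0 ?mulr1 ?mulr0 //.
Qed.
Lemma nm_nome_lt1 z : 0 < complex.Im z -> nm (nome z) < 1.
Proof. by move=> h; rewrite nm_nome expR_lt1 oppr_lt0 !mulr_gt0 // pi_gt0. Qed.

Lemma normr_expR_sub1 x : `|expR x - 1| <= `|x| * expR `|x|.
Proof.
case: (lerP 0 x) => x0.
  rewrite (ger0_norm x0) ger0_norm; last by rewrite subr_ge0 -expR0 ler_expR.
  have := expR_ge1Dx (- x); rewrite expRN => h.
  have e0 := expR_gt0 x.
  have : (1 - x) * expR x <= 1 by rewrite -ler_pdivlMr // mul1r.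
  by lra.
rewrite (ltr0_norm x0) ltr0_norm; last by rewrite subr_lt0 expR_lt1.
have := expR_ge1Dx x; have : 1 <= expR (- x) by rewrite -expR0 ler_expR; lra.
nra.
Qed.

Lemma expR_sub1Dx x : `|expR x - 1 - x| <= x ^+ 2 * expR `|x|.
Proof.
have h0 := expR_ge1Dx x; rewrite ger0_norm; last by lra.
have h1 := expR_ge1Dx (- x); have e0 := expR_gt0 x.
have ee : expR x * expR (- x) = 1 by rewrite expRxMexpNx_1.
have {h1 ee} h1 : (1 - x) * expR x <= 1 by nra.
case: (lerP 0 x) => x0; first by rewrite (ger0_norm x0); nra.
rewrite (ltr0_norm x0).
have e1 : 1 <= expR (- x) by rewrite -expR0 ler_expR; lra.
have : x ^+ 2 * 1 <= x ^+ 2 * expR (- x) by rewrite ler_wpM2l // sqr_ge0.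
have : expR x <= 1 by rewrite expR_le1; lra.
nra.
Qed.

Lemma sin_le_id x : 0 <= x -> sin x <= x.
Proof.
rewrite le_eqVlt => /orP[/eqP <-|x0]; first by rewrite sin0.
have [|c _] := MVT x0 (fun y _ => is_derive_sin y).

  by apply: continuous_subspaceT => y; exact: continuous_sin.
rewrite sin0 !subr0 => ->; rewrite -[leRHS]mul1r ler_wpM2r ?cos_le1 //; exact: ltW.
Qed.
Lemma normr_sin_le x : `|sin x| <= `|x|.
Proof.
wlog x0 : x / 0 <= x => [hw|].
  by case: (lerP 0 x) => [/hw//|x0]; rewrite -[`|x|]normrN -(normrN (sin x)) -sinN hw; lra.
rewrite (ger0_norm x0) ler_norml sin_le_id // andbT.
have [x1|x1] := lerP x 1; last by have := sin_geN1 x; lra.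
have : 0 <= sin x; last by lra.
by apply: sin_ge0_pi; have := @pi_ge2 R; lra.
Qed.
Lemma sqr_le_norm x y : `|x| <= `|y| -> x ^+ 2 <= y ^+ 2.
Proof.
by move=> h; rewrite -(real_normK (num_real x)) -(real_normK (num_real y)) lerXn2r // nnegrE.
Qed.
Lemma cos_sub1 x : `|cos x - 1| <= x ^+ 2.
Proof.
have -> : cos x = 1 - 2 * sin (x / 2) ^+ 2.
  have -> : cos x = cos (x / 2 *+ 2) by congr cos; lra.
  rewrite cos_mulr2n cos2sin2; ring.
have h := normr_sin_le (x / 2).
have : sin (x / 2) ^+ 2 <= (x / 2) ^+ 2.
  exact: sqr_le_norm.
have := sqr_ge0 (sin (x / 2)).
rewrite (_ : 1 - _ - 1 = - (2 * sin (x / 2) ^+ 2)); last by ring.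
by rewrite normrN => ? ?; rewrite ger0_norm; nra.
Qed.
Lemma sin_subx x : `|sin x - x| <= 2 * x ^+ 2.
Proof.
wlog x0 : x / 0 <= x => [hw|].
  case: (lerP 0 x) => [/hw//|x0]; have := hw (- x).
  rewrite sinN sqrrN -opprD normrN; apply; lra.
move: x0; rewrite le_eqVlt => /orP[/eqP <-|x0].
  by rewrite sin0 subrr normr0 expr0n mulr0.
have [|c ] := MVT x0 (fun y _ => is_derive_sin y).
  by apply: continuous_subspaceT => y; exact: continuous_sin.
rewrite in_itv /= => /andP[c0 cx]; rewrite sin0 !subr0 => ->.
rewrite (_ : cos c * x - x = (cos c - 1) * x); last by ring.
rewrite normrM (gtr0_norm x0) expr2 mulrA ler_wpM2r //; first exact: ltW.
have [x1|x1] := lerP x 1; first by have := cos_sub1 c => h; nra.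
by have := cos_geN1 c; have := cos_le1 c; rewrite ler_norml; lra.
Qed.

(** Real and imaginary parts are split into four pieces estimated by real bounds on exp, cos and
    sin; 5 = 1 + 1 + 1 + 2 adds up their constants. It serves both for the pole of 1/(1 - q) and for
    differentiating q-series. *)
Lemma cexp_sub1Dx z : nm (cexp z - 1 - z) <= 5 * nm z ^+ 2 * expR (nm z).
Proof.
case: z => a b; set z := Complex a b.
have ha : `|a| <= nm z by exact: (Re_le_nm z).
have hb : `|b| <= nm z by exact: (Im_le_nm z).
set r := nm z in ha hb *.
have r0 : 0 <= r by exact: nm_ge0.
have hE : expR `|a| <= expR r by rewrite ler_expR.
have E1 : 1 <= expR r by rewrite -expR0 ler_expR.
have a2 : a ^+ 2 <= r ^+ 2 by apply: sqr_le_norm; rewrite (ger0_norm r0).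
have b2 : b ^+ 2 <= r ^+ 2 by apply: sqr_le_norm; rewrite (ger0_norm r0).
have ea : expR a <= expR r by rewrite ler_expR; apply: le_trans ha; exact: ler_norm.
apply: le_trans (nm_le _) _.
rewrite !ReD !ImD !ReN !ImN /= oppr0 addr0.
have -> : expR a * cos b - 1 - a = (expR a - 1 - a) + expR a * (cos b - 1) by ring.
have -> : expR a * sin b - b = (expR a - 1) * sin b + (sin b - b) by ring.
have t1 : `|expR a - 1 - a| <= r ^+ 2 * expR r.
  by apply: le_trans (expR_sub1Dx a) _; apply: ler_pM => //; rewrite ?sqr_ge0 ?expR_ge0.
have t2 : `|expR a * (cos b - 1)| <= expR r * r ^+ 2.
  rewrite normrM (gtr0_norm (expR_gt0 a)); apply: ler_pM => //.
  exact: le_trans (cos_sub1 b) b2.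
have t3 : `|(expR a - 1) * sin b| <= r * expR r * r.
  rewrite normrM; apply: ler_pM => //; last exact: le_trans (normr_sin_le b) hb.
  by apply: le_trans (normr_expR_sub1 a) _; apply: ler_pM => //; rewrite ?expR_ge0.
have t4 : `|sin b - b| <= 2 * (r ^+ 2 * expR r).
  apply: le_trans (sin_subx b) _; rewrite ler_pM2l // -[X in X <= _]mulr1.
  by apply: ler_pM => //; exact: sqr_ge0.
have := ler_normD (expR a - 1 - a) (expR a * (cos b - 1)).
have := ler_normD ((expR a - 1) * sin b) (sin b - b).
by rewrite expr2 in t1 t2 t4 *; lra.
Qed.

End Exponential.

(** * Power series and the sums of n^k x^n *)

Section PowerSeries.
Variable R : realType.
Implicit Types (a b : nat -> CC R) (x s t : CC R) (M N : R).

Definition cauchy_prod a b (n : nat) : CC R := \sum_(0 <= i < n.+1) a i * b (n - i)%N.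

Lemma ps_mul a b x s t M N :
  hsum (fun n => a n * x ^+ n) s -> absb (fun n => a n * x ^+ n) M ->
  hsum (fun n => b n * x ^+ n) t -> absb (fun n => b n * x ^+ n) N ->
  hsum (fun n => cauchy_prod a b n * x ^+ n) (s * t) /\
  absb (fun n => cauchy_prod a b n * x ^+ n) (M * N).
Proof.
move=> hs aM ht bN.
pose A n : seq (nat * nat) := [seq (i, n - i)%N | i <- index_iota 0 n.+1].
have [|||h1 h2] := @hsum_fiber R _ _ (fun p : nat * nat => (p.1 + p.2)%N) A
  (fun p => a p.1 * x ^+ p.1 * (b p.2 * x ^+ p.2)) (s * t) (M * N) _ _ _
  (absb_mul aM bN) (hsum_mul hs ht aM bN).
- by move=> n; rewrite map_inj_uniq ?iota_uniq // => i j [].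
- move=> n [i j] /mapP[i' ]; rewrite mem_index_iota /= ltnS => h [-> ->] /=.
  by rewrite subnKC.
- move=> [i j] _ /=; apply/mapP; exists i; last by rewrite addKn.
  by rewrite mem_index_iota /= ltnS leq_addr.
have e n : \sum_(p <- A n) a p.1 * x ^+ p.1 * (b p.2 * x ^+ p.2) =
    cauchy_prod a b n * x ^+ n.
  rewrite big_map /cauchy_prod mulr_suml; apply: eq_big_nat => i /=.
  rewrite ltnS => hi; have -> : x ^+ n = x ^+ i * x ^+ (n - i) by rewrite -exprD subnKC.
  by rewrite /=; ring.
split; first exact: hsum_ext e h1.
by move: h2; rewrite (_ : (fun j => _) = fun n => cauchy_prod a b n * x ^+ n) //; apply/funext.
Qed.

Lemma ps_geom x : nm x < 1 -> hsum (fun n => 1 * x ^+ n) (1 - x)^-1 /\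
  absb (fun n => 1 * x ^+ n) (1 - nm x)^-1.
Proof.
move=> x1; have x10 : 0 < 1 - nm x by rewrite subr_gt0.
have xn1 : 1 - x != 0.
  by apply: contraTneq x1 => /eqP; rewrite subr_eq0 => /eqP <-; rewrite nm1 ltxx.
have bx : absb (fun n => 1 * x ^+ n) (1 - nm x)^-1.
  apply: absb_nat => n; rewrite (eq_bigr (fun i => nm x ^+ i)); last first.
    by move=> i _; rewrite mul1r nmX.
  rewrite -[leRHS]mul1r ler_pdivlMr // mulrC -opprB mulNr big_mkord -subrX1 opprB.
  by rewrite lerBlDr lerDl exprn_ge0 // nm_ge0.
split=> //; have [s hs] := hsum_ex bx.
suff <- : s = (1 - x)^-1 by [].
apply: (mulfI xn1); rewrite mulfV // mulrBl mul1r.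
have h2 : hsum (fun n => 1 * x ^+ n) (1 * x ^+ 0 + x * s).
  apply: hsum_shift; apply: hsum_ext (hsumZ x hs) => n; rewrite exprS; ring.
by rewrite {1}(hsum_uniq hs h2) expr0 mul1r addrK.
Qed.

(** The hockey-stick identity: it computes the Cauchy product of the binomial series with the
    geometric series. *)
Lemma sum_bin_diag (n j : nat) : (\sum_(0 <= i < n.+1) 'C(i + j, j) = 'C(n + j.+1, j.+1))%N.
Proof.
elim: n => [|n IH]; first by rewrite big_nat1 !add0n !binn.
by rewrite big_nat_recr //= IH !addSn !addnS [RHS]binS.
Qed.

Lemma ps_binom x j : nm x < 1 ->
  hsum (fun n => 'C(n + j, j)%:R * x ^+ n) ((1 - x)^-1 ^+ j.+1) /\
  absb (fun n => 'C(n + j, j)%:R * x ^+ n) ((1 - nm x)^-1 ^+ j.+1).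
Proof.
move=> x1; have [g1 g2] := ps_geom x1; elim: j => [|j [IH1 IH2]].
  rewrite !expr1; split; first by apply: hsum_ext g1 => n; rewrite addn0 bin0.
  by apply: absb_le g2 => n; rewrite addn0 bin0.
have [h1 h2] := ps_mul IH1 IH2 g1 g2; rewrite !(exprSr _ j.+1).
have e n : cauchy_prod (fun n => 'C(n + j, j)%:R) (fun=> 1) n = 'C(n + j.+1, j.+1)%:R.
  by rewrite /cauchy_prod -sum_bin_diag natr_sum; apply: eq_bigr => i _; rewrite mulr1.
split; first by apply: hsum_ext h1 => n; rewrite e.
by apply: absb_le h2 => n; rewrite e.
Qed.

(** Only the top coefficient is made explicit: it governs the pole of highest order, k + 1, of the
    sum of n^k x^n at x = 1. *)
Lemma natX_binom k : exists c : nat -> CC R, c k = k`!%:R /\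
  forall n, n%:R ^+ k = \sum_(0 <= j < k.+1) c j * 'C(n + j, j)%:R.
Proof.
elim: k => [|k [c [ck IH]]].
  by exists (fun=> 1); split=> // n; rewrite big_nat1 expr0 addn0 bin0 mulr1.
(* From n C(n+j, j) = (j+1) C(n+j+1, j+1) - (j+1) C(n+j, j). *)
exists (fun j => (if j is i.+1 then i.+1%:R * c i else 0) -
   (if (j <= k)%N then j.+1%:R * c j else 0)); split.
  by rewrite ltnn subr0 ck factS natrM.
move=> n; rewrite exprSr IH mulr_suml.
under [RHS]eq_bigr do rewrite mulrBl.
rewrite sumrB [X in _ = X - _]big_nat_recl //= mul0r add0r [X in _ =
  _ - X]big_nat_recr //= ltnn mul0r addr0.
rewrite -sumrB; apply: eq_big_nat => j /=; rewrite ltnS => hj; rewrite hj.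
have : (n + j.+1)%:R * 'C(n + j, j)%:R = j.+1%:R * 'C(n + j.+1, j.+1)%:R :> CC R.
  by rewrite -!natrM; congr _%:R; rewrite addnS -mul_bin_diag.
rewrite natrD -natr1 => e.
rewrite -[X in _ = X - _]mulrA -[X in _ = _ - X]mulrA.
rewrite (_ : (j%:R + 1) * (c j * 'C(n + j.+1, j.+1)%:R) =
  c j * ((j%:R + 1) * 'C(n + j.+1, j.+1)%:R)); last by ring.
by rewrite -e; ring.
Qed.

Lemma ps_natX k : exists c : nat -> CC R, c k = k`!%:R /\ forall x, nm x < 1 ->
  hsum (fun n => n%:R ^+ k * x ^+ n) (\sum_(0 <= j < k.+1) c j * (1 - x)^-1 ^+ j.+1).
Proof.
have [c [ck hc]] := natX_binom k; exists c; split=> // x x1.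
have := hsum_bigD (index_iota 0 k.+1) (fun j => hsumZ (c j) (ps_binom j x1).1).
by apply: hsum_ext => n; rewrite hc mulr_suml; apply: eq_bigr => j _; rewrite mulrA.
Qed.

Lemma leq_natX_binom n k : (n ^ k <= k`! * 'C(n + k, k))%N.
Proof.
elim: k => [|k IH]; first by rewrite bin0.
rewrite expnSr factS [(k.+1 * _)%N]mulnC -mulnA addnS -mul_bin_diag mulnCA mulnC.
by apply: leq_mul => //; rewrite -addnS leq_addr.
Qed.

Lemma absb_natX k x : nm x < 1 -> exists M, absb (fun n => n%:R ^+ k * x ^+ n) M.
Proof.
move=> x1; have [_ h] := ps_binom k x1.
exists (k`!%:R * (1 - nm x)^-1 ^+ k.+1) => B uB.
apply: le_trans (_ : \sum_(i <- B) k`!%:R * nm ('C(i + k, k)%:R * x ^+ i) <= _).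
  apply: ler_sum => n _; rewrite !nmM mulrA ler_wpM2r ?nm_ge0 //.
  by rewrite nmX !nm_nat -natrX -natrM ler_nat leq_natX_binom.
by rewrite -mulr_sumr ler_wpM2l // h.
Qed.

End PowerSeries.

(** * Eisenstein series and their q-expansions *)

Section LatticeSums.
Variable R : realType.
Implicit Types (z : CC R).

Definition wt (n : int) : R := ((1 + absz n)%:R ^+ 2)^-1.

Lemma wt_ge0 n : 0 <= wt n. Proof. by rewrite invr_ge0 sqr_ge0. Qed.

Lemma sum_inv_sqr N : \sum_(0 <= i < N) ((1 + i)%:R ^+ 2)^-1 <= 2 :> R.
Proof.
(* Telescoping, by 1/(y+1)^2 <= 1/y - 1/(y+1). *)
suff h n : \sum_(0 <= i < n.+1) ((1 + i)%:R ^+ 2)^-1 <= 2 - n.+1%:R^-1 :> R.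
  case: N => [|N]; first by rewrite big_nil.
  by apply: le_trans (h N) _; rewrite gerBl invr_ge0.
elim: n => [|n IH]; first by rewrite big_nat1 addn0 expr1n invr1; lra.
rewrite big_nat_recr //; move: IH; set S := \sum_(0 <= i < _) _.
rewrite [(1 + n.+1)%N]add1n -[n.+2%:R]natr1.
set y : R := n.+1%:R; have y0 : 0 < y by rewrite ltr0n.
have : ((y + 1) ^+ 2)^-1 <= y^-1 - (y + 1)^-1.
  have -> : y^-1 - (y + 1)^-1 = (y * (y + 1))^-1.
    have y1 : y + 1 != 0 by rewrite gt_eqF //; lra.
    have yn : y != 0 by rewrite gt_eqF.
    by rewrite -[y^-1]mul1r -[(y + 1)^-1]mul1r -mulNr addf_div // invfM; ring.
  by rewrite lef_pV2 ?posrE; nra.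
by move=> h1 h2; apply: le_trans (lerD h2 h1) _; rewrite addrA subrK.
Qed.

Lemma absb_wt : absb (fun n => rr (wt n)) (4 : R).
Proof.
move=> B uB; have [N hN] : exists N, forall i, i \in B -> (absz i < N)%N.
  by exists (\max_(i <- B) absz i).+1 => i iB; rewrite ltnS (leq_bigmax_seq (F := absz)).
rewrite (eq_bigr wt); last by move=> i _; rewrite nm_rr ger0_norm // wt_ge0.
apply: le_trans (_ : \sum_(i <- map Posz (index_iota 0 N) ++ map Negz (index_iota 0 N)) wt i <= _).
  apply: ler_sum_subset => //; first exact: wt_ge0.
    rewrite cat_uniq !map_inj_uniq ?iota_uniq //=; try by move=> ? ? [].
    by rewrite andbT; apply/hasPn => _ /mapP[i _ ->]; apply/mapP => -[].
  move=> i iB; have hi := hN i iB.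
  rewrite mem_cat; case: i iB hi => n _ hn; apply/orP; [left|right]; apply: map_f.
    by rewrite mem_index_iota.
  by rewrite mem_index_iota /=; apply: leq_trans hn.
rewrite big_cat !big_map /=.
have h1 := sum_inv_sqr N.
have : \sum_(0 <= j < N) wt (Negz j) <= \sum_(0 <= i < N) ((1 + i)%:R ^+ 2)^-1.
  apply: ler_sum => i _; rewrite /wt lef_pV2 ?posrE ?exprn_gt0 ?ltr0n //.
  by rewrite lerXn2r ?nnegrE ?ler0n // ler_nat /=.
have -> : \sum_(0 <= j < N) wt (Posz j) = \sum_(0 <= i < N) ((1 + i)%:R ^+ 2)^-1 by [].
lra.
Qed.

(** |m| Im z <= |m z + n| and |n| <= |m z + n| + |m| |z| bound |m| + |n| by a multiple of |m z + n|.
    The product form on the left lets the lattice sum be dominated by a product of two sums of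
    [wt]. *)
Lemma lattice_lb z : 0 < complex.Im z -> exists2 d : R, 0 < d & forall m n : int,
  (m, n) != 0 -> d * ((1 + absz m)%:R * (1 + absz n)%:R) <= nm (m%:~R * z + n%:~R) ^+ 2.
Proof.
set y := complex.Im z => y0.
pose d0 : R := 1 / y + 1 + nm z / y.
have z1 : 0 <= nm z / y by rewrite divr_ge0 ?nm_ge0 // ltW.
have d00 : 0 < d0 by rewrite /d0 ltr_wpDr // addr_gt0 // divr_gt0.
exists ((d0 ^+ 2 * 4)^-1); first by rewrite invr_gt0 mulr_gt0 // exprn_gt0.
move=> m n mn0; set v := nm _; set a : R := (absz m)%:R; set b : R := (absz n)%:R.
have aE : `|m%:~R : R| = a by rewrite /a natr_absz intr_norm.
have bE : `|n%:~R : R| = b by rewrite /b natr_absz intr_norm.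
have a0 : 0 <= a by exact: ler0n.
have b0 : 0 <= b by exact: ler0n.
have v0 : 0 <= v by exact: nm_ge0.
have h1 : y * a <= v.
  have := Im_le_nm (m%:~R * z + n%:~R).
  by rewrite ImD ImM Re_int !Im_int mul0r !addr0 normrM aE -/y (gtr0_norm y0) mulrC.
have h2 : b <= v + a * nm z.
  have := nm_lbD (n%:~R : CC R) (m%:~R * z).
  by rewrite [_ + m%:~R * z]addrC -/v nmM !nm_int aE bE; lra.
have h3 : a + b <= v * d0.
  have ya : a <= v / y by rewrite ler_pdivlMr // mulrC.
  have : a * nm z <= v / y * nm z by rewrite ler_wpM2r ?nm_ge0.
  rewrite /d0 !mulrDr mulr1 mul1r [v * (nm z / y)]mulrCA; lra.
have s1 : 1 <= a + b.
  rewrite /a /b -natrD ler1n addn_gt0 !absz_gt0; move: mn0.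
  by rewrite -[(m, n) == 0]/((m == 0) && (n == 0)) negb_and.
rewrite ler_pdivrMl ?mulr_gt0 ?exprn_gt0 // !natrD -/a -/b.
have : (a + b) ^+ 2 <= (v * d0) ^+ 2 by rewrite lerXn2r // nnegrE; nra.
rewrite exprMn; nra.
Qed.

Lemma absb_lattice (j : nat) z : (2 <= j)%N -> 0 < complex.Im z ->
  exists M, absb (fun p : int * int => (p.1%:~R * z + p.2%:~R) ^- (2 * j)) M.
Proof.
move=> j2 z0; have [d d0 hd] := lattice_lb z0.
exists (d^-1 ^+ j * (4 * 4)) => B uB.
apply: le_trans (_ : \sum_(p <- B) d^-1 ^+ j * nm (rr (wt p.1) * rr (wt p.2)) <= _); last first.
  rewrite -mulr_sumr ler_wpM2l //; first by rewrite exprn_ge0 // invr_ge0 ltW.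
  by have := absb_mul absb_wt absb_wt; apply.
apply: ler_sum => -[m n] _ /=.
rewrite nmM !nm_rr !ger0_norm ?wt_ge0 // nmV nmX exprM exprVn.
(* The origin contributes 0, because the exponent is positive and the inverse of 0 is 0. *)
have [/eqP[-> ->]|mn0] := boolP ((m, n) == 0).
  rewrite mul0r add0r nm0 expr0n /= expr0n (_ : (j == 0)%N = false) ?invr0; last by lia.
  by rewrite mulr_ge0 ?mulr_ge0 ?wt_ge0 // invr_ge0 exprn_ge0 // ltW.
have h := hd m n mn0; set v := nm _ ^+ 2 in h *.
rewrite /wt -!invfM -exprMn.
set e : R := (1 + absz m)%:R * (1 + absz n)%:R in h *.
have e1 : 1 <= e by rewrite /e -natrM ler1n muln_gt0.
have e0 : 0 < e by lra.
have p0 : 0 < d ^+ j * e ^+ 2 by rewrite mulr_gt0 ?exprn_gt0.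
have le1 : d ^+ j * e ^+ 2 <= v ^+ j.
  apply: le_trans (_ : (d * e) ^+ j <= _); last by rewrite lerXn2r // nnegrE; nra.
  rewrite [(d * e) ^+ j]exprMn ler_wpM2l ?exprn_ge0 ?(ltW d0) //; exact: ler_weXn2l.
by rewrite lef_pV2 ?posrE //; apply: lt_le_trans le1.
Qed.

Definition sumC (I : eqType) (f : I -> CC R) : CC R := xget 0 [set s | hsum f s]%classic.

Lemma sumCP (I : eqType) (f : I -> CC R) M : absb f M -> hsum f (sumC f).
Proof. by move=> /hsum_ex [s hs]; rewrite /sumC; case: xgetP => [_ -> //|/(_ s)]. Qed.

Lemma sumC_eq (I : eqType) (f : I -> CC R) s : hsum f s -> sumC f = s.
Proof.
move=> hs; apply: (hsum_uniq _ hs); rewrite /sumC; case: xgetP => [_ -> //|/(_ s)] //.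
Qed.

End LatticeSums.

(** * The strip |Re z| <= 1/2 and the pole of 1/(1 - q) *)

Section Strip.
Variable R : realType.
Implicit Types (x y : R) (z : CC R).

Definition strip z := (0 < complex.Im z) && (`|complex.Re z| <= 2^-1).

Lemma sin_lb x : `|x| <= 2^-1 -> x ^+ 2 / 4 <= sin (pi * x) ^+ 2.
Proof.
wlog x0 : x / 0 <= x => [hw|].
  case: (lerP 0 x) => [/hw//|x0] hx; have := hw (- x).
  rewrite mulrN sinN !sqrrN normrN; apply=> //; lra.
rewrite (ger0_norm x0) => x2; have p2 := @pi_ge2 R.
(* The half angle stays below pi/4, where cos is at least 1/2; the mean value theorem then gives sin
   t >= t/2, and the double angle formula returns to pi x. *)
pose t := pi * x / 2.
have t0 : 0 <= t by rewrite /t; nra.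
have tp : t <= pi / 4 by rewrite /t; nra.
have c2t : 0 <= cos (t *+ 2) by apply: cos_ge0_pihalf; rewrite [t *+ 2]mulr2n; apply/andP; split; lra.
have ct : 2^-1 <= cos t.
  have h0 : 0 <= cos t by apply: cos_ge0_pihalf; apply/andP; split; lra.
  rewrite cos_mulr2n -mulr_natl in c2t; nra.
have st : t / 2 <= sin t.
  have [<-|tn0] := eqVneq 0 t; first by rewrite sin0 mul0r.
  have t00 : 0 < t by rewrite lt_neqAle tn0.
  have [|c ] := MVT t00 (fun y _ => is_derive_sin y).
    by apply: continuous_subspaceT => y; exact: continuous_sin.
  rewrite in_itv /= => /andP[c0 cx]; rewrite sin0 !subr0 => ->.
  have h0 : 0 <= cos c by apply: cos_ge0_pihalf; apply/andP; split; lra.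
  have h1 : 0 <= cos (c *+ 2) by apply: cos_ge0_pihalf; rewrite [c *+ 2]mulr2n; apply/andP; split; lra.
  rewrite cos_mulr2n -mulr_natl in h1.
  have : 2^-1 <= cos c by nra.
  nra.
have -> : pi * x = t *+ 2 by rewrite [t *+ 2]mulr2n /t; lra.
rewrite sin_mulr2n -mulr_natl.
have h : x / 2 <= t / 2 by rewrite /t; nra.
have : x / 2 <= 2 * (cos t * sin t) by nra.
move=> h2; have : (x / 2) ^+ 2 <= (2 * (cos t * sin t)) ^+ 2 by rewrite lerXn2r // nnegrE; nra.
by rewrite expr_div_n; lra.
Qed.

Lemma nm_sub1_nome z : nm (1 - nome z) ^+ 2 =
  (1 - expR (- (2 * pi * complex.Im z))) ^+ 2 +
  4 * expR (- (2 * pi * complex.Im z)) * sin (pi * complex.Re z) ^+ 2.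
Proof.
case: z => x y; rewrite nm_sqr ReD ImD ReN ImN /= !mul0r !sub0r !add0r sqrrN.
set e := expR _; have -> : 2 * pi * x = (pi * x) *+ 2 by rewrite -[(pi * x) *+ 2]mulr_natl; ring.
rewrite cos_mulr2n sin_mulr2n.
have := cos2Dsin2 (pi * x); set c := cos _; set s := sin _ => h.
have -> : c ^+ 2 = 1 - s ^+ 2 by rewrite -h addrK.
have -> : (e * ((c * s) *+ 2)) ^+ 2 = 4 * e ^+ 2 * c ^+ 2 * s ^+ 2 by rewrite -mulr_natl; ring.
have -> : c ^+ 2 = 1 - s ^+ 2 by rewrite -h addrK.
rewrite -mulr_natl; ring.
Qed.

(** The modulus of q on the line Im z = 1. *)
Definition e0 : R := expR (- (2 * pi)).
Lemma e0_gt0 : 0 < e0. Proof. exact: expR_gt0. Qed.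
Lemma e0_lt1 : e0 < 1. Proof. by rewrite expR_lt1; have := @pi_gt0 R; lra. Qed.

(** In |1 - q|^2 = (1 - |q|)^2 + 4 |q| sin(pi Re z)^2 the first square controls Im z and the second
    summand controls Re z. *)
Lemma nm_sub1_nome_lb z : strip z -> complex.Im z <= 1 -> e0 * nm z <= nm (1 - nome z).
Proof.
move=> /andP[y0 x2] y1; rewrite -(@ler_pXn2r _ 2) ?nnegrE ?nm_ge0 //; last first.
  by rewrite mulr_ge0 ?nm_ge0 // ltW // e0_gt0.
rewrite nm_sub1_nome exprMn nm_sqr; have := sin_lb x2.
set x := complex.Re z in x2 *; set y := complex.Im z in y0 y1 *.
set S := sin _ ^+ 2 => hS; set e := expR _; have e00 := e0_gt0; have e01 := e0_lt1.
have pi0 := @pi_ge2 R.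
have ee : e0 <= e by rewrite ler_expR; nra.
have e1 : y * e0 <= 1 - e.
  have h := expR_ge1Dx (2 * pi * y).
  have : e * expR (2 * pi * y) = 1 by rewrite mulrC expRxMexpNx_1.
  have : 0 < e by exact: expR_gt0.
  have p1 : y <= 2 * pi * y by nra.
  nra.
have h1 : (y * e0) ^+ 2 <= (1 - e) ^+ 2 by rewrite lerXn2r // nnegrE; nra.
have h2 : e0 ^+ 2 * x ^+ 2 <= 4 * e * S.
  have : e0 ^+ 2 <= e by nra.
  have := sqr_ge0 x; nra.
by rewrite mulrDr addrC; apply: lerD h2; rewrite -exprMn mulrC.
Qed.

(* [u = 1/(1-q)] has principal part [-1/(2 pi i z)] at [z = 0]. *)
Lemma inv_sub1_nome : exists A : R, 0 <= A /\ forall z, strip z ->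
  nm ((1 - nome z)^-1 + (tpi R * z)^-1) <= A.
Proof.
have e00 := e0_gt0; have e01 := e0_lt1; have p2 := @pi_ge2 R.
exists (10 * pi * expR (4 * pi) / e0 + ((1 - e0)^-1 + 1)).
have E0 : 0 < expR (4 * pi : R) by exact: expR_gt0.
have t1 : 0 <= 10 * pi * expR (4 * pi) / e0.
  by rewrite divr_ge0 ?(ltW e00) // !mulr_ge0 //; lra.
have t2 : 0 <= (1 - e0)^-1 by rewrite invr_ge0; lra.
split; first by lra.
move=> z lipschitz_defect; have /andP[y0 x2] := lipschitz_defect.
have z0 : z != 0 by apply: contraTneq y0 => ->; rewrite ltxx.
have nz0 : 0 < nm z by rewrite nm_gt0.
have q1 : 1 - nome z != 0.
  apply: contraTneq (nm_nome_lt1 y0) => /eqP; rewrite subr_eq0 => /eqP <-.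
  by rewrite nm1 ltxx.
have [y1|y1] := lerP (complex.Im z) 1.
  rewrite -[leLHS]addr0; apply: lerD; last by lra.
  have w0 : tpi R * z != 0 by rewrite mulf_neq0 ?tpi_neq0.
  rewrite -[(1 - _)^-1]mul1r -[(_ * z)^-1]mul1r addf_div // !mul1r nmM nmV.
  have nq0 : 0 < nm (1 - nome z) by rewrite nm_gt0.
  rewrite ler_pdivrMr ?nm_gt0 ?mulf_neq0 ?tpi_neq0 //.
  have -> : tpi R * z + (1 - nome z) = - (cexp (tpi R * z) - 1 - tpi R * z).
    by rewrite /nome -/(tpi R); ring.
  rewrite nmN; apply: le_trans (cexp_sub1Dx _) _.
  rewrite !nmM nmtpi.
  have zz : nm z <= 2.
    by have := nm_le z; rewrite (gtr0_norm y0) => /le_trans; apply; lra.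
  have h1 : expR (2 * pi * nm z) <= expR (4 * pi) by rewrite ler_expR; nra.
  have h2 := nm_sub1_nome_lb lipschitz_defect y1.
  apply: (@le_trans _ _ (5 * (2 * pi * nm z) ^+ 2 * expR (4 * pi))).
    by rewrite ler_wpM2l // mulr_ge0 // sqr_ge0.
  have -> : 5 * (2 * pi * nm z) ^+ 2 * expR (4 * pi) =
     10 * pi * expR (4 * pi) / e0 * (e0 * nm z * (2 * pi * nm z)).
    by field; rewrite gt_eqF.
  rewrite ler_wpM2l // ler_wpM2r //; nra.
rewrite -[leLHS]add0r; apply: lerD => //.
apply: le_trans (nmD _ _) _; apply: lerD; rewrite nmV.
  have h : 1 - e0 <= nm (1 - nome z).
    have := nm_lbD 1 (- nome z); rewrite nm1 nmN nm_nome => h.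
    have : expR (- (2 * pi * complex.Im z)) <= e0 by rewrite ler_expR; nra.
    lra.
  by rewrite lef_pV2 ?posrE ?nm_gt0 //; lra.
rewrite invf_le1 ?nm_gt0 ?mulf_neq0 ?tpi_neq0 // nmM nmtpi.
have := Im_le_nm z; rewrite (gtr0_norm y0); nra.
Qed.

End Strip.

(** * The Lipschitz formula *)

Section Lipschitz.
Variable R : realType.
Variables j k : nat.
Hypotheses (j2 : (2 <= j)%N) (kE : k = (2 * j)%N).
Implicit Types (x y : R) (z w : CC R).

Lemma k_ge4 : (4 <= k)%N. Proof. by rewrite kE; lia. Qed.
Lemma k_pred : k = k.-1.+1. Proof. by have := k_ge4; case: k. Qed.

Lemma exprD_le (a b : R) n : 0 <= a -> 0 <= b -> (a + b) ^+ n <= 2 ^+ n * (a ^+ n + b ^+ n).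
Proof.
move=> a0 b0; wlog ab : a b a0 b0 / a <= b => [hw|].
  have [/hw|/ltW/hw] := lerP a b; first exact.
  by rewrite [b + a]addrC [b ^+ n + _]addrC; apply.
apply: (@le_trans _ _ ((2 * b) ^+ n)); first by rewrite lerXn2r // ?nnegrE; lra.
by rewrite exprMn ler_wpM2l ?exprn_ge0 // lerDr exprn_ge0.
Qed.

Lemma subXX_le (u v : CC R) (A B : R) n : nm (u - v) <= A -> nm u <= B -> nm v <= B ->
  nm (u ^+ n.+1 - v ^+ n.+1) <= A * (n.+1%:R * B ^+ n).
Proof.
move=> hA hu hv; rewrite subrXX nmM; apply: ler_pM; rewrite ?nm_ge0 //.
apply: le_trans (nm_sum _ _ _) _.
rewrite -[X in X%:R * _]card_ord -sum1_card natr_sum mulr_suml.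
apply: ler_sum => i _; rewrite mul1r nmM !nmX /=.
have -> : B ^+ n = B ^+ (n - i) * B ^+ i by rewrite -exprD subnK // -ltnS.
by apply: ler_pM; rewrite ?exprn_ge0 ?nm_ge0 // lerXn2r // nnegrE ?nm_ge0 //;
  apply: le_trans hu; rewrite nm_ge0.
Qed.

Definition lattice_sum z : CC R := sumC (fun n : int => (z + n%:~R) ^- k).
Definition power_series (q : CC R) : CC R := sumC (fun r : nat => r%:R ^+ k.-1 * q ^+ r).
(** The constant (-2 pi i)^k / (k-1)! of the Lipschitz formula, k being even. *)
Definition lipschitz_const : CC R := tpi R ^+ k / k.-1`!%:R.

Lemma absb_lattice_sum z : 0 < complex.Im z -> exists M, absb (fun n : int => (z + n%:~R) ^- k) M.
Proof.
move=> z0; have [M hM] := absb_lattice j2 z0; exists M; rewrite -kE in hM.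
have inj : injective (fun n : int => (1 : int, n)) by move=> ? ? [].
by apply: absb_le (absb_inj inj hM) => n; rewrite /= mul1r.
Qed.

Lemma lattice_sum_sum z : 0 < complex.Im z -> hsum (fun n : int => (z + n%:~R) ^- k) (lattice_sum z).
Proof. by move=> /absb_lattice_sum [M /sumCP]. Qed.

Lemma power_series_sum q : nm q < 1 -> hsum (fun r : nat => r%:R ^+ k.-1 * q ^+ r) (power_series q).
Proof. by move=> /(absb_natX k.-1)[M /sumCP]. Qed.

(** In the strip |z + n| >= (1 + |n|)/4 for every n other than 0, so z^(-k) is the only term that
    can be large. *)
Lemma lattice_sum_strip z : strip z -> nm (lattice_sum z - z ^- k) <= 4 ^+ k * 4.
Proof.
move=> /andP[y0 x2].
have h1 : hsum (fun n : int => if n == 0 then z ^- k else 0) (z ^- k).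
  have := @hsum_supp R _ (fun n : int => if n == 0 then z ^- k else 0) [:: 0] isT.
  by rewrite big_seq1 eqxx; apply=> n; rewrite inE => /negbTE ->.
apply: hsum_le (hsumB (lattice_sum_sum y0) h1) _ => B uB.
apply: le_trans (_ : \sum_(n <- B) 4 ^+ k * nm (rr (wt R n)) <= _); last first.
  by rewrite -mulr_sumr ler_wpM2l ?exprn_ge0 // absb_wt.
apply: ler_sum => n _; rewrite nm_rr ger0_norm ?wt_ge0 //.
have [->|n0] := eqVneq n 0.
  by rewrite addr0 subrr nm0 mulr_ge0 ?exprn_ge0 ?wt_ge0.
rewrite subr0 nmV nmX.
set a : R := (1 + absz n)%:R; have a0 : 0 < a by rewrite ltr0n.
have a1 : 1 <= a by rewrite ler1n.
have h : a / 4 <= nm (z + n%:~R).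
  have := Re_le_nm (z + n%:~R); rewrite ReD Re_int; apply: le_trans.
  have : `|n%:~R : R| - `|complex.Re z| <= `|complex.Re z + n%:~R|.
    by rewrite [complex.Re z + _]addrC; exact: lerB_normD.
  have -> : `|n%:~R : R| = a - 1 by rewrite /a natrD addrAC subrr add0r natr_absz intr_norm.
  have : 2 <= a by rewrite /a ler_nat; move: n0; case: n {a a0 a1 h1} => [[]|].
  lra.
have a4 : 0 < a / 4 by rewrite divr_gt0.
apply: (@le_trans _ _ ((a / 4) ^- k)).
  rewrite lef_pV2 ?posrE ?exprn_gt0 //; last exact: lt_le_trans h.
  by rewrite lerXn2r // nnegrE ltW //; exact: lt_le_trans h.
rewrite expr_div_n invf_div ler_wpM2l ?exprn_ge0 // /wt -/a.
by rewrite lef_pV2 ?posrE ?exprn_gt0 // ler_weXn2l // (leq_trans _ k_ge4).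
Qed.

(** The series is a polynomial of degree k in u = 1/(1 - q), with top coefficient (k-1)!. As u =
    -1/(2 pi i z) + O(1), its top term reproduces z^(-k) up to a pole of order k - 1, and the lower
    powers of u have at most that order. *)
Lemma power_series_strip : exists B : R, forall z, strip z ->
  nm (lipschitz_const * power_series (nome z) - z ^- k) <= B * (1 + (nm z)^-1 ^+ k.-1).
Proof.
have [A [A0 hA]] := inv_sub1_nome R.
have [c [ck hc]] := ps_natX R k.-1.
pose B1 := nm (k.-1`!%:R : CC R) * (A * k%:R) + \sum_(0 <= i < k.-1) nm (c i).
have B10 : 0 <= B1.
  by rewrite addr_ge0 ?sumr_ge0 ?mulr_ge0 ?nm_ge0 ?ler0n // => i _; exact: nm_ge0.
exists (nm lipschitz_const * (B1 * (2 ^+ k.-1 * (1 + A) ^+ k.-1))) => z lipschitz_defect.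
have /andP[y0 x2] := lipschitz_defect.
have z0 : z != 0 by apply: contraTneq y0 => ->; rewrite ltxx.
set nu := (nm z)^-1.
have nu0 : 0 <= nu by rewrite invr_ge0 nm_ge0.
have q1 := nm_nome_lt1 y0.
have -> : power_series (nome z) = _ := hsum_uniq (power_series_sum q1) (hc _ q1).
set u := (1 - nome z)^-1; set v := - (tpi R * z)^-1.
have uv : nm (u - v) <= A by rewrite opprK; exact: hA.
have hv : nm v <= 1 + A + nu.
  rewrite nmN nmV nmM nmtpi invfM -/nu; have := @pi_ge2 R => p2.
  have : (2 * pi)^-1 <= (1 : R) by rewrite invf_le1; lra.
  have : 0 <= (2 * pi : R)^-1 by rewrite invr_ge0; lra.
  nra.
have hu : nm u <= 1 + A + nu.
  have : nm v <= 1 + nu.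
    rewrite nmN nmV nmM nmtpi invfM -/nu; have := @pi_ge2 R => p2.
    have : (2 * pi)^-1 <= (1 : R) by rewrite invf_le1; lra.
    have : 0 <= (2 * pi : R)^-1 by rewrite invr_ge0; lra.
    nra.
  by have := nmD (u - v) v; rewrite subrK; lra.
(* The sign in [v] disappears because [k] is even. *)
have -> : z ^- k = lipschitz_const * (k.-1`!%:R * v ^+ k).
  have f0 : (k.-1`!%:R : CC R) != 0 by rewrite pnatr_eq0 -lt0n fact_gt0.
  have -> : v ^+ k = (tpi R * z) ^- k.
    by rewrite /v exprNn -signr_odd [in odd _]kE oddM expr0 mul1r exprVn.
  rewrite /lipschitz_const exprMn invfM !mulrA divfK // mulfV ?mul1r //.
  by rewrite expf_neq0 // tpi_neq0.
rewrite -mulrBr nmM -[leRHS]mulrA ler_wpM2l ?nm_ge0 //.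
rewrite big_nat_recr //= ck -k_pred -addrA -mulrBr.
set X := 1 + A + nu.
have X1 : 1 <= X by rewrite /X; lra.
apply: (@le_trans _ _ (B1 * X ^+ k.-1)); last first.
  rewrite -!mulrA ler_wpM2l //; apply: le_trans (exprD_le _ _ _) _ => //; first by lra.
  rewrite ler_wpM2l ?exprn_ge0 //.
  have h : 1 <= (1 + A) ^+ k.-1 by rewrite exprn_ege1 //; lra.
  have : 0 <= nu ^+ k.-1 by rewrite exprn_ge0.
  by rewrite mulrDr mulr1; nra.
rewrite /B1 mulrDl [leRHS]addrC; apply: le_trans (nmD _ _) _; apply: lerD.
  rewrite mulr_suml; apply: le_trans (nm_sum _ _ _) _.
  rewrite big_nat [leRHS]big_nat; apply: ler_sum => i /andP[_ ik].
  rewrite nmM nmX ler_wpM2l ?nm_ge0 //.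
  apply: (@le_trans _ _ (X ^+ i.+1)); first by rewrite lerXn2r // nnegrE ?nm_ge0 //; lra.
  by rewrite ler_weXn2l.
rewrite nmM -mulrA ler_wpM2l ?nm_ge0 //.
have := @subXX_le u v A X k.-1 uv hu hv; rewrite -k_pred => h.
by rewrite -mulrA.
Qed.

Definition lipschitz_defect z := lattice_sum z - lipschitz_const * power_series (nome z).

(** The poles z^(-k) of both sides cancel. The drop of the order to k - 1 is what makes duplication
    contract: it costs 2^(k-1) against the factor 2^k of the formula. *)
Lemma lipschitz_defect_strip : exists A : R, 0 <= A /\ forall z, strip z ->
  nm (lipschitz_defect z) <= A * ((nm z)^-1 ^+ k.-1 + 4 ^+ k.-1).
Proof.
have [B hB] := power_series_strip; exists (`|B| + 4 ^+ k * 4); split.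
  by rewrite addr_ge0 // mulr_ge0 ?exprn_ge0.
move=> z sz; have := lattice_sum_strip sz; have := hB z sz.
set a := _ ^+ k.-1; set b : R := 4 ^+ k.-1; set f := 4 ^+ k * 4 => h1 h2.
have a0 : 0 <= a by rewrite exprn_ge0 // invr_ge0 nm_ge0.
have b1 : 1 <= b by rewrite exprn_ege1 //; lra.
have f0 : 0 <= f by rewrite mulr_ge0 ?exprn_ge0.
have : nm (lipschitz_defect z) <=
  nm (lattice_sum z - z ^- k) + nm (lipschitz_const * power_series (nome z) - z ^- k).
  by rewrite /lipschitz_defect (_ : _ - _ =
    (lattice_sum z - z ^- k) - (lipschitz_const * power_series (nome z) - z ^- k)) ?nmDB //; ring.
have : B * (1 + a) <= `|B| * (1 + a) by rewrite ler_wpM2r ?ler_norm //; lra.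
have := normr_ge0 B; nra.
Qed.

Lemma lipschitz_defect_periodic z (n : int) : 0 < complex.Im z -> lipschitz_defect (z + n%:~R) =
  lipschitz_defect z.
Proof.
move=> z0; rewrite /lipschitz_defect.
have -> : nome (z + n%:~R) = nome z by rewrite nomeD nome_int mulr1.
suff -> : lattice_sum (z + n%:~R) = lattice_sum z by [].
have zn0 : 0 < complex.Im (z + n%:~R) by rewrite ImD Im_int addr0.
apply: hsum_uniq (lattice_sum_sum zn0) _.
have inj : injective (fun m : int => n + m) by move=> a b /addrI.
have sur i : exists m, i = n + m by exists (i - n); rewrite addrC subrK.
apply: hsum_ext (hsum_reindex inj sur (lattice_sum_sum z0)) => m.
by rewrite rmorphD /= addrA.
Qed.

Lemma nome_half : nome (2^-1 : CC R) = -1.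
Proof.
have -> : (2^-1 : CC R) = rr 2^-1 by rewrite fmorphV rmorph_nat.
have h : 2 * pi * 2^-1 = pi :> R by lra.
rewrite /nome; apply: CC_eq; rewrite ?ReN ?ImN.
  by rewrite /= !(mul0r, mulr0, subr0, expR0, mul1r, add0r) h cospi oppr0 expR0 mul1r.
by rewrite /= !(mul0r, mulr0, subr0, expR0, mul1r, add0r) h sinpi !mulr0 oppr0.
Qed.

(** On the lattice side the integers split into even and odd ones; on the series side the arguments
    are p and -p with p^2 = q, and adding them kills the odd powers of p. *)
Lemma lipschitz_defect_dup z : 0 < complex.Im z -> 2 ^+ k * lipschitz_defect z =
  lipschitz_defect (z / 2) + lipschitz_defect ((z + 1) / 2).
Proof.
move=> z0; have two0 : (2 : CC R) != 0 by rewrite pnatr_eq0.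
have half : (2^-1 : CC R) = rr 2^-1 by rewrite fmorphV rmorph_nat.
have i1 : 0 < complex.Im (z / 2).
  by rewrite half ImM /= mulr0 add0r divr_gt0.
have i2 : 0 < complex.Im ((z + 1) / 2).
  by rewrite half ImM ImD /= addr0 mulr0 add0r divr_gt0.
have -> : 2 ^+ k * lipschitz_defect z =
  2 ^+ k * lattice_sum z - lipschitz_const * (2 ^+ k * power_series (nome z)) by rewrite
    /lipschitz_defect; ring.
rewrite /lipschitz_defect addrACA -opprD -mulrDr; congr (_ - _ * _).
- pose h (s : int + int) : int := match s with inl n => 2 * n | inr n => 2 * n + 1 end.
  have inj : injective h.
    by case=> [a|a] [b|b] /= e; try (congr (_ _); lia); lia.
  have sur i : exists m, i = h m.
    have := divz_eq i 2; have : 0 <= (i %% 2)%Z by rewrite modz_ge0.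
    have : (i %% 2 < 2)%Z by rewrite ltz_pmod.
    set q := (i %/ 2)%Z; set r := (i %% 2)%Z => r2 r0 e.
    have [r1|r1] := eqVneq r 0; first by exists (inl q); rewrite /=; lia.
    by exists (inr q); rewrite /=; lia.
  apply: hsum_uniq (hsum_reindex inj sur (hsumZ (2 ^+ k) (lattice_sum_sum z0))) _.
  apply: hsum_sum.
    apply: hsum_ext (lattice_sum_sum i1) => n /=.
    have -> : z / 2 + n%:~R = (z + (2 * n)%:~R) / 2 by rewrite rmorphM /=; field.
    by rewrite expr_div_n invf_div.
  apply: hsum_ext (lattice_sum_sum i2) => n /=.
  have -> : (z + 1) / 2 + n%:~R = (z + (2 * n + 1)%:~R) / 2.
    by rewrite rmorphD rmorphM /=; field.
  by rewrite expr_div_n invf_div.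
set p := nome (z / 2).
have -> : nome ((z + 1) / 2) = - p by rewrite mulrDl nomeD mul1r nome_half mulrN1.
have -> : nome z = p ^+ 2 by rewrite -nome_natM mulrC divfK.
have p1 : nm p < 1 by exact: nm_nome_lt1.
have p2 : nm (- p) < 1 by rewrite nmN.
have p3 : nm (p ^+ 2) < 1 by rewrite nmX exprn_ilt1 ?nm_ge0.
pose h (s : nat + nat) : nat := match s with inl n => 2 * n | inr n => 2 * n + 1 end%N.
have inj : injective h.
  by case=> [a|a] [b|b] /= e; try (congr (_ _); lia); lia.
have sur i : exists m, i = h m.
  exists (if odd i then inr i./2 else inl i./2).
  by have := odd_double_half i; case: (odd i) => /= <-; lia.
apply: hsum_uniq _ (hsum_reindex inj sur (hsumD (power_series_sum p1) (power_series_sum p2))).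
rewrite -[X in hsum _ X]addr0; apply: hsum_sum.
  apply: hsum_ext (hsumZ (2 ^+ k) (power_series_sum p3)) => n /=.
  have -> : (- p) ^+ (2 * n) = p ^+ (2 * n) by rewrite exprM sqrrN -exprM.
  have -> : 2 ^+ k = 2 * 2 ^+ k.-1 :> CC R by rewrite {1}k_pred exprS.
  rewrite [p ^+ (2 * n)]exprM natrM [(2%:R * n%:R) ^+ _]exprMn; set a := 2 ^+ k.-1;
    set b := n%:R ^+ k.-1; ring.
apply: (@hsum_ext _ _ (fun=> 0)).
  by move=> n /=; rewrite exprNn -signr_odd oddD oddM /= expr1; ring.
by have := @hsum_supp R nat (fun=> 0) [::] isT; rewrite big_nil; apply.
Qed.

(* The duplication formula halves the constant [A] of the bound at each step. *)
Lemma dup_bounded_eq0 (h : CC R -> CC R) (A : R) : 0 <= A ->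
  (forall z, strip z -> nm (h z) <= A * ((nm z)^-1 ^+ k.-1 + 4 ^+ k.-1)) ->
  (forall z (n : int), 0 < complex.Im z -> h (z + n%:~R) = h z) ->
  (forall z, 0 < complex.Im z -> 2 ^+ k * h z = h (z / 2) + h ((z + 1) / 2)) ->
  forall z, strip z -> h z = 0.
Proof.
move=> A0 hA lipschitz_defect_periodic lipschitz_defect_dup z sz.
have key : forall n z, strip z -> nm (h z) <= A / 2 ^+ n * ((nm z)^-1 ^+ k.-1 + 4 ^+ k.-1).
  elim=> [|n IH] {}z {}sz; first by rewrite expr0 divr1; exact: hA.
  have /andP[y0 x2] := sz.
  have half : (2^-1 : CC R) = rr 2^-1 by rewrite fmorphV rmorph_nat.
  have i1 : complex.Im (z / 2) = complex.Im z / 2 by rewrite half ImM /= mulr0 add0r.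
  have r1 : complex.Re (z / 2) = complex.Re z / 2 by rewrite half ReM /= mulr0 subr0.
  have s1 : strip (z / 2).
    by rewrite /strip i1 r1 divr_gt0 //= normrM (gtr0_norm (_ : 0 < 2^-1)); lra.
  (* Translated into the strip, (z + 1)/2 stays at distance at least 1/4 from 0, so its bound is
     absorbed by the constant 4^(k-1); only z/2 inherits the pole. *)
  have [w [sw ew dw]] : exists w, [/\ strip w, h w = h ((z + 1) / 2) & 4^-1 <= nm w].
    have i2 : complex.Im ((z + 1) / 2) = complex.Im z / 2.
      by rewrite half ImM ImD /= addr0 mulr0 add0r.
    have r2 : complex.Re ((z + 1) / 2) = (complex.Re z + 1) / 2.
      by rewrite half ReM ReD /= mulr0 subr0.
    move: x2; rewrite ler_norml => /andP[x2 x3].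
    have [x0|x0] := lerP (complex.Re z) 0.
      exists ((z + 1) / 2); split=> //.
        by rewrite /strip i2 r2 divr_gt0 //= ger0_norm; lra.
      by apply: le_trans (Re_le_nm _); rewrite r2 ger0_norm; lra.
    exists ((z + 1) / 2 + (-1)%:~R); split.
    - rewrite /strip ImD ReD Im_int Re_int i2 r2 addr0 divr_gt0 //= ler_norml.
      by rewrite mulrN1z; lra.
    - by rewrite lipschitz_defect_periodic // i2 divr_gt0.
    - apply: le_trans (Re_le_nm _); rewrite ReD Re_int r2 mulrN1z ler0_norm; lra.
  have := lipschitz_defect_dup z y0; rewrite -ew => e.
  have {e} : 2 ^+ k * nm (h z) <= nm (h (z / 2)) + nm (h w).
    have e2 : nm (2 ^+ k) = 2 ^+ k :> R by rewrite nmX nm_nat.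
    by rewrite -e2 -nmM e nmD.
  have := IH _ s1; have := IH _ sw.
  have -> : (nm (z / 2))^-1 = 2 * (nm z)^-1.
    have -> : nm (z / 2) = nm z / 2 by rewrite nmM nmV nm_nat.
    by rewrite invf_div.
  rewrite [(2 * (nm z)^-1) ^+ _]exprMn.
  have : (nm w)^-1 ^+ k.-1 <= 4 ^+ k.-1.
    have w0 : 0 < nm w by apply: lt_le_trans dw; rewrite invr_gt0.
    have wi : (nm w)^-1 <= 4 by rewrite -div1r ler_pdivrMr; [lra | exact: w0].
    by apply: lerXn2r wi; rewrite nnegrE ?invr_ge0 ?nm_ge0.
  have -> : A / 2 ^+ n.+1 = A / 2 ^+ n * 2^-1 by rewrite exprSr invfM mulrA.
  set a := (nm z)^-1 ^+ k.-1; set b := (nm w)^-1 ^+ _; set f : R := 4 ^+ k.-1.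
  have -> : 2 ^+ k = 2 * 2 ^+ k.-1 :> R by rewrite {1}k_pred exprS.
  set g : R := 2 ^+ k.-1; set An := A / 2 ^+ n.
  (* The two bounds add up to g a + 3 f; since 3 <= g this is at most g (a + f), half of 2 g (a +
     f). *)
  have g8 : 8 <= g.
    have k3 : (3 <= k.-1)%N by have := k_ge4; lia.
    have : (2 ^ 3 <= 2 ^ k.-1)%N by rewrite leq_exp2l.
    by rewrite -(ler_nat R) !natrX -/g; lra.
  have f0 : 0 <= f by rewrite exprn_ge0.
  have a0 : 0 <= a by apply: exprn_ge0; rewrite invr_ge0; exact: nm_ge0.
  have An0 : 0 <= An by apply: divr_ge0; [exact: A0 | exact: exprn_ge0].
  clearbody a b f g An.
  move: (nm (h z)) (nm (h w)) (nm (h (z / 2))) => Nz Nw Nh bf h1 h2 h3.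
  clear - a0 f0 An0 g8 bf h1 h2 h3.
  have h4 : 2 * g * Nz <= An * (g * a + 3 * f).
    apply: le_trans h3 _; apply: le_trans (lerD h2 h1) _.
    by rewrite -mulrDr; apply: ler_wpM2l An0 _ _ _; lra.
  have h5 : An * (g * a + 3 * f) <= 2 * g * (An * 2^-1 * (a + f)).
    by have : 0 <= An * f; [rewrite mulr_ge0 | nra].
  by rewrite -(@ler_pM2l _ (2 * g)) ?(le_trans h4) //; lra.
apply/eqP; rewrite -nm_eq0 eq_le nm_ge0 andbT.
set X := (nm z)^-1 ^+ k.-1 + 4 ^+ k.-1 in key.
apply/ler_addgt0Pr => e e0; rewrite add0r.
pose Y : R := A * ((nm z)^-1 ^+ k.-1 + 4 ^+ k.-1).
have Y0 : 0 <= Y by rewrite mulr_ge0 // addr_ge0 // exprn_ge0 // invr_ge0 nm_ge0.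
pose n := (Num.truncn (Y / e)).+1.
apply: le_trans (key n z sz) _; rewrite mulrAC -/Y ler_pdivrMr ?exprn_gt0 //.
rewrite mulrC -ler_pdivrMr //.
have := @truncnS_gt R (Y / e); rewrite -/n => /ltW/le_trans; apply.
by rewrite -natrX ler_nat ltnW // ltn_expl.
Qed.

(** The defect vanishes on the strip, and an integral translation brings every point of the
    half-plane there. *)
Lemma lipschitz z : 0 < complex.Im z -> lattice_sum z = lipschitz_const * power_series (nome z).
Proof.
move=> z0; apply/eqP; rewrite -subr_eq0; apply/eqP.
pose n := Num.floor (complex.Re z + 2^-1).
rewrite -/(lipschitz_defect z) -[z](subrK n%:~R) lipschitz_defect_periodic; last first.
  by rewrite ImD ImN Im_int oppr0 addr0.
have [A [A0 hA]] := lipschitz_defect_strip.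
apply: (dup_bounded_eq0 A0 hA lipschitz_defect_periodic lipschitz_defect_dup);
  rewrite /strip ImD ReD ImN ReN Im_int Re_int oppr0 addr0 z0 /=.
have := floor_le (complex.Re z + 2^-1); have := floorD1_gt (complex.Re z + 2^-1).
rewrite -/n rmorphD /= ler_norml; lra.
Qed.

End Lipschitz.

(** * Eisenstein series of even weight k *)

Section Eisenstein.
Variable R : realType.
Variables j k : nat.
Hypotheses (j2 : (2 <= j)%N) (kE : k = (2 * j)%N).
Implicit Types (z q : CC R).

(** The pair (0, 0) belongs to the index set and contributes 0 since 0^-1 = 0; the sum thus runs
    over the whole group Z^2, which SL_2(Z) permutes. *)
Definition Eis z : CC R := sumC (fun p : int * int => (p.1%:~R * z + p.2%:~R) ^- k).

Lemma Eis_sum z : 0 < complex.Im z ->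
  hsum (fun p : int * int => (p.1%:~R * z + p.2%:~R) ^- k) (Eis z).
Proof. by move=> /(absb_lattice j2)[M]; rewrite -kE => /sumCP. Qed.

Lemma cz_d_neq0 (c d : int) z : 0 < complex.Im z -> (c, d) != 0 ->
  c%:~R * z + d%:~R != 0.
Proof.
move=> /lattice_lb[e e0 he] /he h; rewrite -nm_gt0 lt_neqAle nm_ge0 andbT eq_sym.
apply: contraTneq h => ->; rewrite expr0n -ltNge; exact: mulr_gt0.
Qed.

Lemma Eis_modular (a b c d : int) z : a * d - b * c = 1 -> 0 < complex.Im z ->
  Eis ((a%:~R * z + b%:~R) / (c%:~R * z + d%:~R)) = (c%:~R * z + d%:~R) ^+ k * Eis z.
Proof.
move=> det z0.
have cd0 : c%:~R * z + d%:~R != 0.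
  apply: cz_d_neq0 => //; apply: contra_eqN det => /eqP[-> ->].
  by rewrite !mulr0 subr0 eq_sym oner_eq0.
(* Right multiplication of the row vector (m, n) by the matrix; [h'] is multiplication by its
   inverse. *)
pose h (p : int * int) := (p.1 * a + p.2 * c, p.1 * b + p.2 * d).
pose h' (p : int * int) := (d * p.1 - c * p.2, a * p.2 - b * p.1).
have hK : cancel h h'.
  move=> [m n]; rewrite /h /h' /=; congr pair.
    by rewrite -[RHS]mulr1 -det; ring.
  by rewrite -[RHS]mulr1 -det; ring.
have h'K p : p = h (h' p).
  case: p => m n; rewrite /h /h' /=; congr pair.
    by rewrite -[LHS]mulr1 -det; ring.
  by rewrite -[LHS]mulr1 -det; ring.
have sur i : exists p, i = h p by exists (h' i).
apply: sumC_eq.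
have := hsumZ ((c%:~R * z + d%:~R) ^+ k) (hsum_reindex (can_inj hK) sur (Eis_sum z0)).
apply: hsum_ext => -[m n] /=; rewrite !rmorphD !rmorphM /=.
set w := c%:~R * z + d%:~R in cd0 *.
have -> : (m%:~R * a%:~R + n%:~R * c%:~R) * z + (m%:~R * b%:~R + n%:~R * d%:~R) =
  (m%:~R * ((a%:~R * z + b%:~R) / w) + n%:~R) * w.
  by rewrite [RHS]mulrDl -[m%:~R * _ * w]mulrA divfK // /w; ring.
by rewrite [(_ * w) ^+ k]exprMn invfM mulrCA mulfV ?mulr1 // expf_neq0.
Qed.

Lemma exprN_even (w : CC R) : (- w) ^+ k = w ^+ k.
Proof. by rewrite exprNn -signr_odd kE oddM expr0 mul1r. Qed.

(** The row m = 0 of the lattice sum, that is 2 zeta(k); its term d = 1 already makes it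
    positive. *)
Lemma zeta_pos : exists2 Z : R, 0 < Z &
  hsum (fun d : int => (d%:~R : CC R) ^- k) (rr Z).
Proof.
have i0 : 0 < complex.Im (mkC 0 1 : CC R) by [].
have [M hM] := absb_lattice j2 i0.
have inj : injective (fun d : int => (0 : int, d)) by move=> ? ? [].
have {}hM : absb (fun d : int => (d%:~R : CC R) ^- k) M.
  by apply: absb_le (absb_inj inj hM) => d; rewrite /= mul0r add0r kE.
have e d : (d%:~R : CC R) ^- k = rr ((d%:~R : R) ^- k).
  by rewrite fmorphV rmorphXn rmorph_int.
have p d : 0 <= (d%:~R : R) ^- k by rewrite invr_ge0 kE exprM exprn_ge0 // sqr_ge0.
have [|x [hx bx]] := hsum_nneg p (M := M).
  move=> B /hM; apply: le_trans; apply: ler_sum => d _.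
  by rewrite e nm_rr ler_norm.
exists x; last by apply: hsum_ext hx => d; rewrite e.
have := bx [:: 1] isT; rewrite big_seq1 expr1n invr1; lra.
Qed.

(** The divisor sum sigma_(k-1)(n). Each divisor is written through its cofactor m + 1, the row of
    the lattice sum from which it arises; at n = 0 the range is empty. *)
Definition sigma (n : nat) : nat :=
  (\sum_(m <- [seq m <- index_iota 0 n | m.+1 %| n]) (n %/ m.+1) ^ k.-1)%N.

Lemma sigma0 : sigma 0 = 0%N. Proof. by rewrite /sigma big_nil. Qed.
Lemma sigma1 : sigma 1 = 1%N.
Proof. by rewrite /sigma /= big_seq1 divn1 exp1n. Qed.
Lemma sigma_le n : (sigma n <= n ^ k)%N.
Proof.
have k4 := k_ge4 j2 kE.
rewrite /sigma big_filter.
apply: (@leq_trans (\sum_(0 <= m < n) n ^ k.-1)).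
  rewrite big_mkcond; apply: leq_sum => m _; case: ifP => // _.
  by rewrite leq_exp2r ?leq_div //; lia.
by rewrite sum_nat_const_nat subn0 -expnS; have -> : k.-1.+1 = k by lia.
Qed.

(** The double series of r^(k-1) q^((m+1) r) is summed once along the rows m and once along the
    values n = (m+1) r. *)
Lemma sum_power_series q : nm q < 1 -> exists s,
  hsum (fun m => power_series k (q ^+ m.+1)) s /\ hsum (fun n => (sigma n)%:R * q ^+ n) s.
Proof.
move=> q1; have k4 := k_ge4 j2 kE.
pose f (p : nat * nat) : CC R := p.2%:R ^+ k.-1 * (q ^+ p.1.+1) ^+ p.2.
have [M hM] := absb_natX k.-1 q1.
have fM : absb f ((1 - nm q)^-1 * M).
  (* For r >= 1 one has (m+1) r >= m + r, so the double series is dominated by a product; the terms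
     with r = 0 vanish because k - 1 > 0. *)
  apply: absb_le (absb_mul (ps_geom q1).2 hM) => -[m [|r]] /=.
    rewrite /f /= expr0n (_ : (k.-1 == 0)%N = false); last by lia.
    by rewrite mul0r nm0 nm_ge0.
  rewrite mul1r mulrCA /f /= nmM [leRHS]nmM ler_wpM2l ?nm_ge0 //.
  rewrite -exprM -exprD !nmX; apply: ler_wiXn2l; rewrite ?nm_ge0 ?(ltW q1) //; lia.
have [s hs] := hsum_ex fM; exists s; split.
  apply: (hsum_fubini (f := f)) hs => m; apply: power_series_sum.
  by rewrite nmX exprn_ilt1 ?nm_ge0.
pose A n := [seq (m, n %/ m.+1)%N | m <- index_iota 0 n & (m.+1 %| n)%N].
have [|||h1 _] := @hsum_fiber R _ _ (fun p : nat * nat => (p.1.+1 * p.2)%N) A f s _ _ _ _ fM hs.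
- by move=> n; rewrite map_inj_uniq ?filter_uniq ?iota_uniq // => ? ? [].
- move=> n [m r] /mapP[m']; rewrite mem_filter => /andP[dv _] [-> ->] /=.
  by rewrite mulnC divnK.
- move=> [m r] f0; apply/mapP; exists m; last by rewrite /= mulKn.
  have r0 : (0 < r)%N.
    move: f0; rewrite /f /=; case: r => //; rewrite expr0n.
    by rewrite (_ : (k.-1 == 0)%N = false) ?mul0r ?eqxx //; lia.
  rewrite mem_filter mem_index_iota /= dvdn_mulr //=; nia.
apply: hsum_ext h1 => n; rewrite big_map /sigma natr_sum mulr_suml.
rewrite big_seq [RHS]big_seq; apply: eq_bigr => m; rewrite mem_filter => /andP[dv _].
by rewrite /f /= natrX -exprM mulnC divnK.
Qed.

(** Each row m > 0 is a Lipschitz sum at m z; the row -m equals it, by changing the sign of d and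
    using that k is even. The index set [nat + nat] mirrors [Posz] and [Negz]. *)
Lemma Eis_rows z Z : 0 < complex.Im z -> hsum (fun d : int => (d%:~R : CC R) ^- k) (rr Z) ->
  hsum (fun s : nat + nat => match s with
    | inl 0 => rr Z
    | inl m.+1 | inr m => lipschitz_const R k * power_series k (nome z ^+ m.+1) end) (Eis z).
Proof.
move=> z0 hZ.
pose g (c : int) := match c with
  | Posz 0 => rr Z | Posz m.+1 | Negz m => lipschitz_const R k * power_series k (nome z ^+ m.+1) end.
have rowpos m : hsum (fun d : int => ((m.+1%:R : CC R) * z + d%:~R) ^- k)
    (lipschitz_const R k * power_series k (nome z ^+ m.+1)).
  have i0 : 0 < complex.Im ((m.+1%:R : CC R) * z).
    rewrite -(rmorph_nat (@rr R)) ImM /= mul0r addr0; exact: mulr_gt0.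
  by rewrite -nome_natM -(lipschitz j2 kE i0); exact: (lattice_sum_sum j2 kE).
have hg : hsum g (Eis z).
  apply: hsum_fubini (Eis_sum z0) => -[[|m]|m] /=.
  - by apply: hsum_ext hZ => d; rewrite mul0r add0r.
  - exact: rowpos.
  - have inj : injective (fun d : int => - d) by exact: oppr_inj.
    have sur i : exists d : int, i = - d by exists (- i); rewrite opprK.
    apply: hsum_ext (hsum_reindex inj sur (rowpos m)) => d.
    by rewrite NegzE -[in LHS]exprN_even opprD rmorphN /= opprK rmorphN /= mulNr.
pose h (s : nat + nat) : int := match s with inl n => Posz n | inr n => Negz n end.
have inj : injective h by case=> a [] b //= [->].
have sur i : exists s, i = h s by case: i => n; [exists (inl n)|exists (inr n)].
by apply: hsum_ext (hsum_reindex inj sur hg) => -[[|m]|m].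
Qed.

Lemma lipschitz_const_real : lipschitz_const R k = rr ((-1) ^+ j * ((2 * pi) ^+ k / k.-1`!%:R)).
Proof.
rewrite /lipschitz_const !rmorphM fmorphV rmorph_nat /= mulrA; congr (_ / _).
rewrite kE !exprM -[RHS]rmorphM -exprMn rmorphXn; congr (_ ^+ _).
by apply: CC_eq; rewrite expr2 ?(ReM, ImM) /=; ring.
Qed.

(** The sign (-1)^j of the first coefficient is recorded because it is opposite for weights 4 and 6;
    this makes the q-coefficient of E4^3 - E6^2 non-zero. The sign comes from (2 pi i)^(2 j). *)
Lemma eisenstein : exists (E : CC R -> CC R) (e : nat -> CC R),
  [/\ e 0%N = 1,
      exists2 t : R, 0 < t & e 1%N = rr ((-1) ^+ j * t),
      forall x, nm x < 1 -> exists M, absb (fun n => e n * x ^+ n) M,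
      forall z, 0 < complex.Im z -> hsum (fun n => e n * nome z ^+ n) (E z) &
      forall a b c d : int, a * d - b * c = 1 -> forall z, 0 < complex.Im z ->
        E ((a%:~R * z + b%:~R) / (c%:~R * z + d%:~R)) = (c%:~R * z + d%:~R) ^+ k * E z].
Proof.
have [Z Z0 hZ] := zeta_pos.
have rZ : rr Z != 0 by rewrite rr_eq0 gt_eqF.
pose e n : CC R := (if n == 0%N then 1 else 0) + 2 * lipschitz_const R k / rr Z * (sigma n)%:R.
exists (fun z => (rr Z)^-1 * Eis z), e; split.
- by rewrite /e sigma0 mulr0 addr0.
- exists (2 * ((2 * pi) ^+ k / k.-1`!%:R) / Z).
    apply: divr_gt0 => //; apply: mulr_gt0 => //; apply: divr_gt0.
      by apply: exprn_gt0; rewrite mulr_gt0 // pi_gt0.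
    by rewrite ltr0n fact_gt0.
  rewrite /e /= sigma1 add0r mulr1 lipschitz_const_real -fmorphV -(rmorph_nat (@rr R)) -!rmorphM /=.
  by congr rr; rewrite mulrCA !mulrA.
- move=> x x1; have [M hM] := absb_natX k x1.
  exists (1 + nm (2 * lipschitz_const R k / rr Z) * M) => B uB.
  apply: (@le_trans _ _ (\sum_(n <- B) (nm ((if n == 0%N then 1 else 0) * 1 : CC R) +
      nm (2 * lipschitz_const R k / rr Z) * nm (n%:R ^+ k * x ^+ n)))).
    apply: ler_sum => n _; rewrite /e mulrDl; apply: le_trans (nmD _ _) _; apply: lerD.
      by case: eqP => [->|_]; rewrite ?expr0 // !mul0r.
    rewrite -mulrA nmM ler_wpM2l ?nm_ge0 // !nmM ler_wpM2r ?nm_ge0 //.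
    by rewrite nmX !nm_nat -natrX ler_nat sigma_le.
  rewrite big_split /= -mulr_sumr; apply: lerD; last by rewrite ler_wpM2l ?nm_ge0 ?hM.
  rewrite (bigID (pred1 0%N)) /= [X in _ + X]big1 => [|n /negbTE ->]; last by rewrite mul0r nm0.
  rewrite addr0 (eq_bigr (fun=> 1)) => [|n ->]; last by rewrite mul1r nm1.
  rewrite -big_filter big_const_seq count_predT iter_addr_0.
  have : (size [seq i <- B | i == 0%N] <= 1)%N by rewrite size_filter count_uniq_mem // leq_b1.
  by case: size => [|[|]].
- move=> z z0; have q1 := nm_nome_lt1 z0.
  have [s [h1 h2]] := sum_power_series q1.
  have hE := Eis_rows z0 hZ.
  have eE : Eis z = (rr Z + lipschitz_const R k * s) + lipschitz_const R k * s.
    apply: hsum_uniq hE _; apply: hsum_sum; last exact: hsumZ.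
    pose f m := if m is m'.+1 then lipschitz_const R k * power_series k (nome z ^+ m'.+1) else rr Z.
    apply: (@hsum_ext _ _ f); first by case.
    by apply: (hsum_shift (f := f)); exact: hsumZ.
  have -> : (rr Z)^-1 * Eis z = 1 + 2 * lipschitz_const R k / rr Z * s by rewrite eE; field.
  have hd : hsum (fun n : nat => if n == 0%N then 1 else 0 : CC R) 1.
    have := @hsum_supp R nat (fun n => if n == 0%N then 1 else 0) [:: 0%N] isT.
    by rewrite big_seq1; apply=> n; rewrite inE => /negbTE ->.
  apply: hsum_ext (hsumD hd (hsumZ (2 * lipschitz_const R k / rr Z) h2)) => n.
  rewrite /e [RHS]mulrDl [_ * (_ * _)]mulrA; congr (_ + _).
  by case: eqP => [->|_]; rewrite ?expr0 ?mulr1 ?mul0r.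
- by move=> a b c d det z z0; rewrite Eis_modular // mulrCA.
Qed.

End Eisenstein.

(** * Test forms of large weight *)

Section Forms.
Variable R : realType.
Implicit Types (z : CC R) (a b : nat -> CC R) (F G : CC R -> CC R) (r M N : R).

(** Holomorphy is derived from the first two fields in [mform_derivable]. Carrying the coefficients
    as data turns products of forms into Cauchy products. *)
Record mform (k : nat) F a : Prop := MForm {
  mform_good : forall x, nm x < 1 -> exists M, absb (fun n => a n * x ^+ n) M;
  mform_sum : forall z, 0 < complex.Im z -> hsum (fun n => a n * nome z ^+ n) (F z);
  mform_mod : forall u v c d : int, u * d - v * c = 1 -> forall z, 0 < complex.Im z ->
    F ((u%:~R * z + v%:~R) / (c%:~R * z + d%:~R)) = (c%:~R * z + d%:~R) ^+ k * F z }.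

Definition one_coef : nat -> CC R := fun n => if n == 0%N then 1 else 0.
Definition cauchy_exp a n := iter n (cauchy_prod a) one_coef.
Definition radius_bound r a M := absb (fun n => a n * rr r ^+ n) M.

Lemma radius_bound_one r : radius_bound r one_coef 1.
Proof.
move=> B uB; rewrite (bigID (pred1 0%N)) /= [X in _ + X]big1 => [|n /negbTE n0]; last first.
  by rewrite /one_coef n0 mul0r nm0.
rewrite addr0 (eq_bigr (fun=> 1)) => [|n /eqP ->]; last by rewrite mul1r nm1.
rewrite -big_filter big_const_seq count_predT iter_addr_0.
have : (size [seq i <- B | i == 0%N] <= 1)%N by rewrite size_filter count_uniq_mem // leq_b1.
by case: size => [|[|]].
Qed.

Lemma absb_one x : absb (fun n => one_coef n * x ^+ n) (1 : R).
Proof.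
apply: absb_le (radius_bound_one 1) => -[|n] /=; first by rewrite !expr0.
by rewrite /one_coef /= !mul0r.
Qed.

Lemma radius_bound_mul r a b M N : radius_bound r a M -> radius_bound r b N ->
  radius_bound r (cauchy_prod a b) (M * N).
Proof.
move=> hM hN; have [s hs] := hsum_ex hM; have [t ht] := hsum_ex hN.
exact: (ps_mul hs hM ht hN).2.
Qed.

Lemma radius_bound_exp r a M n : radius_bound r a M -> radius_bound r (cauchy_exp a n) (M ^+ n).
Proof.
move=> hM; elim: n => [|n IH]; first by rewrite expr0; exact: radius_bound_one.
by rewrite exprS; exact: radius_bound_mul.
Qed.

Lemma mform_mul k l F G a b : mform k F a -> mform l G b ->
  mform (k + l) (fun z => F z * G z) (cauchy_prod a b).
Proof.
case=> ga sa ma [gb sb mb]; split.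
- move=> x x1; have [M hM] := ga x x1; have [N hN] := gb x x1; exists (M * N).
  have [s hs] := hsum_ex hM; have [t ht] := hsum_ex hN.
  exact: (ps_mul hs hM ht hN).2.
- move=> z z0; have q1 := nm_nome_lt1 z0; have [M hM] := ga _ q1; have [N hN] := gb _ q1.
  exact: (ps_mul (sa z z0) hM (sb z z0) hN).1.
- move=> u v c d det z z0; rewrite (ma u v c d det z z0) (mb u v c d det z z0) exprD; ring.
Qed.

Lemma mform_one : mform 0 (fun=> 1) one_coef.
Proof.
split.
- by move=> x _; exists 1; exact: absb_one.
- move=> z _; have := @hsum_supp R nat (fun n => one_coef n * nome z ^+ n) [:: 0%N] isT.
  rewrite big_seq1 expr0 mulr1; apply=> n; rewrite inE => /negbTE n0.
  by rewrite /one_coef n0 mul0r.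
- by move=> *; rewrite expr0 mulr1.
Qed.

Lemma mform_exp k F a n : mform k F a -> mform (n * k) (fun z => F z ^+ n) (cauchy_exp a n).
Proof.
move=> h; elim: n => [|n IH]; first exact: mform_one.
have := mform_mul h IH; rewrite -mulSn; congr mform.
by apply/funext => z; rewrite exprS.
Qed.

Lemma mform_comb k F G a b (s t : CC R) : mform k F a -> mform k G b ->
  mform k (fun z => s * F z + t * G z) (fun n => s * a n + t * b n).
Proof.
case=> ga sa ma [gb sb mb]; split.
- move=> x x1; have [M hM] := ga x x1; have [N hN] := gb x x1.
  exists (nm s * M + nm t * N) => B uB.
  apply: (@le_trans _ _ (\sum_(n <- B)
      (nm s * nm (a n * x ^+ n) + nm t * nm (b n * x ^+ n)))).
    by apply: ler_sum => n _; rewrite -!nmM mulrDl -!mulrA nmD.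
  by rewrite big_split /= -!mulr_sumr lerD // ler_wpM2l ?nm_ge0 ?hM ?hN.
- move=> z z0; apply: hsum_ext (hsumD (hsumZ s (sa z z0)) (hsumZ t (sb z z0))) => n.
  by rewrite mulrDl !mulrA.
- move=> u v c d det z z0; rewrite (ma u v c d det z z0) (mb u v c d det z z0); ring.
Qed.

Definition vanish a n := forall i, (i < n)%N -> a i = 0.

Lemma cauchy_prod_low a b m n : vanish a m -> vanish b n ->
  vanish (cauchy_prod a b) (m + n) /\ cauchy_prod a b (m + n) = a m * b n.
Proof.
move=> va vb; split=> [i hi|].
  rewrite /cauchy_prod big_nat big1 // => l /andP[_ hl].
  have [lm|ml] := ltnP l m; first by rewrite va // mul0r.
  by rewrite vb ?mulr0 //; lia.
rewrite /cauchy_prod (big_cat_nat (n := m)) //=; last by lia.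
rewrite big_nat big1 => [|l /andP[_ hl]]; last by rewrite va // mul0r.
rewrite add0r big_ltn; last by rewrite ltnS leq_addr.
rewrite addKn big_nat big1 ?addr0 // => l /andP[hl hl2].
by rewrite vb ?mulr0 //; lia.
Qed.

Lemma cauchy_exp_low a m n : vanish a m -> a m = 1 ->
  vanish (cauchy_exp a n) (n * m) /\ cauchy_exp a n (n * m)%N = 1.
Proof.
move=> va am; elim: n => [|n [IH1 IH2]]; first by split.
have [h1 h2] := cauchy_prod_low va IH1; rewrite mulSn; split=> //.
by rewrite /cauchy_exp iterS h2 am IH2 mulr1.
Qed.

Lemma nbW r a M N : M <= N -> radius_bound r a M -> radius_bound r a N.
Proof. exact: absbW. Qed.

Lemma nm_mulX (x : CC R) r n : 0 <= r -> nm (x * rr r ^+ n) = nm x * r ^+ n.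
Proof. by move=> r0; rewrite nmM nmX nm_rr (ger0_norm r0). Qed.

Lemma radius_bound_rad r s a M : 0 <= s -> s <= r -> radius_bound r a M -> radius_bound s a M.
Proof.
move=> s0 sr; apply: absb_le => n; have r0 := le_trans s0 sr.
rewrite [leLHS](nm_mulX (a n) n s0) [leRHS](nm_mulX (a n) n r0); apply: ler_wpM2l; first exact: nm_ge0.
by apply: lerXn2r sr; rewrite nnegrE.
Qed.

(** Passing from radius 1/2 to 1/K gains at least a factor 2/K in every term but the constant one.
    The bound 1 + O(1/K) survives being raised to a power of size at most K. *)
Lemma radius_bound_small a M (K : nat) : (2 <= K)%N -> a 0%N = 1 -> radius_bound 2^-1 a M ->
  radius_bound K%:R^-1 a (1 + 2 * M / K%:R).
Proof.
move=> K2 a0 hM B uB.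
have K0 : 0 < K%:R :> R by rewrite ltr0n; lia.
apply: (@le_trans _ _ (\sum_(n <- B) (nm (one_coef n * rr 1 ^+ n) +
    2 / K%:R * nm (a n * rr 2^-1 ^+ n)))).
  apply: ler_sum => -[|n] _.
    by rewrite !expr0 a0 !mulr1 nm1 lerDl !mulr_ge0 ?invr_ge0 // ltW.
  apply: (@le_trans _ _ (2 / K%:R * nm (a n.+1 * rr 2^-1 ^+ n.+1))); last first.
    by rewrite lerDr; exact: nm_ge0.
  have i0 : 0 <= K%:R^-1 :> R by rewrite invr_ge0 ltW.
  have h0 : 0 <= 2^-1 :> R by rewrite invr_ge0.
  rewrite [leLHS](nm_mulX (a n.+1) n.+1 i0) [X in _ <= _ * X](nm_mulX (a n.+1) n.+1 h0) mulrCA.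
  apply: ler_wpM2l; first exact: nm_ge0.
  have q0 : 0 <= 2 / K%:R :> R by rewrite divr_ge0 // ltW.
  have q1 : 2 / K%:R <= 1 :> R by rewrite ler_pdivrMr // mul1r ler_nat.
  have e : K%:R^-1 = 2 / K%:R * 2^-1 :> R by rewrite mulrAC mulfV ?mul1r.
  rewrite [in leLHS]e exprMn; apply: ler_wpM2r; first exact: exprn_ge0.
  by rewrite exprS; apply: ler_piMr; [exact: q0 | exact: exprn_ile1].
rewrite big_split /= -mulr_sumr [2 * M / _]mulrAC; apply: lerD; first exact: radius_bound_one.
by rewrite ler_wpM2l ?hM // divr_ge0 // ltW.
Qed.

Lemma exp_bound (M : R) (K n : nat) : 0 <= M -> (0 < K)%N -> (n <= K)%N ->
  (1 + M / K%:R) ^+ n <= expR M.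
Proof.
move=> M0 K0 nK; have K0' : 0 < K%:R :> R by rewrite ltr0n.
have x0 : 0 <= M / K%:R by rewrite divr_ge0 // ltW.
apply: (@le_trans _ _ ((1 + M / K%:R) ^+ K)); first by apply: ler_weXn2l => //; lra.
have -> : expR M = expR (M / K%:R) ^+ K by rewrite -expRM_natl mulrC divfK ?gt_eqF.
by apply: lerXn2r; rewrite ?nnegrE ?expR_ge0 ?expR_ge1Dx //; lra.
Qed.

Lemma basic_forms : exists E4 e4 E6 e6 Dl dl,
  [/\ mform 4 E4 e4, mform 6 E6 e6, mform 12 Dl dl,
      e4 0%N = 1 /\ e6 0%N = 1 & vanish dl 1 /\ dl 1%N = 1].
Proof.
have [E4 [e4 [c40 [t4 t40 c41] g4 s4 m4]]] := @eisenstein R 2 4 isT erefl.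
have [E6 [e6 [c60 [t6 t60 c61] g6 s6 m6]]] := @eisenstein R 3 6 isT erefl.
have f4 : mform 4 E4 e4 by split.
have f6 : mform 6 E6 e6 by split.
(* The q-coefficient of E4^3 - E6^2, by which the difference is divided to obtain Delta with leading
   coefficient 1. *)
pose lead : R := 3 * t4 + 2 * t6.
have l0 : rr lead != 0 by rewrite rr_eq0 gt_eqF // /lead; lra.
have f12 := mform_comb (rr lead)^-1 (- (rr lead)^-1) (mform_exp 3 f4) (mform_exp 2 f6).
exists E4, e4, E6, e6; eexists; eexists; split; [exact: f4|exact: f6|exact: f12|by split|].
have p0 a b : cauchy_prod a b 0 = a 0%N * b 0%N by rewrite /cauchy_prod big_nat1.
have p1 a b : cauchy_prod a b 1 = a 0%N * b 1%N + a 1%N * b 0%N.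
  by rewrite /cauchy_prod big_nat_recr //= big_nat1 subnn subn0.
split=> [[|//] _|]; rewrite /cauchy_exp /= !(p0, p1) /one_coef /=.
  by rewrite c40 c60; ring.
rewrite c40 c60 c41 c61 expr2 mulrNN mulr1 mul1r.
rewrite (_ : (-1) ^+ 3 * t6 = - t6); last by rewrite !exprS expr0; ring.
rewrite rmorphN /= !(mulr0, addr0, mul1r, mulr1).
apply: (mulfI l0); rewrite mulrDr mulNr mulrN !mulVKf // mulr1 /lead.
rewrite rmorphD !rmorphM !rmorph_nat /=; ring.
Qed.

(** Modulo 4 the parity of K/2 decides whether one factor E6 is required; the condition K >= 12 m +
    12 keeps the number of factors E4 non-negative. *)
Lemma weight_split (K m : nat) : ~~ odd K -> (12 * m + 12 <= K)%N ->
  exists c b : nat, (b <= 1)%N /\ K = (m * 12 + (c * 4 + b * 6))%N.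
Proof.
move=> Ke KK; have := odd_double_half K; rewrite (negbTE Ke) add0n -mul2n => e1.
have := odd_double_half K./2; rewrite -mul2n => e2.
exists (K./2./2 - 3 * m - odd K./2)%N, (odd K./2).
have : (odd K./2 <= 1)%N by exact: leq_b1.
lia.
Qed.

(* [F = Delta^m E4^c E6^b] with [b <= 1]. At radius [1/K] its coefficients are
   bounded independently of [K], because [(1 + M/K)^K <= exp M]. *)
Lemma test_forms r : 0 < r -> r < 1 -> exists2 beta : R, 1 <= beta &
  forall m : nat, exists (C : R) (K1 : nat), forall K, ~~ odd K -> (K1 <= K)%N ->
  exists F a, [/\ mform K F a, vanish a m, a m = 1, radius_bound r a (beta ^+ K) &
    radius_bound K%:R^-1 a C].
Proof.
move=> r0 r1.
have [E4 [e4 [E6 [e6 [Dl [dl [f4 f6 f12 [e40 e60] [vd d1]]]]]]]] := basic_forms.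
have nr a k F : mform k F a -> forall s, 0 < s -> s < 1 -> exists2 M, 1 <= M & radius_bound s a M.
  move=> f s s0 s1; have [|M hM] := mform_good f (x := rr s).
    by rewrite nm_rr gtr0_norm.
  exists (Num.max 1 M); first by rewrite le_max lexx.
  by apply: absbW hM; rewrite le_max lexx orbT.
have [M4 M41 n4] := nr _ _ _ f4 r r0 r1.
have [M6 M61 n6] := nr _ _ _ f6 r r0 r1.
have [Md Md1 nd] := nr _ _ _ f12 r r0 r1.
have h0 : 0 < 2^-1 :> R by lra.
have h1 : 2^-1 < 1 :> R by lra.
have [P4 P41 p4] := nr _ _ _ f4 _ h0 h1.
have [P6 P61 p6] := nr _ _ _ f6 _ h0 h1.
have [Pd Pd1 pd] := nr _ _ _ f12 _ h0 h1.
(* All three bounds are at least 1, hence each is at most [beta]; a form of weight K has at most K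
   factors, whence beta^K. *)
pose beta := M4 * M6 * Md.
have b1 : 1 <= beta by rewrite /beta !mulr_ege1.
have M4b : M4 <= beta by rewrite /beta -mulrA ler_peMr ?mulr_ege1 //; lra.
have M6b : M6 <= beta by rewrite /beta [M4 * M6]mulrC -mulrA ler_peMr ?mulr_ege1 //; lra.
have Mdb : Md <= beta by rewrite /beta ler_peMl ?mulr_ege1 //; lra.
exists beta => // m.
exists (Pd ^+ m * (expR (2 * P4) * expR (2 * P6))), (12 * m + 12)%N => K Ke KK.
have [c [b [b1' eK]]] := weight_split Ke KK.
have [K2 hK cK bK Kn0] : [/\ (2 <= K)%N, (m + (c + b) <= K)%N, (c <= K)%N, (b <= K)%N & (0 < K)%N].
  by split; move: eK KK; clear; lia.
have f := mform_mul (mform_exp m f12) (mform_mul (mform_exp c f4) (mform_exp b f6)).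
have f' := f; rewrite -eK in f'.
have [v1 l1] := cauchy_exp_low m vd d1; rewrite muln1 in v1 l1.
have va (a : nat -> CC R) : vanish a 0 by [].
have [v2 l2] := cauchy_exp_low c (va e4) e40.
have [v3 l3] := cauchy_exp_low b (va e6) e60.
have [v4 l4] := cauchy_prod_low v2 v3.
have [v5 l5] := cauchy_prod_low v1 v4.
rewrite !muln0 !addn0 in l2 l3 l4 l5 v4 v5.
eexists; eexists; split; first exact: f'.
- exact: v5.
- by rewrite l5 l4 l1 l2 l3 !mulr1.
- apply: nbW (radius_bound_mul (radius_bound_exp m nd) (radius_bound_mul (radius_bound_exp c n4)
  (radius_bound_exp b n6))).
  apply: (@le_trans _ _ (beta ^+ m * (beta ^+ c * beta ^+ b))).
    have le (x : R) : 1 <= x -> x <= beta -> forall n, x ^+ n <= beta ^+ n.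
      by move=> x1 xb n; apply: lerXn2r => //; rewrite nnegrE; lra.
    have ge (x : R) n : 1 <= x -> 0 <= x ^+ n by move=> x1; apply: exprn_ge0; lra.
    apply: ler_pM; [exact: ge|by apply: mulr_ge0; exact: ge|exact: le|].
    by apply: ler_pM; [exact: ge|exact: ge|exact: le|exact: le].
  by rewrite -!exprD; exact: (ler_weXn2l b1).
- have K0 : 0 <= K%:R^-1 :> R by rewrite invr_ge0.
  have K2' : K%:R^-1 <= 2^-1 :> R by rewrite lef_pV2 ?posrE ?ltr0n ?ler_nat.
  have q4 := radius_bound_small K2 e40 p4; have q6 := radius_bound_small K2 e60 p6.
  have qd := radius_bound_rad K0 K2' pd.
  apply: nbW (radius_bound_mul (radius_bound_exp m qd) (radius_bound_mul (radius_bound_exp c q4)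
    (radius_bound_exp b q6))).
  have p (x : R) : 0 <= x -> 0 <= 1 + x / K%:R by move=> x0; rewrite addr_ge0 // mulr_ge0.
  apply: ler_wpM2l; first by apply: exprn_ge0; lra.
  apply: ler_pM; try (apply: exprn_ge0; apply: p; lra).
    by apply: exp_bound => //; lra.
  by apply: exp_bound => //; lra.
Qed.

End Forms.

(** * Gauss sums *)

Section RootsOfUnity.
Variables (R : realType) (D : nat).
Hypothesis D0 : (0 < D)%N.

Definition zeta : CC R := nome (D%:R^-1).

Lemma zetaD : zeta ^+ D = 1.
Proof. by rewrite /zeta -nome_natM mulfV ?nome1 // pnatr_eq0 -lt0n. Qed.
Lemma zeta_neq0 : zeta != 0. Proof. exact: nome_neq0. Qed.
Lemma nm_zeta : nm zeta = 1.
Proof.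
rewrite /zeta nm_nome -(rmorph_nat (@rr R)) -fmorphV /=.
by rewrite mulr0 oppr0 expR0.
Qed.
Lemma zeta_mod n : zeta ^+ (n %% D) = zeta ^+ n.
Proof. by rewrite [in RHS](divn_eq n D) exprD mulnC exprM zetaD expr1n mul1r. Qed.

(** For 0 < r < D the real part of zeta^r is 1 - 2 sin(pi r/D)^2 < 1. *)
Lemma zeta_eq1 n : zeta ^+ n = 1 -> (D %| n)%N.
Proof.
rewrite -zeta_mod /dvdn; set r := (n %% D)%N => h.
have rD : (r < D)%N by rewrite ltn_mod.
case: (posnP r) => [/eqP //|r0]; exfalso.
pose t : R := pi * (r%:R / D%:R).
have DR : 0 < D%:R :> R by rewrite ltr0n.
have x0 : 0 < r%:R / D%:R :> R by rewrite divr_gt0 // ltr0n.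
have x1 : r%:R / D%:R < 1 :> R by rewrite ltr_pdivrMr // mul1r ltr_nat.
have st : 0 < sin t by apply: sin_gt0_pi; rewrite /t; have := @pi_gt0 R => p0; apply/andP; split; nra.
have : complex.Re (zeta ^+ r) = cos (t *+ 2).
  rewrite /zeta -nome_natM -!(rmorph_nat (@rr R)) -fmorphV -rmorphM /nome /=.
  rewrite !mul0r mulr0 subr0 expR0 mul1r add0r; congr cos.
  by rewrite /t -[RHS]mulr_natl; ring.
rewrite h cos_mulr2n cos2sin2 -[_ *+ 2]mulr_natl /=.
have : 0 < sin t ^+ 2 by rewrite exprn_gt0.
lra.
Qed.

Lemma zeta_inj n m : zeta ^+ n = zeta ^+ m -> n = m %[mod D].
Proof.
wlog nm_ : n m / (n <= m)%N => [hw|] h.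
  by have [/hw/(_ h)|/ltnW/hw/(_ (esym h))/esym] := leqP n m.
apply/eqP; rewrite eq_sym eqn_mod_dvd //; apply: zeta_eq1.
by apply: (mulfI (expf_neq0 n zeta_neq0)); rewrite -exprD subnKC // mulr1.
Qed.

Lemma sum_roots (w : CC R) : w ^+ D = 1 -> \sum_(a < D) w ^+ a = if w == 1 then D%:R else 0.
Proof.
move=> wD; case: eqP => [->|/eqP w1].
  by rewrite (eq_bigr (fun=> 1)) ?sumr_const ?card_ord // => i _; rewrite expr1n.
apply/eqP; have := subrX1 w D; rewrite wD subrr => /esym/eqP.
by rewrite mulf_eq0 subr_eq0 (negbTE w1).
Qed.

Lemma sum_mulmod (g : nat -> CC R) (a : nat) : coprime a D ->
  (forall n, g (n %% D)%N = g n) -> \sum_(b < D) g (a * b)%N = \sum_(b < D) g b.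
Proof.
move=> ca gp.
pose h (b : 'I_D) : 'I_D := Ordinal (ltn_pmod (a * b) D0).
have hi : injective h.
  move=> b c [] /eqP e; apply/val_inj => /=.
  wlog bc : b c e / (b <= c)%N => [hw|].
    by have [/hw|/ltnW/hw h'] := leqP b c; [exact|rewrite h' // eq_sym].
  move: e; rewrite eq_sym eqn_mod_dvd ?leq_mul2l ?bc ?orbT // -mulnBr Gauss_dvdr; last first.
    by rewrite coprime_sym.
  have : (c - b < D)%N by apply: leq_ltn_trans (ltn_ord c); rewrite leq_subr.
  by move=> /[swap] /dvdn_leq; case: (posnP (c - b)) => [|cb /(_ isT)]; lia.
rewrite [RHS](reindex_inj hi); apply: eq_bigr => b _; by rewrite /h /= gp.
Qed.

Lemma exists_neg_inv a : coprime a D -> exists2 b, (b < D)%N & (D %| a * b + 1)%N.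
Proof.
move=> ca; case: (posnP a) ca => [->|a0 ca].
  by rewrite /coprime gcd0n => /eqP ->; exists 0%N.
have [u v e _] := egcdnP D a0.
rewrite (eqP (_ : gcdn a D == 1)%N) // in e.
(* [u] inverts [a] modulo D, and D - 1 stands for -1. *)
exists ((u * D.-1) %% D)%N; first by rewrite ltn_mod.
rewrite /dvdn -modnDml modnMmr modnDml.
have -> : (a * (u * D.-1) + 1 = D * (v * D.-1 + 1))%N by nia.
by rewrite modnMr.
Qed.

End RootsOfUnity.

(** * Primitive characters modulo a square-free D *)

Section Characters.
Variables (R : realType) (D : nat).
Hypotheses (D0 : (0 < D)%N) (Dsf : squarefree D).
Variable chi : int -> CC R.
Hypothesis chiP : primitive_character D chi.
Let chiD : dirichlet_character D chi. Proof. by case: chiP. Qed.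
Local Notation zeta := (zeta R D).

Lemma chi_cong (m n : int) : (D%:Z %| m - n)%Z -> chi m = chi n.
Proof.
have per (k : nat) x : chi (x + k%:Z * D%:Z) = chi x.
  elim: k => [|k IH]; first by rewrite mul0r addr0.
  rewrite -[RHS]IH -(dirichlet_periodic chiD (x + k%:Z * D%:Z)); congr chi; lia.
move=> /dvdzP[[k|k] e]; first by rewrite -(per k n) -e addrC subrK.
by rewrite -(per k.+1 m); congr chi; rewrite NegzE in e; lia.
Qed.

Lemma chi_mod (n : nat) : chi (n %% D)%N = chi n.
Proof.
apply: chi_cong; rewrite [in X in _ - X](divn_eq n D); apply/dvdzP.
exists (- (n %/ D)%N%:Z); lia.
Qed.

Lemma chi_neq0 (n : nat) : (chi n != 0) = coprime n D.
Proof. by rewrite (dirichlet_eq0 chiD) negbK coprimezE. Qed.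

Lemma chiX (n k : nat) : chi n ^+ k = chi (n ^ k)%N.
Proof.
elim: k => [|k IH]; first by rewrite expn0 (dirichlet1 chiD).
by rewrite exprS IH -(dirichletM chiD) expnS.
Qed.

Lemma chi_root (n : nat) : coprime n D -> chi n ^+ totient D = 1.
Proof.
move=> cn; rewrite chiX -chi_mod (cyclic.Euler_exp_totient cn) chi_mod; exact: (dirichlet1 chiD).
Qed.

Lemma nm_chi (n : nat) : coprime n D -> nm (chi n) = 1.
Proof.
move=> cn; apply/eqP; rewrite -(@pexpr_eq1 _ _ (totient D)) ?nm_ge0 ?totient_gt0 //.
by rewrite -nmX chi_root // nm1.
Qed.

Lemma nm_chi_le1 (n : nat) : nm (chi n) <= 1.
Proof.
have [/nm_chi -> //|] := boolP (coprime n D).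
by rewrite -chi_neq0 negbK => /eqP ->; rewrite nm0.
Qed.

(** The finite Fourier transform of [chi], a Gauss sum divided by D so that inversion carries no
    factor. *)
Definition tau (a : nat) : CC R := D%:R^-1 * \sum_(b < D) chi b * zeta^-1 ^+ (a * b).

Lemma DC0 : (D%:R : CC R) != 0. Proof. by rewrite pnatr_eq0 -lt0n. Qed.

Lemma tau_inversion (n : nat) : chi n = \sum_(a < D) tau a * zeta ^+ (a * n).
Proof.
have -> : \sum_(a < D) tau a * zeta ^+ (a * n) =
    D%:R^-1 * \sum_(b < D) chi b * \sum_(a < D) (zeta ^+ n / zeta ^+ b) ^+ a.
  rewrite mulr_sumr.
  under eq_bigr do rewrite /tau -mulrA mulr_suml mulr_sumr.
  rewrite exchange_big; apply: eq_bigr => b _; rewrite mulr_sumr mulr_sumr.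
  apply: eq_bigr => a _; rewrite -!mulrA; congr (_ * (_ * _)).
  by rewrite expr_div_n -!exprM exprVn mulrC; congr (_ * _^-1); congr (_ ^+ _); lia.
have nD : (n %% D < D)%N by rewrite ltn_mod.
rewrite (bigD1 (Ordinal nD)) //= [X in _ * (_ + X)]big1 ?addr0 => [|b bn]; last first.
  rewrite sum_roots; last by rewrite expr_div_n -!exprM ![(_ * D)%N]mulnC !exprM zetaD // !expr1n divr1.
  case: eqP => [/divr1_eq/(zeta_inj D0) e|]; last by rewrite mulr0.
  case/eqP: bn; apply/val_inj => /=; by rewrite e modn_small.
rewrite zeta_mod // mulfV ?expf_neq0 ?zeta_neq0 //.
rewrite sum_roots ?expr1n // eqxx chi_mod mulrCA mulVf ?mulr1 //; exact: DC0.
Qed.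

Lemma tau_coprime a : coprime a D -> chi a * tau a = tau 1.
Proof.
move=> ca; rewrite /tau mulrCA; congr (_ * _).
rewrite mulr_sumr.
rewrite -[RHS](@sum_mulmod R D D0 (fun b => chi b * zeta^-1 ^+ (1 * b)) a) //.
  by apply: eq_bigr => b _; rewrite mulrA -(dirichletM chiD) mul1n.
by move=> n; rewrite chi_mod !mul1n !exprVn zeta_mod.
Qed.

(* If [g = gcd(a, D) > 1] and [tau a != 0], then [chi] is trivial on the units
   congruent to 1 modulo [D / g], so it would be induced from [D / g]; this is
   where primitivity and square-freeness of [D] enter. *)
Lemma tau_noncoprime (a : nat) : ~~ coprime a D -> tau a = 0.
Proof.
move=> nca; apply/eqP/negP => /negP t0.
pose g := gcdn a D; pose d := (D %/ g)%N.
have gD : (g %| D)%N by exact: dvdn_gcdr.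
have g0 : (0 < g)%N by rewrite gcdn_gt0 D0 orbT.
have g1 : (1 < g)%N by rewrite ltn_neqAle g0 andbT eq_sym.
have eD : D = (d * g)%N by rewrite divnK.
have dD : (d %| D)%N by rewrite eD dvdn_mulr.
have d0 : (0 < d)%N by rewrite divn_gt0 // dvdn_leq.
have cdg : coprime d g.
  rewrite /coprime; apply/eqP; apply: Dsf; rewrite eD expnS expn1.
  by apply: dvdn_mul; [exact: dvdn_gcdl|exact: dvdn_gcdr].
(* If a c = a modulo D, the substitution b -> c b in the Gauss sum gives chi(c) tau(a) = tau(a). The
   inequality keeps the truncated subtraction exact. *)
have fixc (c : nat) : coprime c D -> (D %| a * c - a)%N -> (a <= a * c)%N -> chi c = 1.
  move=> cc dac ac; apply: (mulIf t0); rewrite mul1r.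
  rewrite /tau mulrCA; congr (_ * _).
  rewrite mulr_sumr -[RHS](@sum_mulmod R D D0 (fun b => chi b * zeta^-1 ^+ (a * b)) c) //.
    apply: eq_bigr => b _; rewrite mulrA -(dirichletM chiD); congr (_ * _).
    have -> : (a * (c * b) = (a * c - a) * b + a * b)%N by rewrite mulnA -mulnDl subnK.
    have /dvdnP[q ->] := dac; rewrite exprD.
    have -> : zeta^-1 ^+ (q * D * b) = 1.
      by rewrite exprVn -mulnA mulnCA exprM zetaD // expr1n invr1.
    by rewrite mul1r.
  move=> n; rewrite chi_mod !exprVn; congr (_ * _^-1).
  by rewrite mulnC exprM zeta_mod // -exprM mulnC.
have fixz (c : int) : coprimez c D%:Z -> (d%:Z %| c - 1)%Z -> chi c = 1.
  move=> cc /dvdzP[q eq].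
  (* A natural representative of [c]; adding D makes it positive, as [fixc] requires. *)
  pose c' := absz (c %% D%:Z)%Z + D : nat.
  have ec : chi c = chi c'%N.
    apply: chi_cong; rewrite /c'; have h0 : 0 <= (c %% D%:Z)%Z by rewrite modz_ge0 //; lia.
    apply/dvdzP; exists ((c %/ D%:Z)%Z - 1); rewrite {1}(divz_eq c D%:Z).
    rewrite -[Posz (_ + _)]/(Posz (absz (c %% D)%Z + D)%N) PoszD gez0_abs //; ring.
  rewrite ec; apply: fixc.
  - by rewrite -chi_neq0 -ec (dirichlet_eq0 chiD) negbK.
  - have [q' ea] : exists q', a = (q' * g)%N by apply/dvdnP; exact: dvdn_gcdl.
    have [q'' ec'] : exists q'' : int, c'%:Z - 1 = q'' * d%:Z.
      exists (q - (c %/ D%:Z)%Z * g%:Z + g%:Z).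
      have h0 : 0 <= (c %% D%:Z)%Z by rewrite modz_ge0 //; lia.
      rewrite /c' PoszD gez0_abs // mulrDl mulrBl -eq -mulrA.
      have -> : g%:Z * d%:Z = D%:Z by rewrite -PoszM mulnC -eD.
      have := divz_eq c D%:Z; set Q := (c %/ D%:Z)%Z; set S := (c %% D%:Z)%Z => e.
      by rewrite e; ring.
    have c1 : (1 <= c')%N by rewrite /c'; lia.
    rewrite -{2}[a]muln1 -mulnBr ea.
    suff /dvdnP[p ->] : (d %| c' - 1)%N by rewrite mulnACA [(g * d)%N]mulnC -eD dvdn_mull.
    have : (d%:Z %| c'%:Z - 1%:Z)%Z by apply/dvdzP; exists q''.
    by rewrite subzn.
  - by rewrite leq_pmulr // /c'; lia.
case: chiP => _ /(_ d dD) [] //; first by rewrite {1}eD ltn_Pmulr.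
(* Square-freeness makes d and g coprime. By the Chinese remainder theorem n u + v is n modulo d and
   1 modulo g, and [chi] at this point is the character modulo d that induces [chi]. *)
have [u [v [ud ug vd vg]]] : exists u v : int,
    [/\ (d%:Z %| u - 1)%Z, (g%:Z %| u)%Z, (d%:Z %| v)%Z & (g%:Z %| v - 1)%Z].
  have : coprimez d%:Z g%:Z by rewrite coprimezE.
  move=> /coprimezP[[x y] /= e]; exists (y * g%:Z), (x * d%:Z); split.
  - by apply/dvdzP; exists (- x); lia.
  - exact: dvdz_mull.
  - exact: dvdz_mull.
  - by apply/dvdzP; exists (- y); lia.
have dg x : (D%:Z %| x)%Z = (d%:Z %| x)%Z && (g%:Z %| x)%Z.
  by rewrite eD PoszM Gauss_dvdz // coprimezE.
have nd n : (d%:Z %| n * u + v - n)%Z.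
  have -> : n * u + v - n = n * (u - 1) + v by ring.
  by rewrite rpredD // dvdz_mull.
have ng n : (g%:Z %| n * u + v - 1)%Z.
  have -> : n * u + v - 1 = n * u + (v - 1) by ring.
  by rewrite rpredD // dvdz_mull.
have chi0E n : (chi (n * u + v) == 0) = ~~ coprimez n d%:Z.
  rewrite (dirichlet_eq0 chiD) eD PoszM coprimezMr; congr negb.
  have -> : coprimez (n * u + v) g%:Z.
    have /dvdzP[q e] := ng n; apply/coprimezP; exists (1, - q); rewrite /=; lia.
  rewrite andbT; have /dvdzP[q e] := nd n.
  have e1 : n * u + v = q * d%:Z + n by rewrite -e subrK.
  apply/coprimezP/coprimezP => -[[x y] /= e'].
    by exists (x, x * q + y); rewrite /= -[RHS]e' e1; ring.
  by exists (x, y - x * q); rewrite /= e1 -[RHS]e'; ring.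
exists (fun n => chi (n * u + v)); split; first split.
- rewrite -(dirichlet1 chiD); apply: chi_cong; by rewrite dg nd ng.
- move=> m n; rewrite -(dirichletM chiD); apply: chi_cong; rewrite dg; apply/andP; split.
    have -> : m * n * u + v - (m * u + v) * (n * u + v) =
       (m * n * u + v - m * n) - ((m * u + v - m) * (n * u + v) + m * (n * u + v - n)) by ring.
    apply: rpredB; first exact: nd.
    by apply: rpredD; [apply: dvdz_mulr; exact: nd|apply: dvdz_mull; exact: nd].
  have -> : m * n * u + v - (m * u + v) * (n * u + v) =
     (m * n * u + v - 1) - ((m * u + v - 1) * (n * u + v) + (n * u + v - 1)) by ring.
  apply: rpredB; first exact: ng.
  by apply: rpredD; [apply: dvdz_mulr; exact: ng|exact: ng].
- move=> n; apply: chi_cong; rewrite dg.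
  have -> : (n + d%:Z) * u + v - (n * u + v) = d%:Z * u by ring.
  by rewrite dvdz_mulr // dvdz_mull.
- exact: chi0E.
move=> n cn; set n' := n * u + v.
have /coprimezP[[m y] /= e] := cn.
have nz : chi n != 0 by rewrite (dirichlet_eq0 chiD) negbK.
have n'z : chi n' != 0.
  by rewrite chi0E negbK; move: cn; rewrite eD PoszM coprimezMr => /andP[].
have eqn : chi (n' * m) * chi n = chi n'.
  rewrite -(dirichletM chiD); apply: chi_cong; apply/dvdzP; exists (- (n' * y)).
  have -> : n' * m * n - n' = n' * (m * n - 1) by ring.
  have -> : m * n = 1 - y * D%:Z by rewrite -e addrK.
  by ring.
(* [m] inverts [n] modulo D and n' = n modulo d, so n' m = 1 modulo d, and [fixz] applies. *)
suff c1 : chi (n' * m) = 1 by rewrite -eqn c1 mul1r.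
apply: fixz.
  by move: n'z; rewrite -eqn mulf_eq0 negb_or (dirichlet_eq0 chiD) negbK => /andP[].
have /dvdzP[q eq] := nd n; apply/dvdzP; exists (q * m - y * g%:Z).
have -> : n' * m - 1 = (n' - n) * m + (m * n - 1) by ring.
rewrite /n' eq; have -> : m * n = 1 - y * D%:Z by rewrite -e addrK.
by rewrite {1}eD PoszM; ring.
Qed.

Lemma nm_tau (a : nat) : nm (tau a) <= nm (tau 1).
Proof.
have [ca|/tau_noncoprime ->] := boolP (coprime a D); last by rewrite nm0 nm_ge0.
by rewrite -(tau_coprime ca) nmM nm_chi // mul1r.
Qed.

(** Fourier inversion at n = 1 writes 1 as a sum of D terms, each of modulus at most |tau(1)|. *)
Lemma nm_tau1_ge : D%:R^-1 <= nm (tau 1).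
Proof.
have DR : 0 < D%:R :> R by rewrite ltr0n.
rewrite -div1r ler_pdivrMr //.
have := tau_inversion 1; rewrite (dirichlet1 chiD) => e.
rewrite -[X in X <= _](@nm1 R) e; apply: le_trans (nm_sum _ _ _) _.
apply: (@le_trans _ _ (\sum_(a < D) nm (tau 1))).
  by apply: ler_sum => a _; rewrite nmM nmX nm_zeta expr1n mulr1 nm_tau.
by rewrite sumr_const card_ord mulr_natr.
Qed.

Lemma nm_tau_le1 (a : nat) : nm (tau a) <= 1.
Proof.
have DR : 0 < D%:R :> R by rewrite ltr0n.
rewrite /tau nmM nmV nm_nat mulrC ler_pdivrMr // mul1r.
apply: le_trans (nm_sum _ _ _) _.
apply: (@le_trans _ _ (\sum_(b < D) 1)).
  apply: ler_sum => b _; rewrite nmM nmX nmV nm_zeta invr1 expr1n mulr1; exact: nm_chi_le1.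
by rewrite sumr_const card_ord.
Qed.

(** The residue D - 1 stands for -1 and turns zeta^-1 into zeta. *)
Lemma gauss_tau : \sum_(b < D) chi b * zeta ^+ b = D%:R * tau D.-1.
Proof.
rewrite /tau mulVKf ?DC0 //; apply: eq_bigr => b _; congr (_ * _).
apply: (mulIf (expf_neq0 (D.-1 * b) (zeta_neq0 R D))).
rewrite -exprMn mulVf ?zeta_neq0 // expr1n -exprD.
have -> : (b + D.-1 * b = D * b)%N by rewrite -mulSn prednK.
by rewrite exprM zetaD // expr1n.
Qed.

(** Here s(a) is -1/a modulo D, so tau(a) = tau(1) chi(-1) chi(s(a)), and the sum becomes tau(1)
    chi(-1) times the Gauss sum at m, from which 1/chi(m) splits off. Its modulus D |tau(1)|^2 is at
    least 1/D by [nm_tau1_ge]. *)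
Lemma tau_twisted_sum (s : nat -> nat) : (forall a, coprime a D -> (s a < D)%N /\ (D %| a * s a + 1)%N) ->
  exists2 kappa : CC R, D%:R^-1 <= nm kappa & forall m : nat, coprime m D ->
   chi m * \sum_(a < D | coprime a D) tau a * zeta ^+ (m * s a) = kappa.
Proof.
move=> hs.
have chi_s a : coprime a D -> chi a * chi (s a) = chi (-1).
  move=> /hs[_ /dvdnP[q e]]; rewrite -(dirichletM chiD); apply: chi_cong.
  by apply/dvdzP; exists q%:Z; rewrite -!PoszM; lia.
have chiN : chi (-1) * chi (-1) = 1.
  by rewrite -(dirichletM chiD) mulN1r opprK; exact: (dirichlet1 chiD).
have cs a : coprime a D -> coprime (s a) D.
  move=> ca; rewrite -chi_neq0; apply: contra_eqN chiN => /eqP h.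
  by rewrite -(chi_s a ca) h mulr0 mul0r eq_sym oner_eq0.
(* [s] continued by the identity off the units, so as to be a permutation of all residues. *)
pose h (a : 'I_D) : 'I_D := if coprime a D =P true is ReflectT ca
  then Ordinal (hs _ ca).1 else a.
have hE (a : 'I_D) : coprime a D -> h a = s a :> nat by rewrite /h; case: eqP.
have hN (a : 'I_D) : ~~ coprime a D -> h a = a.
  by move=> nca; rewrite /h; case: eqP => // ca; rewrite ca in nca.
have hc a : coprime (h a) D = coprime a D.
  have [ca|nca] := boolP (coprime a D); first by rewrite hE //; exact: cs.
  by rewrite hN //; exact: negbTE.
have hi : injective h.
  move=> a b e; have := hc a; rewrite e hc => cab.
  have [ca|nca] := boolP (coprime a D); last first.
    have ncb : ~~ coprime b D by rewrite cab.
    by rewrite -(hN a nca) e hN.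
  have cb : coprime b D by rewrite cab.
  have es : s a = s b by rewrite -hE // e hE.
  have [_ da] := hs _ ca; have [_ db] := hs _ cb; rewrite es in da.
  apply/val_inj => /=.
  wlog ab : a b {e cab} ca cb es da db / (a <= b)%N => [hw|].
    have [ab|/ltnW ba] := leqP a b; first exact: hw.
    by apply/esym; apply: hw; rewrite ?es.
  have : (D %| (b - a) * s b)%N.
    have -> : ((b - a) * s b = (b * s b + 1) - (a * s b + 1))%N by nia.
    exact: dvdn_sub.
  rewrite Gauss_dvdl; last by rewrite coprime_sym; exact: cs.
  have : (b - a < D)%N by apply: leq_ltn_trans (ltn_ord b); rewrite leq_subr.
  by move=> /[swap] /dvdn_leq; case: (posnP (b - a)) => [|ab' /(_ isT)]; lia.
have tE a : coprime a D -> tau a = tau 1 * chi (-1) * chi (s a).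
  move=> ca; rewrite -(tau_coprime ca) -(chi_s _ ca).
  have : chi a * chi (s a) * (chi a * chi (s a)) = 1 by rewrite chi_s.
  move=> e; rewrite -[LHS]mulr1 -e; ring.
pose G := \sum_(b < D) chi b * zeta ^+ b.
exists (tau 1 * chi (-1) * G).
  have nG : nm G = D%:R * nm (tau 1).
    have cD : coprime D.-1 D by rewrite -[X in coprime _ X](prednK D0) coprimenS.
    by rewrite /G gauss_tau nmM nm_nat -(tau_coprime cD) nmM nm_chi // mul1r.
  have n1 : nm (chi (-1)) = 1.
    by apply/eqP; rewrite -(@pexpr_eq1 _ _ 2) ?nm_ge0 // expr2 -nmM chiN nm1.
  rewrite nmM [nm (tau 1 * _)]nmM nG n1 mulr1.
  have DR : 0 < D%:R :> R by rewrite ltr0n.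
  have t := nm_tau1_ge; set x := nm (tau 1) in t *.
  have : 1 <= x * D%:R by rewrite -ler_pdivrMr // div1r.
  have : 0 <= x by exact: nm_ge0.
  move=> x0 x1; apply: le_trans t _; rewrite [D%:R * x]mulrC.
  apply: (@le_trans _ _ (x * 1)); [by rewrite mulr1|].
  exact: (ler_wpM2l x0 x1).
move=> m cm.
have -> : \sum_(a < D | coprime a D) tau a * zeta ^+ (m * s a) =
    tau 1 * chi (-1) * \sum_(b < D) chi b * zeta ^+ (m * b).
  rewrite [X in _ = _ * X](bigID (fun b : 'I_D => coprime b D)) /= [X in _ = _ * (_ + X)]big1.
    rewrite addr0 [in RHS](reindex_inj hi) /= mulr_sumr.
    rewrite (eq_bigl (fun a : 'I_D => coprime a D)) => [|a]; last by [].
    rewrite [RHS](eq_bigl (fun a : 'I_D => coprime a D)) => [|a]; last by rewrite hc.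
    by apply: eq_bigr => a ca; rewrite hE // tE // mulrA.
  by move=> b; rewrite -chi_neq0 negbK => /eqP ->; rewrite mul0r.
rewrite mulrCA; congr (_ * _); rewrite mulr_sumr /G.
rewrite -[RHS](@sum_mulmod R D D0 (fun b => chi b * zeta ^+ b) m) //.
  by apply: eq_bigr => b _; rewrite mulrA -(dirichletM chiD).
by move=> n; rewrite chi_mod zeta_mod.
Qed.

End Characters.

(** * Integrals over the positive half-line *)

Section GammaIntegrals.
Variable R : realType.
Implicit Types (b t x : R) (p n : nat).
Local Notation mu := (@lebesgue_measure R).
Local Notation Rp := (`]0, +oo[%classic : set R).

Lemma Rp_measurable : measurable Rp.
Proof. exact: measurable_itv. Qed.

Lemma is_derive_expb b x :
  is_derive x 1 (fun s : R => expR (- (b * s))) (- b * expR (- (b * x))).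
Proof.
have h : is_derive x 1 (fun s : R => - (b * s)) (- b).
  have : is_derive x 1 (fun s : R => (- b) *: (s : R^o)) ((- b) *: (1 : R^o)).
    exact: is_deriveZ.
  rewrite /GRing.scale /= mulr1; congr is_derive.
  by apply/funext => s; rewrite mulNr.
have := @is_derive1_comp R expR (fun s => - (b * s)) x _ _ (is_derive_expR _) h.
by rewrite mulrC.
Qed.

Lemma is_derive_powexp b p x :
  is_derive x 1 (fun s : R => s ^+ p.+1 * expR (- (b * s)))
    (p.+1%:R * x ^+ p * expR (- (b * x)) - b * (x ^+ p.+1 * expR (- (b * x)))).
Proof.
have h1 : is_derive x 1 (fun s : R => s ^+ p.+1) (p.+1%:R * x ^+ p).
  have := @is_deriveX R R^o id p.+1 x 1 1 (is_derive_id _ _).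
  rewrite exprfctE /GRing.scale /= mulr1 mulr_natl; exact.
have := is_deriveM h1 (is_derive_expb b x).
move=> h; apply: is_derive_eq h _.
by rewrite /GRing.scale /=; ring.
Qed.

(** The antiderivative of s^p exp(-b s) given by repeated integration by parts, which vanishes at
    infinity for b > 0. *)
Fixpoint gprim b p (s : R) : R :=
  match p with
  | 0 => - (b^-1 * expR (- (b * s)))
  | q.+1 => - (b^-1 * (s ^+ q.+1 * expR (- (b * s)))) + b^-1 * q.+1%:R * gprim b q s
  end.

Lemma is_derive_gprim b p x : b != 0 ->
  is_derive x 1 (gprim b p) (x ^+ p * expR (- (b * x))).
Proof.
move=> b0; elim: p => [|p IH].
  have := is_deriveN (is_deriveZ b^-1 (is_derive_expb b x)).
  move=> h; apply: is_derive_eq h _; rewrite /GRing.scale /=.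
  by rewrite expr0 mul1r mulrA mulrN mulVf // mulN1r opprK.
have := is_deriveD (is_deriveN (is_deriveZ b^-1 (is_derive_powexp b p x)))
  (is_deriveZ (b^-1 * p.+1%:R) IH).
move=> h; apply: is_derive_eq h _; rewrite /GRing.scale /=.
rewrite mulrBr !mulrA mulVf // mul1r; ring.
Qed.

Lemma gprim0 b p : b != 0 -> gprim b p 0 = - (p`!%:R / b ^+ p.+1).
Proof.
move=> b0; elim: p => [|p IH] /=; first by rewrite mulr0 oppr0 expR0 fact0 expr1 mulrC.
rewrite expr0n mul0r mulr0 oppr0 add0r IH factS natrM [b ^+ p.+2]exprS invfM; ring.
Qed.

Lemma powexp_le b n s : 0 < b -> 0 < s ->
  s ^+ n * expR (- (b * s)) <= n.+1`!%:R / b ^+ n.+1 / s.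
Proof.
move=> b0 s0; have bs : 0 <= b * s by rewrite mulr_ge0 // ltW.
have h := expR_ge1Dxn n bs; have bp : 0 < b ^+ n.+1 by rewrite exprn_gt0.
have f0 : 0 < n.+1`!%:R :> R by rewrite ltr0n fact_gt0.
rewrite expRN ler_pdivrMr ?expR_gt0 //.
have : (b * s) ^+ n.+1 / n.+1`!%:R <= expR (b * s) by lra.
rewrite exprMn => h2.
have -> : s ^+ n = n.+1`!%:R / b ^+ n.+1 / s * (b ^+ n.+1 * s ^+ n.+1 / n.+1`!%:R).
  by rewrite [s ^+ n.+1]exprS; field;
    rewrite ?(gt_eqF f0) ?(gt_eqF s0) ?(gt_eqF bp) ?expf_neq0 ?(gt_eqF b0).
by rewrite ler_wpM2l // !divr_ge0 // ltW.
Qed.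

Lemma cvg_powexp_y b n : 0 < b -> (s ^+ n * expR (- (b * s)) @[s --> +oo%R] --> (0 : R))%classic.
Proof.
move=> b0; set C := n.+1`!%:R / b ^+ n.+1 : R.
apply/cvgrPdist_le => e e0; near=> s.
have s0 : 0 < s by near: s; apply: nbhs_pinfty_gt; exact: num_real.
have g0 : 0 <= s ^+ n * expR (- (b * s)).
  by apply: mulr_ge0; [apply: exprn_ge0; exact: ltW|exact: expR_ge0].
rewrite sub0r normrN (ger0_norm g0).
apply: le_trans (powexp_le n b0 s0) _; rewrite -/C.
have sC : C / e <= s by near: s; apply: nbhs_pinfty_ge; exact: num_real.
by rewrite ler_pdivrMr // [e * s]mulrC -ler_pdivrMr.
Unshelve. all: by end_near. Qed.

Lemma cvg_powexp_inv b n : 0 < b ->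
  ((t^-1) ^+ n * expR (- (b * t^-1)) @[t --> (0 : R)^'+] --> (0 : R))%classic.
Proof.
move=> b0; set C := n.+1`!%:R / b ^+ n.+1 : R.
have C0 : 0 < C by rewrite divr_gt0 ?exprn_gt0 // ltr0n fact_gt0.
apply/cvgrPdist_le => e e0; near=> t.
have t0 : 0 < t by near: t; exact: nbhs_right_gt.
have i0 : 0 < t^-1 by rewrite invr_gt0.
have g0 : 0 <= (t^-1) ^+ n * expR (- (b * t^-1)).
  by apply: mulr_ge0; [apply: exprn_ge0; exact: ltW|exact: expR_ge0].
rewrite sub0r normrN (ger0_norm g0).
apply: le_trans (powexp_le n b0 i0) _; rewrite -/C invrK mulrC -ler_pdivlMr //.
by near: t; apply: nbhs_right_le; rewrite divr_gt0.
Unshelve. all: by end_near. Qed.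

Lemma cvg_gprim_y b p : 0 < b -> (gprim b p s @[s --> +oo%R] --> (0 : R))%classic.
Proof.
move=> b0; elim: p => [|p IH].
  have H : (- (b^-1 * (s ^+ 0 * expR (- (b * s)))) @[s --> +oo%R] --> - (b^-1 * (0 : R)))%classic.
    by apply: cvgN; apply: cvgM; [exact: cvg_cst|exact: cvg_powexp_y].
  rewrite mulr0 oppr0 in H; apply: cvg_trans H; apply: near_eq_cvg.
  by near=> s; rewrite /= expr0 mul1r.
have H : (- (b^-1 * (s ^+ p.+1 * expR (- (b * s)))) + b^-1 * p.+1%:R * gprim b p s
    @[s --> +oo%R] --> - (b^-1 * (0 : R)) + b^-1 * p.+1%:R * 0)%classic.
  apply: cvgD; first by apply: cvgN; apply: cvgM; [exact: cvg_cst|exact: cvg_powexp_y].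
  by apply: cvgM; [exact: cvg_cst|exact: IH].
by rewrite !mulr0 oppr0 addr0 in H.
Unshelve. all: by end_near. Qed.

Lemma cvg_gprim_inv b p : 0 < b -> (gprim b p t^-1 @[t --> (0 : R)^'+] --> (0 : R))%classic.
Proof.
move=> b0; elim: p => [|p IH].
  have H : (- (b^-1 * (s^-1 ^+ 0 * expR (- (b * s^-1)))) @[s --> (0 : R)^'+] -->
    - (b^-1 * (0 : R)))%classic.
    by apply: cvgN; apply: cvgM; [exact: cvg_cst|exact: cvg_powexp_inv].
  rewrite mulr0 oppr0 in H; apply: cvg_trans H; apply: near_eq_cvg.
  by near=> s; rewrite /= expr0 mul1r.
have H : (- (b^-1 * (s^-1 ^+ p.+1 * expR (- (b * s^-1)))) + b^-1 * p.+1%:R * gprim b p s^-1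
    @[s --> (0 : R)^'+] --> - (b^-1 * (0 : R)) + b^-1 * p.+1%:R * 0)%classic.
  apply: cvgD; first by apply: cvgN; apply: cvgM; [exact: cvg_cst|exact: cvg_powexp_inv].
  by apply: cvgM; [exact: cvg_cst|exact: IH].
by rewrite !mulr0 oppr0 addr0 in H.
Unshelve. all: by end_near. Qed.

Lemma integral_Rp (f F : R -> R) (l : R) : (forall x, 0 <= x -> 0 <= f x) ->
  (forall x, 0 < x -> {for x, continuous f}) -> (f x @[x --> 0^'+] --> f 0)%classic ->
  (F x @[x --> +oo%R] --> l)%classic -> (F x @[x --> 0^'+] --> F 0)%classic ->
  (forall x, 0 < x -> is_derive x 1 F (f x)) ->
  mu.-integrable Rp (EFin \o f) /\ (\int[mu]_(x in Rp) f x = l - F 0)%R.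
Proof.
move=> f0 cf cf0 Fy F0 dF.
have mf : measurable_fun Rp f.
  apply: open_continuous_measurable_fun; first exact: interval_open.
  by move=> x; rewrite inE /= in_itv /= andbT; exact: cf.
have mEf : measurable_fun Rp (EFin \o f) by apply/measurable_EFinP.
have wf : {within `[0, +oo[, continuous f}%classic.
  by apply/continuous_within_itvcyP; split=> // x; rewrite in_itv /= andbT; exact: cf.
have E : (\int[mu]_(x in Rp) (f x)%:E = l%:E - (F 0)%:E)%E.
  rewrite integral_itv_obnd_cbnd //.
  apply: ge0_continuous_FTC2y => //.
  - by move=> x x0; have [] := dF x x0.
  - by move=> x; rewrite in_itv /= andbT => x0; rewrite derive1E; have [_ ->] := dF x x0.
split; last by rewrite /Rintegral E -EFinB.
apply/integrableP; split=> //.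
apply: (@le_lt_trans _ _ (\int[mu]_(x in Rp) (f x)%:E)%E); last first.
  by rewrite E -EFinB ltry.
rewrite le_eqVlt; apply/orP; left; apply/eqP; apply: eq_integral => x.
rewrite inE /= in_itv /= andbT => x0.
by rewrite ger0_norm // f0 // ltW.
Qed.

Lemma integral_powexp b p : 0 < b ->
  mu.-integrable Rp (EFin \o (fun t => t ^+ p * expR (- (b * t)))) /\
  (\int[mu]_(t in Rp) (t ^+ p * expR (- (b * t))) = p`!%:R / b ^+ p.+1)%R.
Proof.
move=> b0; have bn : b != 0 by rewrite gt_eqF.
have cont x : {for x, continuous (fun t : R => t ^+ p * expR (- (b * t)))}.
  case: p => [|p].
    have h := is_derive_expb b x.
    apply/differentiable_continuous/derivable1_diffP.
    have -> : (fun t : R => t ^+ 0 * expR (- (b * t))) = fun t => expR (- (b * t)).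
      by apply/funext => t; rewrite expr0 mul1r.
    by case: h.
  apply/differentiable_continuous/derivable1_diffP.
  by case: (is_derive_powexp b p x).
have contg x : {for x, continuous (gprim b p)}.
  apply/differentiable_continuous/derivable1_diffP.
  by case: (is_derive_gprim p x bn).
have [|||||| h1 h2] := @integral_Rp (fun t => t ^+ p * expR (- (b * t))) (gprim b p) 0.
- by move=> x x0; apply: mulr_ge0; [exact: exprn_ge0|exact: expR_ge0].
- by move=> x _; exact: cont.
- by apply: cvg_at_right_filter; exact: cont.
- exact: cvg_gprim_y.
- by apply: cvg_at_right_filter; exact: contg.
- by move=> x _; exact: is_derive_gprim.
by split=> //; rewrite h2 gprim0 // sub0r opprK.
Qed.

(** [integral_powexp] after t -> 1/t, carried out on the antiderivative; the exponent p + 2 contains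
    the factor t^(-2) of the substitution. *)
Lemma integral_invexp b p : 0 < b ->
  mu.-integrable Rp (EFin \o (fun t => (t^-1) ^+ p.+2 * expR (- (b * t^-1)))) /\
  (\int[mu]_(t in Rp) ((t^-1) ^+ p.+2 * expR (- (b * t^-1))) = p`!%:R / b ^+ p.+1)%R.
Proof.
move=> b0; have bn : b != 0 by rewrite gt_eqF.
(* The value at 0 is imposed: since 0^-1 = 0, the bare formula would give there -gprim b p 0 instead
   of the right limit 0. *)
pose F t := if t <= 0 then 0 else - gprim b p t^-1.
have nearF x : 0 < x -> \near x, - gprim b p x^-1 = F x.
  move=> x0; near=> t; have t0 : 0 < t by near: t; exact: lt_nbhsr.
  by rewrite /F leNgt t0.
have dinv x : 0 < x -> is_derive x 1 (fun t : R => t^-1) (- (x ^- 2)).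
  move=> x0; have x1 : x != 0 by rewrite gt_eqF.
  have := @is_deriveV R id x 1 1 x1 (is_derive_id _ _).
  by rewrite /GRing.scale /= mulr1.
have cont x : 0 < x -> {for x, continuous (fun t : R => (t^-1) ^+ p.+2 * expR (- (b * t^-1)))}.
  move=> x0; apply/differentiable_continuous/derivable1_diffP.
  have := is_derive1_comp (is_derive_powexp b p.+1 x^-1) (dinv x x0).
  by case.
(* With 0^-1 = 0 the integrand takes at 0 exactly its right limit. *)
have e0 : (0 : R)^-1 ^+ p.+2 * expR (- (b * 0^-1)) = 0.
  by rewrite invr0 expr0n mul0r.
have F0 : F 0 = 0 by rewrite /F lexx.
have [|||||| h1 h2] := @integral_Rp (fun t => (t^-1) ^+ p.+2 * expR (- (b * t^-1))) F (p`!%:R / b ^+ p.+1).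
- by move=> x x0; apply: mulr_ge0; [rewrite exprn_ge0 // invr_ge0|exact: expR_ge0].
- exact: cont.
- rewrite e0; exact: cvg_powexp_inv.
- have -> : p`!%:R / b ^+ p.+1 = - gprim b p 0 by rewrite gprim0 // opprK.
  apply/cvgrPdist_le => e ee0.
  have : {for (0 : R), continuous (gprim b p)}.
    apply/differentiable_continuous/derivable1_diffP.
    by case: (is_derive_gprim p 0 bn).
  move=> /cvgrPdist_le/(_ e ee0)/nbhs_norm0P[d /= d0 hd].
  near=> t; have t0 : 0 < t by near: t; apply: nbhs_pinfty_gt; exact: num_real.
  rewrite /F [t <= 0]leNgt t0 /= -opprD normrN; apply: hd => /=.
  rewrite ger0_norm ?invr_ge0 ?ltW // -[d]invrK ltf_pV2 ?posrE ?invr_gt0 //.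
  by near: t; apply: nbhs_pinfty_gt; exact: num_real.
- have h : (- gprim b p t^-1 @[t --> (0 : R)^'+] --> - (0 : R))%classic.
    by apply: cvgN; exact: cvg_gprim_inv.
  rewrite oppr0 in h; rewrite F0.
  have hF : {near ((0 : R)^'+)%classic, (fun t => - gprim b p t^-1) =1 F}.
    near=> t; have t0 : 0 < t by near: t; exact: nbhs_right_gt.
    by rewrite /F [t <= 0]leNgt t0.
  exact: (cvg_trans (near_eq_cvg hF) h).
- move=> x x0; apply: near_eq_is_derive (nearF x x0) _.
  have := is_deriveN (is_derive1_comp (is_derive_gprim p x^-1 bn) (dinv x x0)).
  move=> h; apply: is_derive_eq h _.
  by rewrite mulrN opprK -exprVn mulrAC -exprD addn2.
by split=> //; rewrite h2 F0 subr0.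
Unshelve. all: by end_near. Qed.

End GammaIntegrals.

(** * Integrals of complex-valued functions *)

Section ComplexIntegrals.
Variable R : realType.
Local Notation mu := (@lebesgue_measure R).
Local Notation Rp := (`]0, +oo[%classic : set R).
Implicit Types (g : R -> CC R) (G : R -> R).

Definition cintegrable g := mu.-integrable Rp (EFin \o (fun t => complex.Re (g t))) /\
  mu.-integrable Rp (EFin \o (fun t => complex.Im (g t))).

Lemma cintegrable_dom g G : measurable_fun Rp (fun t => complex.Re (g t)) ->
  measurable_fun Rp (fun t => complex.Im (g t)) ->
  mu.-integrable Rp (EFin \o G) -> (forall t, 0 < t -> nm (g t) <= G t) -> cintegrable g.
Proof.
move=> m1 m2 iG hG.
have mR : measurable Rp by exact: Rp_measurable.
split; apply: (@le_integrable _ _ _ mu Rp mR _ (EFin \o G) _ _ iG).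
- exact/measurable_EFinP.
- move=> t; rewrite /= in_itv /= andbT => t0; rewrite lee_fin.
  by apply: le_trans (Re_le_nm _) _; apply: le_trans (hG t t0) _; exact: ler_norm.
- exact/measurable_EFinP.
- move=> t; rewrite /= in_itv /= andbT => t0; rewrite lee_fin.
  by apply: le_trans (Im_le_nm _) _; apply: le_trans (hG t t0) _; exact: ler_norm.
Qed.

Lemma cintegrableD g h : cintegrable g -> cintegrable h ->
  cintegrable (fun t => g t + h t) /\
  Cintegral (fun t => g t + h t) = Cintegral g + Cintegral h.
Proof.
move=> [g1 g2] [h1 h2]; have mR : measurable Rp by exact: Rp_measurable.
have e1 : (fun t => complex.Re (g t + h t)) = fun t => complex.Re (g t) + complex.Re (h t).
  by apply/funext => t; rewrite ReD.
have e2 : (fun t => complex.Im (g t + h t)) = fun t => complex.Im (g t) + complex.Im (h t).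
  by apply/funext => t; rewrite ImD.
split.
  rewrite /cintegrable e1 e2; split.
    by have := @integrableD _ _ R mu Rp mR _ _ g1 h1; congr (_.-integrable _ _).
  by have := @integrableD _ _ R mu Rp mR _ _ g2 h2; congr (_.-integrable _ _).
rewrite /Cintegral e1 e2 (@RintegralD _ _ R mu Rp _ _ mR g1 h1) (@RintegralD _ _ R mu Rp _ _ mR g2 h2).
by apply: CC_eq; rewrite ?ReD ?ImD.
Qed.

Lemma cintegrableZ (c : CC R) g : cintegrable g ->
  cintegrable (fun t => c * g t) /\ Cintegral (fun t => c * g t) = c * Cintegral g.
Proof.
move=> [g1 g2]; have mR : measurable Rp by exact: Rp_measurable.
have iZ (f : R -> R) k : mu.-integrable Rp (EFin \o f) ->
    mu.-integrable Rp (EFin \o (fun t => k * f t)).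
  by move=> hf; have := @integrableZl _ _ R mu Rp mR k _ hf; congr (_.-integrable _ _).
have e1 : (fun t => complex.Re (c * g t)) =
    fun t => complex.Re c * complex.Re (g t) - complex.Im c * complex.Im (g t).
  by apply/funext => t; rewrite ReM.
have e2 : (fun t => complex.Im (c * g t)) =
    fun t => complex.Re c * complex.Im (g t) + complex.Im c * complex.Re (g t).
  by apply/funext => t; rewrite ImM.
split.
  rewrite /cintegrable e1 e2; split.
    by have := @integrableB _ _ R mu Rp mR _ _ (iZ _ (complex.Re c) g1) (iZ _ (complex.Im c) g2);
      congr (_.-integrable _ _).
  by have := @integrableD _ _ R mu Rp mR _ _ (iZ _ (complex.Re c) g2) (iZ _ (complex.Im c) g1);
      congr (_.-integrable _ _).
rewrite /Cintegral e1 e2 (@RintegralB _ _ R mu Rp _ _ mR (iZ _ _ g1) (iZ _ _ g2)).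
rewrite (@RintegralD _ _ R mu Rp _ _ mR (iZ _ _ g2) (iZ _ _ g1)) !(@RintegralZl _ _ R mu Rp _ _ mR) //.
by apply: CC_eq; rewrite ?ReM ?ImM.
Qed.

Lemma cintegral_sum (I : Type) (r : seq I) (c : I -> CC R) (g : I -> R -> CC R) :
  (forall i, cintegrable (g i)) -> cintegrable (fun t => \sum_(i <- r) c i * g i t) /\
  Cintegral (fun t => \sum_(i <- r) c i * g i t) = \sum_(i <- r) c i * Cintegral (g i).
Proof.
move=> hg; elim: r => [|i r [IH1 IH2]].
  have e : (fun t : R => \sum_(i <- [::]) c i * g i t) = fun=> 0.
    by apply/funext => t; rewrite big_nil.
  rewrite e big_nil; split.
    by split; rewrite /comp /=; exact: integrable0.
  by rewrite /Cintegral /= (_ : Rintegral _ _ _ = 0) // /Rintegral integral0.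
have e : (fun t : R => \sum_(j <- i :: r) c j * g j t) =
    fun t => c i * g i t + \sum_(j <- r) c j * g j t.
  by apply/funext => t; rewrite big_cons.
have [h1 h2] := cintegrableZ (c i) (hg i).
have [h3 h4] := cintegrableD h1 IH1.
by rewrite e big_cons; split=> //; rewrite h4 h2 IH2.
Qed.

Lemma cintegrable_real (m : R -> R) : mu.-integrable Rp (EFin \o m) ->
  cintegrable (fun t => rr (m t)) /\
  Cintegral (fun t => rr (m t)) = rr (\int[mu]_(t in Rp) m t).
Proof.
move=> hm; split; first by split; [exact: hm|exact: integrable0].
by rewrite /Cintegral /rr /=; congr mkC; rewrite /Rintegral integral0.
Qed.

(** The factor 2 comes from bounding real and imaginary parts separately. *)
Lemma nm_Cintegral g G : cintegrable g -> mu.-integrable Rp (EFin \o G) ->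
  (forall t, 0 < t -> nm (g t) <= G t) -> nm (Cintegral g) <= 2 * \int[mu]_(t in Rp) G t.
Proof.
move=> [g1 g2] iG hG; have mR : measurable Rp by exact: Rp_measurable.
have bound (f : R -> R) : mu.-integrable Rp (EFin \o f) ->
    (forall t, 0 < t -> `|f t| <= G t) -> `|\int[mu]_(t in Rp) f t| <= \int[mu]_(t in Rp) G t.
  move=> hf hfG; apply: le_trans (@le_normr_Rintegral _ _ R mu Rp _ mR hf) _.
  apply: le_Rintegral => //.
    by have := integrable_abse hf; congr (_.-integrable _ _).
  by move=> t; rewrite /= in_itv /= andbT; exact: hfG.
apply: le_trans (nm_le _) _; rewrite /Cintegral /= mulr_natl mulr2n; apply: lerD.
  by apply: bound => // t t0; apply: le_trans (Re_le_nm _) (hG t t0).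
by apply: bound => // t t0; apply: le_trans (Im_le_nm _) (hG t t0).
Qed.

End ComplexIntegrals.

(** * Convergent q-series as cusp forms, and uniqueness of q-expansions *)

Section Convergence.
Variable R : realType.
Implicit Types (z h : CC R) (a b : nat -> CC R) (F : CC R -> CC R).

Lemma CC_cvgP (u : nat -> CC R) (s : CC R) :
  (forall e : R, 0 < e -> exists N0, forall N, (N0 <= N)%N -> nm (s - u N) < e) <->
  (u @ \oo --> s)%classic.
Proof.
split=> [H|/cvgrPdist_lt H].
  apply/cvgrPdist_lt => eps /rr_gt0[e e0 ->]; have [N0 hN] := H e e0.
  by exists N0 => // N /= /hN; rewrite nmE rr_lt.
move=> e e0; have /H[N0 _ hN] : 0 < rr e by rewrite -[0](rmorph0 (@rr R)) rr_lt.
by exists N0 => N /hN /=; rewrite nmE rr_lt.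
Qed.

Lemma hsum_cvg (f : nat -> CC R) s : f 0%N = 0 -> hsum f s ->
  ((fun N => \sum_(1 <= n < N) f n) @ \oo --> s)%classic.
Proof.
move=> f0 hs; apply/CC_cvgP => e /(hsum_nat hs)[N0 hN].
exists N0.+1 => N lN; have := hN N (ltnW lN); rewrite big_ltn ?f0 ?add0r //.
exact: leq_ltn_trans lN.
Qed.

Lemma CC_lim (u : nat -> CC R) s : (u @ \oo --> s)%classic -> lim (u @ \oo)%classic = s.
Proof. exact: (@cvg_lim (CC R) (@norm_hausdorff _ _)). Qed.

(** The image v satisfies Im(v) |c z + d|^2 = (a d - b c) Im(z). *)
Lemma im_moebius (a b c d : int) z : a * d - b * c = 1 -> 0 < complex.Im z ->
  0 < complex.Im ((a%:~R * z + b%:~R) / (c%:~R * z + d%:~R)).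
Proof.
move=> det z0; set w := c%:~R * z + d%:~R.
have w0 : w != 0.
  apply: cz_d_neq0 => //; apply: contra_eqN det => /eqP[-> ->].
  by rewrite !mulr0 subr0 eq_sym oner_eq0.
set v := _ / w; have e : v * w = a%:~R * z + b%:~R by rewrite /v divfK.
clearbody v.
have eR := congr1 (@complex.Re R) e; have eI := congr1 (@complex.Im R) e.
move: eR eI; rewrite /w !(ReM, ImM, ReD, ImD, Re_int, Im_int) !(mul0r, mulr0, subr0, addr0).
have : 0 < nm w ^+ 2 by rewrite exprn_gt0 // nm_gt0.
rewrite nm_sqr /w !(ReM, ImM, ReD, ImD, Re_int, Im_int) !(mul0r, mulr0, subr0, addr0).
set x := complex.Re z; set y := complex.Im z in z0 *.
set p := complex.Re v; set q := complex.Im v.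
have dt : a%:~R * d%:~R - b%:~R * c%:~R = 1 :> R by rewrite -!rmorphM -rmorphB det.
move: dt; move: (a%:~R : R) (b%:~R : R) (c%:~R : R) (d%:~R : R) => A B C E dt n0 eR eI.
have k : q * ((C * x + E) ^+ 2 + (C * y) ^+ 2) = y.
  transitivity (A * y * (C * x + E) - C * y * (A * x + B)).
    by rewrite -eI -eR; ring.
  by rewrite -[RHS]mul1r -dt; ring.
by rewrite -(pmulr_lgt0 _ n0) k.
Qed.

Lemma derivable_quadratic (f : CC R -> CC R) z (l : CC R) (C d : R) : 0 < d ->
  (forall h, nm h < d -> nm (f (z + h) - f z - l * h) <= C * nm h ^+ 2) -> derivable f z 1.
Proof.
move=> d0 H; rewrite /derivable; apply/cvg_ex; exists l; apply/cvgrPdist_le => eps.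
move=> /rr_gt0[e e0 ->].
pose d1 := Num.min d (e / (`|C| + 1)).
have C1 : 0 < `|C| + 1 by rewrite ltr_wpDl.
have d10 : 0 < d1 by rewrite lt_min d0 divr_gt0.
have rd1 : 0 < rr d1 by rewrite -[0](rmorph0 (@rr R)) rr_lt.
rewrite /dnbhs; exists (rr d1) => //= h.
rewrite /ball_ /= sub0r normrN nmE rr_lt lt_min => /andP[hd he] h0.
rewrite nmE rr_le.
have nh0 : 0 < nm h by rewrite nm_gt0.
have -> : l - h^-1 *: (f (h *: 1 + z) - f z) = - (h^-1 * (f (z + h) - f z - l * h)).
  rewrite /GRing.scale /= mulr1 [h + z]addrC.
  by rewrite [h^-1 * (_ - l * h)]mulrBr [h^-1 * (l * h)]mulrCA mulVf // mulr1 opprB.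
rewrite nmN nmM nmV; apply: (@le_trans _ _ ((nm h)^-1 * (C * nm h ^+ 2))).
  by apply: ler_wpM2l; [rewrite invr_ge0 nm_ge0|exact: H].
rewrite mulrCA expr2 mulKf ?gt_eqF //.
move: he; rewrite ltr_pdivlMr // => he; have := ler_norm C; nra.
Qed.

Lemma natsq_geom_bound (s : R) : 0 <= s -> s < 1 -> exists2 B : R, 0 <= B &
  forall n : nat, n%:R ^+ 2 * s ^+ n <= B.
Proof.
move=> s0 s1; have [|M hM] := @absb_natX R 2 (rr s).
  by rewrite nm_rr ger0_norm.
exists M; first exact: absb_ge0 hM.
move=> n; have := hM [:: n] isT; rewrite big_seq1 nm_mulX // nmX nm_nat //.
Qed.

(** Termwise differentiation: the second-order errors of the terms sum to O(|h|^2). *)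
Lemma mform_derivable k F a z : mform k F a -> 0 < complex.Im z ->
  derivable (fun w : CC R => if 0 < complex.Im w then F w else 0) z 1.
Proof.
case=> ga sa _ y0; set y := complex.Im z in y0 *; have p0 := @pi_gt0 R.
(* Here |q(z)| = s^4. A step |h| < y/4 costs at most s^(-n) in the n-th term; of the remaining s^(3
   n), one s^n absorbs n^2 and s^(2 n) stays inside the disc of convergence. *)
pose s : R := expR (- (pi * y / 2)).
have s0 : 0 < s by exact: expR_gt0.
have s1 : s < 1 by rewrite expR_lt1 oppr_lt0 divr_gt0 // mulr_gt0.
have [B B0 hB] := natsq_geom_bound (ltW s0) s1.
have [|M hM] := ga (rr (s ^+ 2)).
  by rewrite nm_rr ger0_norm ?exprn_ge0 ?exprn_ilt1 // ltW.
pose Q n : CC R := a n * nome z ^+ n.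
have nQ n : nm (nome z ^+ n) = s ^+ (4 * n).
  rewrite nmX nm_nome exprM; congr (_ ^+ _); rewrite -expRM_natl; congr expR.
  by rewrite -/y; lra.
have M0 := absb_ge0 hM.
have hT (t : nat -> CC R) (T : R) : 0 <= T ->
   (forall n, nm (t n) <= T * (n%:R ^+ 2 * (nm (a n) * s ^+ (3 * n)))) ->
   absb t (T * (B * M)).
  move=> T0 ht Bs uB.
  apply: (@le_trans _ _ (\sum_(n <- Bs) T * (B * nm (a n * rr (s ^+ 2) ^+ n)))).
    apply: ler_sum => n _; apply: le_trans (ht n) _; apply: ler_wpM2l => //.
    rewrite nm_mulX ?exprn_ge0 ?(ltW s0) // -exprM mulrCA [leRHS]mulrCA.
    apply: ler_wpM2l; first exact: nm_ge0.
    rewrite mulSn exprD mulrA; apply: ler_wpM2r; [by apply: exprn_ge0; exact: ltW|exact: hB].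
  rewrite -mulr_sumr -mulr_sumr; apply: ler_wpM2l => //; apply: ler_wpM2l => //; exact: hM.
have [l hl] : exists l, hsum (fun n => Q n * (n%:R * tpi R)) l.
  apply: (@hsum_ex _ _ _ (2 * pi * (B * M))); apply: hT => [|n]; first by rewrite mulr_ge0 // ltW.
  rewrite /Q !nmM nQ nm_nat nmtpi.
  have e1 : s ^+ (4 * n) <= s ^+ (3 * n) by apply: ler_wiXn2l; rewrite ?ltW //; lia.
  have e2 : (n%:R : R) <= n%:R ^+ 2 by rewrite -natrX ler_nat expnS expn1;
    case: (posnP n) => [-> //|n0]; exact: leq_pmulr.
  have a0 := nm_ge0 (a n); have q0 : 0 <= s ^+ (4 * n) by apply: exprn_ge0; exact: ltW.
  have n0 : 0 <= n%:R :> R by [].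
  have -> : nm (a n) * s ^+ (4 * n) * (n%:R * (2 * pi)) =
    2 * pi * (n%:R * (nm (a n) * s ^+ (4 * n))) by ring.
  apply: ler_wpM2l; first by rewrite mulr_ge0 // ltW.
  apply: ler_pM => //; first by rewrite mulr_ge0.
  exact: ler_wpM2l.
pose d := y / 4; have d0 : 0 < d by rewrite divr_gt0.
apply: (@derivable_quadratic _ z l (5 * (2 * pi) ^+ 2 * (B * M)) d d0) => h hd.
have zh : 0 < complex.Im (z + h).
  rewrite ImD -/y; have := Im_le_nm h; rewrite ler_norml => /andP[h1 _].
  by move: hd; rewrite /d; lra.
rewrite zh y0.
have hs := hsumB (hsumB (sa _ zh) (sa _ y0)) (hsumZ h hl).
rewrite [h * l]mulrC in hs; apply: hsum_le hs _.
have -> : 5 * (2 * pi) ^+ 2 * (B * M) * nm h ^+ 2 = 5 * (2 * pi) ^+ 2 * nm h ^+ 2 * (B * M) by ring.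
apply: hT => [|n].
  by apply: mulr_ge0; [apply: mulr_ge0 => //|]; exact: sqr_ge0.
have -> : a n * nome (z + h) ^+ n - a n * nome z ^+ n - h * (Q n * (n%:R * tpi R)) =
   Q n * (cexp (tpi R * (n%:R * h)) - 1 - tpi R * (n%:R * h)).
  rewrite /Q -[cexp _]/(nome (n%:R * h)) nome_natM nomeD exprMn; ring.
rewrite /Q nmM [nm (a n * _)]nmM nQ.
have := cexp_sub1Dx (tpi R * (n%:R * h)).
have -> : nm (tpi R * (n%:R * h)) = 2 * pi * (n%:R * nm h) by rewrite !nmM nmtpi nm_nat.
set E := expR _; set X := nm (_ - _ - _) => hX.
have hE : s ^+ (4 * n) * E <= s ^+ (3 * n).
  rewrite /E /s -!expRM_natl -expRD ler_expR !natrM.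
  have : n%:R * nm h <= n%:R * (y / 4) by apply: ler_wpM2l => //; exact: ltW.
  nra.
have a0 := nm_ge0 (a n); have q0 : 0 <= s ^+ (4 * n) by apply: exprn_ge0; exact: ltW.
apply: (@le_trans _ _ (nm (a n) * s ^+ (4 * n) * (5 * (2 * pi * (n%:R * nm h)) ^+ 2 * E))).
  by apply: ler_wpM2l hX; rewrite mulr_ge0.
have -> : nm (a n) * s ^+ (4 * n) * (5 * (2 * pi * (n%:R * nm h)) ^+ 2 * E) =
  5 * (2 * pi) ^+ 2 * nm h ^+ 2 * n%:R ^+ 2 * nm (a n) * (s ^+ (4 * n) * E) by ring.
have -> : 5 * (2 * pi) ^+ 2 * nm h ^+ 2 * (n%:R ^+ 2 * (nm (a n) * s ^+ (3 * n))) =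
  5 * (2 * pi) ^+ 2 * nm h ^+ 2 * n%:R ^+ 2 * nm (a n) * s ^+ (3 * n) by ring.
apply: ler_wpM2l hE; apply: mulr_ge0 => //; apply: mulr_ge0; last exact: sqr_ge0.
by apply: mulr_ge0; [apply: mulr_ge0 => //|]; exact: sqr_ge0.
Qed.

Definition ext0 F (z : CC R) : CC R := if 0 < complex.Im z then F z else 0.

Lemma ext0_qexp k F a : mform k F a -> a 0%N = 0 -> is_qexpansion (ext0 F) a.
Proof.
case=> _ sa _ a0; split=> // z; rewrite /upper_half_plane /= => z0.
rewrite /ext0 z0; apply: hsum_cvg (sa z z0); by rewrite a0 mul0r.
Qed.

Lemma ext0_cusp k F a : mform k F a -> a 0%N = 0 -> is_cusp_form k (ext0 F).
Proof.
move=> f a0; split.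
- by move=> z /negP z0; rewrite /ext0 (negbTE z0).
- by move=> z z0; exact: mform_derivable f z0.
- move=> u v c d det z z0; rewrite /ext0 (im_moebius det z0).
  have z0' : 0 < complex.Im z by exact: z0.
  by rewrite z0'; exact: (mform_mod f).
- by exists a; exact: ext0_qexp f a0.
Qed.

Lemma cvg_terms_bound (c : nat -> CC R) (s : CC R) :
  ((fun N => \sum_(1 <= n < N) c n) @ \oo --> s)%classic -> c 0%N = 0 ->
  exists2 B : R, 0 <= B & forall n, nm (c n) <= B.
Proof.
move=> /CC_cvgP/(_ 1 ltr01)[N0 hN] c0.
exists (2 + \sum_(0 <= n < N0.+1) nm (c n)).
  by rewrite addr_ge0 // sumr_ge0 // => n _; exact: nm_ge0.
move=> n; have [nN|Nn] := leqP n N0.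
  rewrite (@bigD1_seq _ _ _ _ _ n) ?mem_index_iota ?iota_uniq //=.
  have : 0 <= \sum_(0 <= i < N0.+1 | i != n) nm (c i) by apply: sumr_ge0 => i _; exact: nm_ge0.
  have := nm_ge0 (c n); lra.
have S0 : 0 <= \sum_(0 <= n < N0.+1) nm (c n) by apply: sumr_ge0 => i _; exact: nm_ge0.
have n1 : (1 <= n)%N by apply: leq_ltn_trans Nn.
have h1 := hN n.+1 (leqW (ltnW Nn)); have h2 := hN n (ltnW Nn).
rewrite big_nat_recr //= in h1; move: h1 h2; move: (\sum_(1 <= i < n) c i) (c n) => T w h1 h2.
have -> : w = (s - T) - (s - (T + w)) by ring.
have := nmDB (s - T) (s - (T + w)); lra.
Qed.

(** On the imaginary axis q runs over all reals in (0, 1). The expansions converge only as ordered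
    series, so the bound |c_n| <= B 2^n is first extracted from convergence at q = 1/2; then the
    lowest coefficient is isolated as q tends to 0. *)
Lemma qexp_unique (f : CC R -> CC R) a b : is_qexpansion f a -> is_qexpansion f b -> a = b.
Proof.
case=> a0 ha [b0 hb]; pose c n := a n - b n.
have c0 : c 0%N = 0 by rewrite /c a0 b0 subrr.
have hc (x : R) : 0 < x -> x < 1 ->
    ((fun N => \sum_(1 <= n < N) c n * rr x ^+ n) @ \oo --> (0 : CC R))%classic.
  move=> x0 x1; pose z := mkC 0 (- ln x / (2 * pi)) : CC R.
  have p0 : 0 < 2 * pi :> R by rewrite mulr_gt0 // pi_gt0.
  have z0 : upper_half_plane z.
    by rewrite /upper_half_plane /= divr_gt0 // oppr_gt0 ln_lt0 // x0.
  have qz : nome z = rr x.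
    rewrite /z nome_imag; congr rr; rewrite mulrC divfK ?gt_eqF // opprK lnK //.
  have h := cvgB (ha z z0) (hb z z0); rewrite subrr qz in h.
  have -> : (fun N => \sum_(1 <= n < N) c n * rr x ^+ n) = (fun N : nat =>
      \sum_(1 <= n < N) a n * rr x ^+ n - \sum_(1 <= n < N) b n * rr x ^+ n).
    by apply/funext => N; rewrite -sumrB; apply: eq_bigr => n _; rewrite mulrBl.
  exact: h.
have h2 : (2^-1 : R) < 1 by lra.
have h0 : 0 < (2^-1 : R) by rewrite invr_gt0.
have c00 : c 0%N * rr 2^-1 ^+ 0 = 0 by rewrite c0 mul0r.
have [B B0 hB] := cvg_terms_bound (hc 2^-1 h0 h2) c00.
have hcB n : nm (c n) <= B * 2 ^+ n.
  have := hB n; rewrite nm_mulX ?invr_ge0 // exprVn ler_pdivrMr ?exprn_gt0 //.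
suff cz n : c n = 0.
  by apply/funext => n; apply/eqP; rewrite -subr_eq0; apply/eqP; exact: cz.
elim/ltn_ind: n => -[//|m'] IH; set m := m'.+1 in IH *.
apply/eqP; rewrite -nm_eq0 eq_le nm_ge0 andbT; apply/ler_addgt0Pr => e e0; rewrite add0r.
(* For x <= 1/4 the terms beyond m are bounded by a geometric series of ratio at most 1/2, hence by
   2 B (2 x)^(m+1) = T x x^m. *)
pose T : R := 2 * B * 2 ^+ m.+1.
have T0 : 0 <= T by apply: mulr_ge0; [exact: mulr_ge0|exact: exprn_ge0].
pose x : R := Num.min 4^-1 (e / (T + 1)).
have T1 : 0 < T + 1 by lra.
have x0 : 0 < x.
  by rewrite /x lt_min; apply/andP; split; [rewrite invr_gt0; lra|exact: divr_gt0].
have x4 : x <= 4^-1 by rewrite ge_min lexx.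
have xe : T * x <= e.
  have : x <= e / (T + 1) by rewrite ge_min lexx orbT.
  rewrite ler_pdivlMr //; nra.
apply: le_trans xe; rewrite -(@ler_pM2r _ (x ^+ m)) ?exprn_gt0 //.
apply/ler_addgt0Pr => d d0.
have x1 : x < 1 by lra.
have [N0 hN] := (CC_cvgP _ _).2 (hc x x0 x1) d d0.
have := hN (maxn N0 m.+1) (leq_maxl _ _); set N := maxn _ _.
have mN : (m < N)%N by rewrite /N leq_max leqnn orbT.
rewrite sub0r nmN (@big_cat_nat _ _ _ m) //=; last exact: ltnW.
rewrite big_nat big1 ?add0r => [|i /andP[_ im]]; last by rewrite IH // mul0r.
rewrite big_ltn // => h3.
have h4 : nm (\sum_(m.+1 <= i < N) c i * rr x ^+ i) <= T * x * x ^+ m.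
  apply: le_trans (nm_sum _ _ _) _.
  apply: (@le_trans _ _ (\sum_(m.+1 <= i < N) B * (2 * x) ^+ i)).
    apply: ler_sum => i _; rewrite (nm_mulX _ _ (ltW x0)) exprMn [leRHS]mulrA.
    apply: (@ler_wpM2r _ (x ^+ i)); last exact: hcB.
    by apply: exprn_ge0; exact: ltW.
  rewrite -mulr_sumr.
  have -> : T * x * x ^+ m = B * (2 * (2 * x) ^+ m.+1) by rewrite /T exprMn [x ^+ m.+1]exprS; ring.
  apply: ler_wpM2l => //.
  have y0 : 0 <= 2 * x by lra.
  have y2 : 2 * x <= 2^-1 by lra.
  have geo p q : (p <= q)%N -> \sum_(p <= i < q) (2 * x) ^+ i <= 2 * (2 * x) ^+ p - 2 * (2 * x) ^+ q.
    elim: q => [|q IHq]; first by rewrite leqn0 => /eqP ->; rewrite big_geq // subrr.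
    rewrite leq_eqVlt => /orP[/eqP ->|]; first by rewrite big_geq // subrr.
    rewrite ltnS => pq; rewrite big_nat_recr //=; have := IHq pq.
    have : (2 * x) ^+ q.+1 <= 2^-1 * (2 * x) ^+ q.
      by rewrite exprS; apply: ler_wpM2r => //; exact: exprn_ge0.
    lra.
  have := geo m.+1 N mN; have : 0 <= (2 * x) ^+ N by exact: exprn_ge0.
  lra.
have e1 : nm (c m * rr x ^+ m) = nm (c m) * x ^+ m by rewrite nm_mulX // ltW.
have := nm_lbD (c m * rr x ^+ m) (\sum_(m.+1 <= i < N) c i * rr x ^+ i).
rewrite e1; lra.
Qed.

Lemma qcoef_eq (f : CC R -> CC R) a : is_qexpansion f a -> qcoef f = a.
Proof.
move=> ha; have hg : is_qexpansion f (qcoef f) := @xgetPex _ point _ (ex_intro _ a ha).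
exact: qexp_unique hg ha.
Qed.

End Convergence.

(** * Asymptotics of the twisted periods *)

Section Estimate.
Variable R : realType.
Local Notation mu := (@lebesgue_measure R).
Local Notation Rp := (`]0, +oo[%classic : set R).

Definition has_int (f : R -> R) (v : R) :=
  mu.-integrable Rp (EFin \o f) /\ (\int[mu]_(t in Rp) f t)%R = v.

Lemma has_intD f g v w : has_int f v -> has_int g w -> has_int (fun t => f t + g t) (v + w).
Proof.
move=> [f1 <-] [g1 <-]; have mR : measurable Rp by exact: Rp_measurable.
split; last by rewrite (@RintegralD _ _ R mu Rp _ _ mR f1 g1).
by have := @integrableD _ _ R mu Rp mR _ _ f1 g1; congr (_.-integrable _ _).
Qed.

Lemma has_intZ c f v : has_int f v -> has_int (fun t => c * f t) (c * v).
Proof.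
move=> [f1 <-]; have mR : measurable Rp by exact: Rp_measurable.
split; last by rewrite (@RintegralZl _ _ R mu Rp _ _ mR).
by have := @integrableZl _ _ R mu Rp mR c _ f1; congr (_.-integrable _ _).
Qed.

Variables (D K L l m N : nat).
Hypotheses (D0 : (0 < D)%N) (eK : K = (L + l + 2)%N) (m0 : (0 < m)%N) (mN : (m < N)%N).
Variables (F : CC R -> CC R) (a : nat -> CC R) (Bd C : R).
Local Notation r := (expR (- (pi / D%:R)) : R).
Hypotheses (hF : mform K F a) (va : vanish a m) (am : a m = 1).
Hypotheses (nr : radius_bound r a Bd) (nK : radius_bound K%:R^-1 a C).
Variable s : nat -> nat.
Hypothesis hs : forall j, coprime j D -> (s j < D)%N /\ (D %| j * s j + 1)%N.
Variable Cc : nat -> CC R.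
Hypothesis Cc0 : forall j, ~~ coprime j D -> Cc j = 0.

Local Notation zeta := (zeta R D).
Let dD : R := D%:R.
Let DR : 0 < dD. Proof. by rewrite ltr0n. Qed.
Let K0 : (0 < K)%N. Proof. by rewrite eK addn2. Qed.

(** The weights are free on residues prime to D: [tau] gives one twist, and a combination of several
    [tau] gives a linear relation between twists. *)
Definition shift_sum (t : R) : CC R := \sum_(j < D) Cc j * F (mkC 0 t + j%:R / D%:R).
Definition weight_norm : R := \sum_(j < D) nm (Cc j).
(** The coefficient with which q^m reappears near 0, after each translate j/D has been moved to
    s_j/D. *)
Definition dual_coef : CC R := \sum_(j < D | coprime j D) Cc j * zeta ^+ (m * s j).
Definition low_const : R := C * K%:R ^+ N.
Definition high_const : R := Bd / r ^+ N.
(** A majorant for the terms of F beyond q^m at height y: those before index N are bounded through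
    radius 1/K, the others through radius r. *)
Definition tail_bound (y : R) : R :=
  low_const * expR (- (2 * pi * y)) ^+ m.+1 + high_const * expR (- (2 * pi * y)) ^+ N.

Lemma low_const_ge0 : 0 <= low_const.
Proof. by apply: mulr_ge0; [exact: absb_ge0 nK|exact: exprn_ge0]. Qed.
Lemma high_const_ge0 : 0 <= high_const.
Proof. by apply: divr_ge0; [exact: absb_ge0 nr|apply: exprn_ge0; exact: expR_ge0]. Qed.
Lemma weight_norm_ge0 : 0 <= weight_norm.
Proof. by apply: sumr_ge0 => j _; exact: nm_ge0. Qed.
(** Below N, q^n <= q^(m+1) and k^n <= k^N; from N on, (q/r')^n <= (q/r')^N. Adding both bounds
    avoids splitting the sum. *)
Lemma term_bound (x k q r' : R) n : 0 <= x -> 1 <= k -> 0 < q -> q <= 1 -> 0 < r' ->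
  q / r' <= 1 -> (m < n)%N ->
  x * q ^+ n <= k ^+ N * q ^+ m.+1 * (x * k^-1 ^+ n) + (q / r') ^+ N * (x * r' ^+ n).
Proof.
move=> x0 k1 q0 q1 r0 qr mn; have k0 : 0 < k by apply: lt_le_trans k1.
have p1 : 0 <= k ^+ N * q ^+ m.+1 * (x * k^-1 ^+ n).
  apply: mulr_ge0; apply: mulr_ge0 => //; apply: exprn_ge0; rewrite ?invr_ge0; exact: ltW.
have p2 : 0 <= (q / r') ^+ N * (x * r' ^+ n).
  apply: mulr_ge0; last by apply: mulr_ge0 => //; apply: exprn_ge0; exact: ltW.
  by apply: exprn_ge0; apply: divr_ge0; exact: ltW.
have [Nn|nN] := leqP N n.
  apply: (@le_trans _ _ ((q / r') ^+ N * (x * r' ^+ n))); last by rewrite lerDr.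
  rewrite mulrCA; apply: ler_wpM2l => //.
  have -> : q ^+ n = (q / r') ^+ n * r' ^+ n by rewrite -exprMn divfK // gt_eqF.
  apply: ler_wpM2r; first by apply: exprn_ge0; exact: ltW.
  by apply: ler_wiXn2l => //; apply: divr_ge0; exact: ltW.
apply: (@le_trans _ _ (k ^+ N * q ^+ m.+1 * (x * k^-1 ^+ n))); last by rewrite lerDl.
rewrite mulrCA; apply: ler_wpM2l => //.
apply: (@le_trans _ _ (q ^+ m.+1)); first by apply: ler_wiXn2l => //; exact: ltW.
rewrite mulrAC; apply: ler_peMl; first by apply: exprn_ge0; exact: ltW.
rewrite exprVn -(subnK (ltnW nN)) exprD mulfK ?expf_neq0 ?gt_eqF //.
exact: exprn_ege1.
Qed.

Lemma sum_bound (x g1 g2 h : nat -> R) (B : seq nat) (k q r' C' Bd' : R) :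
  \sum_(n <- B) g2 n <= Bd' -> \sum_(n <- B) g1 n <= C' ->
  1 <= k -> 0 < q -> q <= 1 -> 0 < r' -> q / r' <= 1 -> (forall n, 0 <= x n) ->
  (forall n, g1 n = x n * k^-1 ^+ n) -> (forall n, g2 n = x n * r' ^+ n) ->
  (forall n, (n <= m)%N -> h n = 0) -> (forall n, (m < n)%N -> h n = x n * q ^+ n) ->
  \sum_(n <- B) h n <= C' * k ^+ N * q ^+ m.+1 + Bd' / r' ^+ N * q ^+ N.
Proof.
move=> s2 s1 k1 q0 q1 r0 qr x0 e1 e2 h0 h1; have k0 : 0 < k by apply: lt_le_trans k1.
have c1 : 0 <= k ^+ N * q ^+ m.+1 by apply: mulr_ge0; apply: exprn_ge0; exact: ltW.
have c2 : 0 <= (q / r') ^+ N by apply: exprn_ge0; apply: divr_ge0; exact: ltW.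
have -> : C' * k ^+ N * q ^+ m.+1 + Bd' / r' ^+ N * q ^+ N =
   k ^+ N * q ^+ m.+1 * C' + (q / r') ^+ N * Bd'.
  by rewrite expr_div_n; ring.
apply: le_trans (lerD (ler_wpM2l c1 s1) (ler_wpM2l c2 s2)).
rewrite !mulr_sumr -big_split /=; apply: ler_sum => n _; rewrite e1 e2.
have [nm_|mn] := leqP n m; last by rewrite h1 //; exact: term_bound.
rewrite h0 //; apply: addr_ge0; apply: mulr_ge0 => //; apply: mulr_ge0 => //;
  apply: exprn_ge0; rewrite ?invr_ge0; exact: ltW.
Qed.

Lemma rest_bound z : dD^-1 <= complex.Im z -> nm (F z - nome z ^+ m) <= tail_bound (complex.Im z).
Proof.
move=> hy; have y0 : 0 < complex.Im z by apply: lt_le_trans hy; rewrite invr_gt0.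
have KR : 0 < K%:R :> R by rewrite ltr0n.
have K1 : 1 <= K%:R :> R by rewrite ler1n.
set Q := expR (- (2 * pi * complex.Im z)); have Q0 : 0 < Q by exact: expR_gt0.
have nq : nm (nome z) = Q by exact: nm_nome.
have Q1 : Q <= 1 by rewrite -nq ltW // nm_nome_lt1.
have r0 : 0 < r by exact: expR_gt0.
(* Height at least 1/D gives |q| <= exp(-2 pi/D) <= r, which is why the radius r was chosen. *)
have Qr : Q / r <= 1.
  rewrite ler_pdivrMr // mul1r ler_expR; have := @pi_gt0 R => p0.
  have : pi / dD <= 2 * pi * complex.Im z by rewrite -/dD in hy *; nra.
  by rewrite /dD; lra.
have Qr0 : 0 <= Q / r by rewrite divr_ge0 // ltW.
have hm : hsum (fun n => if n == m then nome z ^+ m else 0) (nome z ^+ m).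
  have := @hsum_supp R nat (fun n => if n == m then nome z ^+ m else 0) [:: m] isT.
  by rewrite big_seq1 eqxx; apply=> n; rewrite inE => /negbTE ->.
apply: hsum_le (hsumB (mform_sum hF y0) hm) _ => B uB.
have i0 : 0 <= K%:R^-1 :> R by rewrite invr_ge0 ltW.
have e4 n : (n <= m)%N -> nm (a n * nome z ^+ n - (if n == m then nome z ^+ m else 0)) = 0.
  move=> nm_; rewrite -[RHS](nm0 R); congr nm.
  case: eqP => [->|/eqP ne]; first by rewrite am mul1r subrr.
  by rewrite va ?mul0r ?subr0 // ltn_neqAle ne.
have e3 n : (m < n)%N ->
    nm (a n * nome z ^+ n - (if n == m then nome z ^+ m else 0)) = nm (a n) * Q ^+ n.
  by move=> mn; rewrite (gtn_eqF mn) subr0 nmM nmX nq.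
exact: (sum_bound (nr uB) (nK uB) K1 Q0 Q1 r0 Qr (fun n => nm_ge0 (a n))
  (fun n => nm_mulX (a n) n i0) (fun n => nm_mulX (a n) n (ltW r0)) e4 e3).
Qed.

Lemma im_shift (t : R) (j : nat) : complex.Im (mkC 0 t + j%:R / D%:R) = t.
Proof.
rewrite -!(rmorph_nat (@rr R)) -fmorphV -rmorphM ImD /=; exact: addr0.
Qed.

Lemma nome_shift (t : R) (j : nat) : nome (mkC 0 t + j%:R / D%:R) ^+ m =
  rr (expR (- (2 * pi * t)) ^+ m) * zeta ^+ (m * j).
Proof.
by rewrite nomeD exprMn nome_imag rmorphXn /= nome_natM -exprM mulnC.
Qed.

Lemma shift_sum_large t : dD^-1 <= t -> nm (shift_sum t) <=
  weight_norm * (expR (- (2 * pi * t)) ^+ m + tail_bound t).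
Proof.
move=> ht; apply: le_trans (nm_sum _ _ _) _; rewrite /weight_norm mulr_suml.
apply: ler_sum => j _; rewrite nmM; apply: ler_wpM2l; first exact: nm_ge0.
set z := mkC 0 t + _; have iz : complex.Im z = t by exact: im_shift.
have := rest_bound (z := z); rewrite iz => /(_ ht) h.
have e : nm (nome z ^+ m) = expR (- (2 * pi * t)) ^+ m by rewrite nmX nm_nome iz.
have -> : F z = nome z ^+ m + (F z - nome z ^+ m) by rewrite addrC subrK.
by apply: le_trans (nmD _ _) _; rewrite e lerD2l.
Qed.

(** The unimodular part of (D z - j)^(-K) at z = i t + j/D, where D z - j = i D t. *)
Definition automorphy : CC R := mkC 0 1 ^- K.
Lemma nm_automorphy : nm automorphy = 1. Proof. by rewrite /automorphy nmV nmX nm_i expr1n invr1. Qed.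

(** The matrix has rows (s_j, -q) and (D, -j), with determinant 1 because j s_j + 1 = q D; it sends
    the cusp j/D to infinity. *)
Lemma F_transform (t : R) (j : nat) : 0 < t -> coprime j D ->
  F (mkC 0 t + j%:R / D%:R) =
  automorphy * rr ((dD * t)^-1 ^+ K) * F (mkC 0 (dD ^- 2 * t^-1) + (s j)%:R / D%:R).
Proof.
move=> t0 cj; have [_ /dvdnP[q eq]] := hs cj.
have DC : (D%:R : CC R) != 0 by rewrite pnatr_eq0 -lt0n.
have det : (s j)%:Z * (- j%:Z) - (- q%:Z) * D%:Z = 1.
  have : (j * s j + 1)%N%:Z = (q * D)%N%:Z by rewrite eq.
  by rewrite !PoszM PoszD PoszM => e; lia.
set z := mkC 0 t + _.
have z0 : 0 < complex.Im z by rewrite im_shift.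
have := mform_mod hF det z0.
have w_eq : (D%:Z)%:~R * z + (- j%:Z)%:~R = mkC 0 1 * rr (dD * t).
  rewrite /z mulrDr [_ * (j%:R / _)]mulrCA mulfV // mulr1 rmorphN /= addrK.
  have -> : (D%:Z)%:~R = rr dD :> CC R by rewrite /dD rmorph_nat.
  by apply: CC_eq; rewrite ?ReM ?ImM /=; ring.
have i0 : mkC 0 1 != 0 :> CC R by rewrite -nm_eq0 nm_i oner_eq0.
have dt0 : rr (dD * t) != 0 by rewrite rr_eq0 mulf_neq0 ?gt_eqF.
rewrite w_eq.
have -> : ((s j)%:Z%:~R * z + (- q%:Z)%:~R) / (mkC 0 1 * rr (dD * t)) =
    mkC 0 (dD ^- 2 * t^-1) + (s j)%:R / D%:R.
  apply: (mulIf (mulf_neq0 i0 dt0)); rewrite divfK ?mulf_neq0 //.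
  have eqR : dD * q%:R = j%:R * (s j)%:R + 1 :> R.
    by rewrite /dD -!natrM [(D * q)%N]mulnC -eq natrD.
  have dn : dD != 0 by rewrite gt_eqF.
  have tn : t != 0 by rewrite gt_eqF.
  rewrite /z -!(rmorph_nat (@rr R)) -!fmorphV -!rmorphM.
  have eq' : q%:R = (j%:R * (s j)%:R + 1) / dD :> R by rewrite -eqR mulrAC mulfV ?mul1r.
  have -> : (s j)%:Z%:~R = rr (s j)%:R :> CC R by rewrite rmorph_nat.
  have -> : (- q%:Z)%:~R = rr (- q%:R) :> CC R by rewrite rmorphN /= rmorphN rmorph_nat.
  apply: CC_eq; rewrite !(ReD, ImD, ReM, ImM) /= ?eq' -/dD; field; rewrite ?dn ?tn //.
move=> ->; rewrite /automorphy exprMn -rmorphXn exprVn fmorphV !mulrA.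
have p1 : mkC 0 1 ^+ K != 0 :> CC R by rewrite expf_neq0.
have p2 : rr ((dD * t) ^+ K) != 0 by rewrite rmorphXn expf_neq0.
set X := mkC 0 1 ^+ K in p1 *; set Y := rr _ in p2 *.
by rewrite -[LHS]mul1r; congr (_ * _); rewrite -[X^-1 * _ * _]mulrA mulrAC -!mulrA mulVKf // mulVf.
Qed.

(* On [0 < t <= 1/D] each translate [i t + j/D] is moved by an element of SL_2(Z)
   to [i/(D^2 t) + s_j/D], where [Im >= 1/D] and [F] is dominated by [q^m]. *)
Lemma shift_sum_small t : 0 < t -> t <= dD^-1 ->
  nm (shift_sum t - automorphy * dual_coef * rr ((dD * t)^-1 ^+ K * expR (- (2 * pi * (dD ^- 2 *
    t^-1))) ^+ m)) <=
  weight_norm * ((dD * t)^-1 ^+ K * tail_bound (dD ^- 2 * t^-1)).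
Proof.
move=> t0 ht; set u := dD ^- 2 * t^-1; set P := (dD * t)^-1 ^+ K.
have P0 : 0 <= P by apply: exprn_ge0; rewrite invr_ge0 ltW // mulr_gt0.
have hu : dD^-1 <= u.
  rewrite /u expr2 invfM -mulrA; apply: ler_peMr; first by rewrite invr_ge0 ltW.
  by rewrite mulrC ler_pdivlMr // mul1r -[leLHS]invrK lef_pV2 ?posrE ?invr_gt0 // invrK.
have -> : shift_sum t - automorphy * dual_coef * rr (P * expR (- (2 * pi * u)) ^+ m) =
  \sum_(j < D) Cc j * (automorphy * rr P * (F (mkC 0 u + (s j)%:R / D%:R) -
     nome (mkC 0 u + (s j)%:R / D%:R) ^+ m)).
  have -> : automorphy * dual_coef * rr (P * expR (- (2 * pi * u)) ^+ m) =
     \sum_(j < D) Cc j * (automorphy * rr P * nome (mkC 0 u + (s j)%:R / D%:R) ^+ m).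
    rewrite /dual_coef big_mkcond mulr_sumr mulr_suml; apply: eq_bigr => j _.
    case: ifP => [cj|/negbT/Cc0 ->]; last by rewrite mulr0 !mul0r.
    by rewrite nome_shift rmorphM; ring.
  rewrite /shift_sum -sumrB; apply: eq_bigr => j _.
  have [cj|/Cc0 ->] := boolP (coprime j D); last by rewrite !mul0r subrr.
  by rewrite (F_transform t0 cj) -/u -/P -mulrBr -mulrBr.
apply: le_trans (nm_sum _ _ _) _; rewrite /weight_norm mulr_suml.
apply: ler_sum => j _; rewrite nmM; apply: ler_wpM2l; first exact: nm_ge0.
have -> : nm (automorphy * rr P * (F (mkC 0 u + (s j)%:R / D%:R) - nome (mkC 0 u + (s j)%:R / D%:R) ^+ m)) =
   P * nm (F (mkC 0 u + (s j)%:R / D%:R) - nome (mkC 0 u + (s j)%:R / D%:R) ^+ m).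
  by rewrite nmM [nm (automorphy * _)]nmM nm_automorphy mul1r nm_rr (ger0_norm P0).
apply: ler_wpM2l => //.
by have := rest_bound (z := mkC 0 u + (s j)%:R / D%:R); rewrite im_shift => /(_ hu).
Qed.

(** The constant factor in (D t)^(-K) t^l = D^(-K) t^(-(L+2)). *)
Definition dilation : R := dD^-1 ^+ K.
Definition inv_rate (M : nat) : R := 2 * pi * M%:R / dD ^+ 2.
(** The contribution of q^M near 0, after the modular substitution; [pow_fun] is its contribution
    near i oo, and [inv_int], [pow_int] are the two integrals. *)
Definition inv_fun M (t : R) : R := (t^-1) ^+ L.+2 * expR (- (inv_rate M * t^-1)).
Definition pow_fun M (t : R) : R := t ^+ l * expR (- (2 * pi * M%:R * t)).
Definition inv_int M : R := L`!%:R / inv_rate M ^+ L.+1.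
Definition pow_int M : R := l`!%:R / (2 * pi * M%:R) ^+ l.+1.
(** All errors of both ranges, every one extended to the whole half-line by positivity. The last
    summand bounds the main term on t > 1/D, where it does not approximate the integrand. *)
Definition majorant (t : R) : R := weight_norm * (low_const * (dilation * inv_fun m.+1 t + pow_fun m.+1 t) +
   high_const * (dilation * inv_fun N t + pow_fun N t) + pow_fun m t +
   expR (2 * pi / dD) * (dilation * inv_fun m.+1 t)).
Definition majorant_int : R := weight_norm * (low_const * (dilation * inv_int m.+1 + pow_int m.+1) +
   high_const * (dilation * inv_int N + pow_int N) + pow_int m + expR (2 * pi / dD) * (dilation *
     inv_int m.+1)).

Lemma inv_rate_gt0 M : (0 < M)%N -> 0 < inv_rate M.
Proof.
by move=> M0; rewrite divr_gt0 ?exprn_gt0 // mulr_gt0 ?ltr0n // mulr_gt0 // pi_gt0.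
Qed.

Lemma has_int_inv M : (0 < M)%N -> has_int (inv_fun M) (inv_int M).
Proof. by move=> M0; exact: (integral_invexp L (inv_rate_gt0 M0)). Qed.

Lemma has_int_pow M : (0 < M)%N -> has_int (pow_fun M) (pow_int M).
Proof.
move=> M0; apply: integral_powexp; by rewrite mulr_gt0 ?ltr0n // mulr_gt0 // pi_gt0.
Qed.

Lemma has_int_G : has_int majorant majorant_int.
Proof.
have N0 : (0 < N)%N by exact: leq_trans mN.
have i M : (0 < M)%N -> has_int (fun t => dilation * inv_fun M t) (dilation * inv_int M).
  by move=> M0; apply: has_intZ; exact: has_int_inv.
apply: has_intZ; apply: has_intD; last by apply: has_intZ; exact: i.
apply: has_intD; last exact: has_int_pow.
by apply: has_intD; apply: has_intZ; apply: has_intD; (exact: i) || exact: has_int_pow.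
Qed.

Lemma exp_inv M (t : R) : expR (- (2 * pi * (dD ^- 2 * t^-1))) ^+ M = expR (- (inv_rate M * t^-1)).
Proof. by rewrite -expRM_natl; congr expR; rewrite /inv_rate; ring. Qed.
Lemma exp_pow M (t : R) : expR (- (2 * pi * t)) ^+ M = expR (- (2 * pi * M%:R * t)).
Proof. by rewrite -expRM_natl; congr expR; ring. Qed.

Lemma pow_inv t : 0 < t -> (dD * t)^-1 ^+ K * t ^+ l = dilation * (t^-1) ^+ L.+2.
Proof.
move=> t0; rewrite invfM exprMn -/dilation -mulrA; congr (_ * _).
rewrite eK (_ : (L + l + 2 = L.+2 + l)%N); last by lia.
by rewrite exprD -mulrA -exprMn mulVf ?gt_eqF // expr1n mulr1.
Qed.

Lemma nm_dual_coef_le : nm dual_coef <= weight_norm.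
Proof.
apply: le_trans (nm_sum _ _ _) _; rewrite /weight_norm big_mkcond; apply: ler_sum => j _.
by case: ifP => _; rewrite ?nm_ge0 // nmM nmX nm_zeta expr1n mulr1.
Qed.

Lemma inv_fun_ge0 M t : 0 < t -> 0 <= inv_fun M t.
Proof.
by move=> t0; apply: mulr_ge0; [apply: exprn_ge0; rewrite invr_ge0 ltW|exact: expR_ge0].
Qed.
Lemma pow_fun_ge0 M t : 0 < t -> 0 <= pow_fun M t.
Proof.
by move=> t0; apply: mulr_ge0; [apply: exprn_ge0; exact: ltW|exact: expR_ge0].
Qed.

Lemma shift_sum_bound t : 0 < t ->
  nm (shift_sum t * rr (t ^+ l) - automorphy * dual_coef * rr (dilation * inv_fun m t)) <= majorant t.
Proof.
move=> t0; have tl0 : 0 <= t ^+ l by apply: exprn_ge0; exact: ltW.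
have d0 : 0 <= dilation by apply: exprn_ge0; rewrite invr_ge0 ltW.
have S0 := weight_norm_ge0; have r1 := low_const_ge0; have r2 := high_const_ge0.
have E0 : 0 <= expR (2 * pi / dD) by exact: expR_ge0.
have ig M : 0 <= dilation * inv_fun M t by apply: mulr_ge0 => //; exact: inv_fun_ge0.
have pg M := pow_fun_ge0 M t0.
have rhoP y : tail_bound y = low_const * expR (- (2 * pi * y)) ^+ m.+1 + high_const * expR (- (2 *
  pi * y)) ^+ N by [].
have [tD|Dt] := lerP t dD^-1.
  set P := (dD * t)^-1 ^+ K; set u := dD ^- 2 * t^-1.
  have e1 M : P * t ^+ l * expR (- (2 * pi * u)) ^+ M = dilation * inv_fun M t.
    by rewrite (pow_inv t0) exp_inv -mulrA.
  have -> : shift_sum t * rr (t ^+ l) - automorphy * dual_coef * rr (dilation * inv_fun m t) =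
     (shift_sum t - automorphy * dual_coef * rr (P * expR (- (2 * pi * u)) ^+ m)) * rr (t ^+ l).
    rewrite mulrBl -e1; congr (_ - _); rewrite -[RHS]mulrA -rmorphM; congr (_ * rr _).
    by rewrite mulrAC.
  rewrite nmM nm_rr (ger0_norm tl0).
  apply: le_trans (ler_wpM2r tl0 (shift_sum_small t0 tD)) _; rewrite -/P -/u /majorant -[leLHS]mulrA.
  apply: ler_wpM2l => //.
  have -> : P * tail_bound u * t ^+ l =
    low_const * (dilation * inv_fun m.+1 t) + high_const * (dilation * inv_fun N t).
    by rewrite rhoP -!e1; ring.
  have := ig m.+1; have := ig N; have := pg m.+1; have := pg N; have := pg m.
  move: (dilation * inv_fun m.+1 t) (dilation * inv_fun N t) (pow_fun m.+1 t) (pow_fun N t) (pow_fun m t).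
  move=> i1 i2 p1 p2 p3 h1 h2 h3 h4 h5.
  have := mulr_ge0 r1 h3; have := mulr_ge0 r2 h2; have := mulr_ge0 E0 h5; lra.
apply: le_trans (nmDB _ _) _.
have h1 : nm (shift_sum t * rr (t ^+ l)) <=
  weight_norm * (pow_fun m t + low_const * pow_fun m.+1 t + high_const * pow_fun N t).
  rewrite nmM nm_rr (ger0_norm tl0); apply: le_trans (ler_wpM2r tl0 (shift_sum_large (ltW Dt))) _.
  rewrite -[leLHS]mulrA; apply: ler_wpM2l => //.
  by rewrite rhoP !exp_pow /pow_fun le_eqVlt; apply/orP; left; apply/eqP; ring.
(* For 1/t < D, replacing m by m + 1 in the exponential costs at most exp(2 pi/D), so the main term
   is itself an error of the next order. *)
have h2 : nm (automorphy * dual_coef * rr (dilation * inv_fun m t)) <=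
  weight_norm * (expR (2 * pi / dD) * (dilation * inv_fun m.+1 t)).
  rewrite nmM [nm (automorphy * _)]nmM nm_automorphy mul1r nm_rr (ger0_norm (ig m)).
  apply: ler_pM => //; rewrite ?nm_ge0 ?nm_dual_coef_le // [leRHS]mulrCA;
    apply: (@ler_wpM2l _ dilation) => //.
  rewrite /inv_fun [leRHS]mulrCA; apply: ler_wpM2l; first by apply: exprn_ge0; rewrite invr_ge0 ltW.
  rewrite -expRD ler_expR.
  have -> : inv_rate m.+1 = inv_rate m + 2 * pi / dD ^+ 2 by rewrite /inv_rate -natr1; ring.
  have : t^-1 <= dD by rewrite -[leRHS]invrK lef_pV2 ?posrE ?invr_gt0 // ltW.
  move=> h; have : 2 * pi / dD ^+ 2 * t^-1 <= 2 * pi / dD ^+ 2 * dD.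
    by apply: ler_wpM2l h; rewrite divr_ge0 ?exprn_ge0 ?(ltW DR) // mulr_ge0 // pi_ge0.
  have -> : 2 * pi / dD ^+ 2 * dD = 2 * pi / dD.
    by rewrite expr2 invfM mulrA divfK ?gt_eqF.
  rewrite mulrDl; lra.
apply: le_trans (lerD h1 h2) _; rewrite /majorant -mulrDr; apply: ler_wpM2l => //.
have := mulr_ge0 r1 (ig m.+1); have := mulr_ge0 r2 (ig N); lra.
Qed.

Lemma shift_sum_cintegrable : measurable_fun Rp (fun t => complex.Re (shift_sum t)) ->
  measurable_fun Rp (fun t => complex.Im (shift_sum t)) ->
  cintegrable (fun t => shift_sum t * rr (t ^+ l)).
Proof.
move=> m1 m2.
have mt : measurable_fun Rp (fun t : R => t ^+ l).
  exact: measurable_realfun.exprn_measurable.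
have hd := has_intD has_int_G (has_intZ (nm dual_coef) (has_intZ dilation (has_int_inv m0))).
apply: (cintegrable_dom (G := fun t => majorant t + nm dual_coef * (dilation * inv_fun m t))) hd.1 _.
- rewrite (_ : (fun t => _) = fun t => complex.Re (shift_sum t) * t ^+ l).
    exact: measurable_realfun.measurable_funM.
  by apply/funext => t; rewrite ReM /= mulr0 subr0.
- rewrite (_ : (fun t => _) = fun t => complex.Im (shift_sum t) * t ^+ l).
    exact: measurable_realfun.measurable_funM.
  by apply/funext => t; rewrite ImM /= mulr0 add0r.
move=> t t0; have h := shift_sum_bound t0.
have d0 : 0 <= dilation * inv_fun m t.
  by apply: mulr_ge0 (inv_fun_ge0 _ t0); apply: exprn_ge0; rewrite invr_ge0 ltW.
have e : nm (automorphy * dual_coef * rr (dilation * inv_fun m t)) =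
  nm dual_coef * (dilation * inv_fun m t).
  by rewrite nmM [nm (automorphy * _)]nmM nm_automorphy mul1r nm_rr (ger0_norm d0).
rewrite -e -[X in nm X <= _](subrK (automorphy * dual_coef * rr (dilation * inv_fun m t))).
by apply: le_trans (nmD _ _) _; rewrite lerD2r.
Qed.

(** When the weighted period vanishes, the integral of the main term is minus that of the error. *)
Lemma period_bound : cintegrable (fun t => shift_sum t * rr (t ^+ l)) ->
  Cintegral (fun t => shift_sum t * rr (t ^+ l)) = 0 ->
  nm dual_coef * (dilation * inv_int m) <= 2 * majorant_int.
Proof.
move=> ci c0.
have [i1 i2] := has_intZ dilation (has_int_inv m0).
have [r1 r2] := cintegrable_real i1; rewrite i2 in r2.
have [z1 z2] := cintegrableZ (- (automorphy * dual_coef)) r1; rewrite r2 in z2.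
have [d1 d2] := cintegrableD ci z1; rewrite c0 z2 add0r in d2.
have [g1 g2] := has_int_G.
have := nm_Cintegral d1 g1; rewrite d2 g2 mulNr nmN nmM [nm (automorphy * _)]nmM nm_automorphy mul1r nm_rr.
have d0 : 0 <= dilation * inv_int m.
  apply: mulr_ge0; first by apply: exprn_ge0; rewrite invr_ge0 ltW.
  by rewrite divr_ge0 // exprn_ge0 // ltW // inv_rate_gt0.
rewrite (ger0_norm d0); apply => t t0; rewrite mulNr; exact: shift_sum_bound.
Qed.

End Estimate.

(** * Twists as sums of translates *)

Section Twist.
Variables (R : realType) (D : nat).
Hypothesis D0 : (0 < D)%N.
Local Notation Rp := (`]0, +oo[%classic : set R).
Local Notation zeta := (zeta R D).
Variables (k : nat) (F : CC R -> CC R) (a : nat -> CC R).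
Hypotheses (hF : mform k F a) (a0 : a 0%N = 0).
Implicit Types (C : nat -> CC R) (z : CC R).

Lemma measurable_big (r : seq nat) (f : nat -> R -> R) :
  (forall n, measurable_fun Rp (f n)) -> measurable_fun Rp (fun t => \sum_(n <- r) f n t).
Proof.
move=> mf; elim: r => [|n r IH].
  by rewrite (_ : (fun t => _) = cst 0); [exact: measurable_cst|apply/funext => t; rewrite big_nil].
rewrite (_ : (fun t => _) = fun t => f n t + \sum_(i <- r) f i t).
  exact: measurable_realfun.measurable_funD.
by apply/funext => t; rewrite big_cons.
Qed.

Lemma im_shift_frac z (j : nat) : complex.Im (z + j%:R / D%:R) = complex.Im z.
Proof.
by rewrite -!(rmorph_nat (@rr R)) -fmorphV -rmorphM ImD /= addr0.
Qed.

Lemma nome_shift_frac z (j : nat) : nome (z + j%:R / D%:R) = nome z * zeta ^+ j.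
Proof. by rewrite nomeD nome_natM. Qed.

Lemma hsum_shifts C z : 0 < complex.Im z ->
  hsum (fun n => (\sum_(j < D) C j * zeta ^+ (j * n)) * a n * nome z ^+ n)
    (\sum_(j < D) C j * F (z + j%:R / D%:R)).
Proof.
move=> z0.
have h (j : 'I_D) : hsum (fun n => C j * (a n * nome (z + j%:R / D%:R) ^+ n))
    (C j * F (z + j%:R / D%:R)).
  by apply: hsumZ; apply: (mform_sum hF); rewrite im_shift_frac.
apply: hsum_ext (hsum_bigD (index_enum 'I_D) h) => n.
rewrite !mulr_suml; apply: eq_bigr => j _.
by rewrite nome_shift_frac exprMn -exprM; ring.
Qed.

Lemma twist_eq (chi : int -> CC R) C z : 0 < complex.Im z ->
  (forall n : nat, chi n%:Z = \sum_(j < D) C j * zeta ^+ (j * n)) ->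
  twist chi (ext0 F) z = \sum_(j < D) C j * F (z + j%:R / D%:R).
Proof.
move=> z0 hC; rewrite /twist (qcoef_eq (ext0_qexp hF a0)); apply: CC_lim.
apply: hsum_cvg; first by rewrite a0 mulr0 mul0r.
by apply: hsum_ext (hsum_shifts C z0) => n; rewrite hC.
Qed.

(** The functions are pointwise limits of polynomials in exp(-2 pi t). *)
Lemma shifts_measurable C :
  measurable_fun Rp (fun t => complex.Re (\sum_(j < D) C j * F (mkC 0 t + j%:R / D%:R))) /\
  measurable_fun Rp (fun t => complex.Im (\sum_(j < D) C j * F (mkC 0 t + j%:R / D%:R))).
Proof.
pose c n := (\sum_(j < D) C j * zeta ^+ (j * n)) * a n.
pose e (t : R) := expR (- (2 * pi * t)).
have me n : measurable_fun Rp (fun t => e t ^+ n).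
  apply: (@measurableT_comp _ _ _ _ _ _ (fun x : R => x ^+ n)).
    exact: measurable_realfun.exprn_measurable.
  apply: (@measurableT_comp _ _ _ _ _ _ expR); first exact: measurable_realfun.measurable_expR.
  rewrite (_ : (fun t => _) = fun t => - (2 * pi) * t); last by apply/funext => t; rewrite mulNr.
  by apply: measurable_realfun.measurable_funM.
have cv t : 0 < t -> ((fun N => \sum_(1 <= n < N) c n * rr (e t) ^+ n) @ \oo -->
    \sum_(j < D) C j * F (mkC 0 t + j%:R / D%:R))%classic.
  move=> t0; apply: hsum_cvg; first by rewrite /c a0 mulr0 mul0r.
  by apply: hsum_ext (@hsum_shifts C (mkC 0 t) t0) => n; rewrite nome_imag.
split.
  apply: (@measurable_realfun.measurable_fun_cvg _ _ R _
    (fun N t => \sum_(n <- index_iota 1 N) complex.Re (c n) * e t ^+ n)).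
    move=> N; apply: measurable_big => n.
    by apply: measurable_realfun.measurable_funM.
  move=> t /=; rewrite in_itv /= andbT => t0.
  apply/cvgrPdist_lt => d d0; have [N0 hN] := (CC_cvgP _ _).2 (cv t t0) d d0.
  exists N0 => // N /= /hN; apply: le_lt_trans; apply: le_trans (Re_le_nm _).
  rewrite ReD ReN [X in _ <= `|_ - X|]Re_sum le_eqVlt; apply/orP; left; apply/eqP; congr `|_ - _|.
  by apply: eq_bigr => n _; rewrite -rmorphXn ReM /= mulr0 subr0.
apply: (@measurable_realfun.measurable_fun_cvg _ _ R _
  (fun N t => \sum_(n <- index_iota 1 N) complex.Im (c n) * e t ^+ n)).
  move=> N; apply: measurable_big => n.
  by apply: measurable_realfun.measurable_funM.
move=> t /=; rewrite in_itv /= andbT => t0.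
apply/cvgrPdist_lt => d d0; have [N0 hN] := (CC_cvgP _ _).2 (cv t t0) d d0.
exists N0 => // N /= /hN; apply: le_lt_trans; apply: le_trans (Im_le_nm _).
rewrite ImD ImN [X in _ <= `|_ - X|]Im_sum le_eqVlt; apply/orP; left; apply/eqP; congr `|_ - _|.
by apply: eq_bigr => n _; rewrite -rmorphXn ImM /= mulr0 add0r.
Qed.

End Twist.

(** * Comparison of the integrals for large weight *)

Section Asymptotics.
Variable R : realType.
Implicit Types (x y w d : R).

Lemma pow_fact_le y n : 0 <= y -> y ^+ n / n`!%:R <= expR y.
Proof.
case: n => [|n] y0; last by have := expR_ge1Dxn n y0; lra.
by rewrite expr0 fact0 divr1 -expR0 ler_expR.
Qed.

(** The binomial coefficient C(k + l, l) is at least 1. *)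
Lemma fact_ratio l k : l`!%:R / (k + l)`!%:R <= (k`!%:R)^-1 :> R.
Proof.
have f n : 0 < n`!%:R :> R by rewrite ltr0n fact_gt0.
rewrite ler_pdivrMr // ler_pdivlMl // -natrM ler_nat.
have := bin_fact (leq_addr l k); rewrite [(k + l - k)%N]addKn => <-.
by apply: leq_pmull; rewrite bin_gt0 leq_addr.
Qed.

(* The decay of [l! / L!], [L = k + l], is what makes the contribution of
   [a_m q^m] near [i oo] negligible against its mirror image near [0]. *)
Lemma ratio_small x l k : 0 <= x ->
  x ^+ k.+1 * (l`!%:R / (k.+1 + l)`!%:R) <= x * expR x / (k.+1 + l)%:R.
Proof.
move=> x0; have f n : 0 < n`!%:R :> R by rewrite ltr0n fact_gt0.
have L0 : 0 < (k.+1 + l)%:R :> R by rewrite ltr0n addSn.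
have -> : x ^+ k.+1 * (l`!%:R / (k.+1 + l)`!%:R) =
   x * (x ^+ k * (l`!%:R / (k + l)`!%:R)) / (k.+1 + l)%:R.
  by rewrite addSn factS natrM exprS invfM; ring.
apply: ler_wpM2r; first by rewrite invr_ge0 ltW.
apply: ler_wpM2l => //; apply: le_trans (pow_fact_le k x0).
by apply: ler_wpM2l (fact_ratio l k); exact: exprn_ge0.
Qed.

(** With w = 2 pi m and d = D: the quotient of the two integrals attached to q^m, near i oo and near
    0. *)
Lemma period_ratio w d l k : 0 < w -> 0 < d ->
  l`!%:R / w ^+ l.+1 = ((w / d) ^+ k * (l`!%:R / (k + l)`!%:R)) *
    (d^-1 ^+ (k + l + l + 2) * ((k + l)`!%:R / (w / d ^+ 2) ^+ (k + l).+1)).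
Proof.
move=> w0 d0; have f n : n`!%:R != 0 :> R by rewrite pnatr_eq0 -lt0n fact_gt0.
have wn : w != 0 by rewrite gt_eqF.
have dn : d != 0 by rewrite gt_eqF.
rewrite !expr_div_n exprVn -exprM.
have -> : (2 * (k + l).+1 = (k + l + l + 2) + k)%N by lia.
have -> : ((k + l).+1 = k + l.+1)%N by lia.
rewrite !exprD; have := f (k + l)%N; have := f l.
move: (l`!%:R) ((k + l)`!%:R) => u v u0 v0.
have := expf_neq0 k wn; have := expf_neq0 k dn; have := expf_neq0 l dn; have := expf_neq0 l.+1 wn.
move: (w ^+ k) (d ^+ k) (w ^+ l.+1) (d ^+ l) => p1 p2 p3 p4 h3 h4 h2 h1.
by field; rewrite ?u0 ?v0 ?h1 ?h2 ?h3 ?h4 ?dn.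
Qed.

Lemma natX_decay s n : 0 <= s -> s < 1 -> exists2 M : R, 0 <= M & forall K : nat, K%:R ^+ n * s ^+ K <= M.
Proof.
move=> s0 s1; have [|M hM] := @absb_natX R n (rr s); first by rewrite nm_rr ger0_norm.
exists M; first exact: absb_ge0 hM.
move=> K; have := hM [:: K] isT; rewrite big_seq1; apply: le_trans.
by rewrite nmM !nmX nm_nat nm_rr (ger0_norm s0).
Qed.

(** Every integral is measured against [dilation * inv_int m]. Replacing m by n multiplies [inv_int]
    by (m/n)^(L+1); with s the square root of m/n this is at most s^K, because 2(L+1) >= K. Square
    roots thus give a bound uniform in l. *)
Lemma majorant_int_le (D m N l k : nat) (Bd C s1 s2 : R) (Cc : nat -> CC R) :
  let L := (k.+1 + l)%N in let K := (L + l + 2)%N in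
  let x : R := 2 * pi * m%:R / D%:R in
  (0 < D)%N -> (0 < m)%N -> (0 < N)%N -> 0 <= Bd -> 0 <= C ->
  0 < s1 -> s1 <= 1 -> 0 < s2 -> s2 <= 1 -> s1 ^+ 2 = m%:R / m.+1%:R -> s2 ^+ 2 = m%:R / N%:R ->
  (l <= k.+1 + l)%N ->
  majorant_int D K L l m N Bd C Cc <= weight_norm D Cc * (C * K%:R ^+ N * (s1 ^+ K * (1 + expR (x / s1))) +
     Bd / expR (- (pi / D%:R)) ^+ N * (s2 ^+ K * (1 + expR (x / s2))) +
     x * expR x / L%:R + expR (2 * pi / D%:R) * s1 ^+ K) * (dilation R D K * inv_int R D L m).
Proof.
move=> L K x D0 m0 N0 B0 C0 s10 s11 s20 s21 e1 e2 lL.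
have DR : 0 < D%:R :> R by rewrite ltr0n.
have w0 n : (0 < n)%N -> 0 < 2 * pi * n%:R :> R.
  by move=> n0; rewrite mulr_gt0 ?ltr0n // mulr_gt0 // pi_gt0.
have x0 : 0 <= x by apply: divr_ge0; apply: ltW => //; exact: w0.
have f n : 0 < n`!%:R :> R by rewrite ltr0n fact_gt0.
set P := dilation R D K * inv_int R D L m.
have P0 : 0 <= P.
  apply: mulr_ge0; first by apply: exprn_ge0; rewrite invr_ge0 ltW.
  by apply: divr_ge0; [exact: ltW|apply: exprn_ge0; apply: divr_ge0;
    [exact: ltW (w0 _ _)|exact: exprn_ge0 (ltW DR)]].
have hX n s : (0 < n)%N -> 0 < s -> s <= 1 -> s ^+ 2 = m%:R / n%:R ->
   dilation R D K * inv_int R D L n <= s ^+ K * P.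
  move=> n0 s0 s1_ es.
  have -> : dilation R D K * inv_int R D L n = (s ^+ 2) ^+ L.+1 * P.
    have -> : inv_int R D L n = (s ^+ 2) ^+ L.+1 * inv_int R D L m.
      rewrite /inv_int es; have -> : inv_rate R D m = inv_rate R D n * (m%:R / n%:R).
        rewrite /inv_rate; have : n%:R != 0 :> R by rewrite pnatr_eq0 -lt0n.
        by move=> nn; field; rewrite ?nn ?gt_eqF.
      rewrite [(inv_rate R D n * _) ^+ _]exprMn.
      have h1 : (m%:R / n%:R : R) ^+ L.+1 != 0.
        by rewrite expf_neq0 // mulf_neq0 ?invr_eq0 ?pnatr_eq0 -?lt0n.
      have h2 : inv_rate R D n ^+ L.+1 != 0 by rewrite expf_neq0 // gt_eqF // inv_rate_gt0.
      move: ((m%:R / n%:R : R) ^+ L.+1) (inv_rate R D n ^+ L.+1) (L`!%:R : R) h1 h2 => u v q h1 h2.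
      by field; rewrite h1 h2.
    by rewrite mulrCA.
  apply: ler_wpM2r => //; rewrite -exprM; apply: ler_wiXn2l => //; first exact: ltW.
  by rewrite /K /L; clear; lia.
have hY : pow_int R l m = (x ^+ k.+1 * (l`!%:R / L`!%:R)) * P.
  exact: (period_ratio l k.+1 (w0 _ m0) DR).
have hXY n s : (0 < n)%N -> 0 < s -> s <= 1 -> s ^+ 2 = m%:R / n%:R ->
   pow_int R l n <= s ^+ K * expR (x / s) * P.
  move=> n0 s0 s1_ es.
  have -> : pow_int R l n = (s ^+ 2) ^+ l.+1 * pow_int R l m.
    rewrite /pow_int es; have nn : n%:R != 0 :> R by rewrite pnatr_eq0 -lt0n.
    have mn : m%:R != 0 :> R by rewrite pnatr_eq0 -lt0n.
    rewrite expr_div_n ![(2 * pi * _) ^+ _]exprMn.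
    have h1 := expf_neq0 l.+1 nn; have h2 := expf_neq0 l.+1 mn.
    have h3 : (2 * pi : R) ^+ l.+1 != 0 by rewrite expf_neq0 // mulf_neq0 // gt_eqF // pi_gt0.
    move: ((n%:R : R) ^+ l.+1) ((m%:R : R) ^+ l.+1) ((2 * pi : R) ^+ l.+1) h1 h2 h3 => p q v h1 h2 h3.
    by field; rewrite h1 h2 h3.
  rewrite hY mulrA; apply: ler_wpM2r => //.
  (* As K = 2(l+1) + (k+1), the missing powers of s are taken from x^(k+1), which becomes
     (x/s)^(k+1) and is tamed by the factorials. *)
  have -> : (s ^+ 2) ^+ l.+1 * (x ^+ k.+1 * (l`!%:R / L`!%:R)) =
     s ^+ K * ((x / s) ^+ k.+1 * (l`!%:R / L`!%:R)).
    rewrite mulrA [RHS]mulrA; congr (_ * _); rewrite -exprM (expr_div_n x s).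
    have -> : K = (2 * l.+1 + k.+1)%N by rewrite /K /L; clear; lia.
    rewrite (exprD s (2 * l.+1) k.+1) -[RHS]mulrA; congr (_ * _); rewrite mulrCA mulfV ?mulr1 //.
    by rewrite expf_neq0 // gt_eqF.
  apply: ler_wpM2l; first by apply: exprn_ge0; exact: ltW.
  have xs : 0 <= x / s by apply: divr_ge0 => //; exact: ltW.
  apply: le_trans (pow_fact_le k.+1 xs).
  by apply: ler_wpM2l (fact_ratio _ _); exact: exprn_ge0.
have hYm : pow_int R l m <= x * expR x / L%:R * P.
  by rewrite hY; apply: ler_wpM2r => //; exact: ratio_small.
rewrite /majorant_int -[leRHS]mulrA; apply: ler_wpM2l; first by apply: sumr_ge0 => j _; exact: nm_ge0.
rewrite [leRHS]mulrDl; apply: lerD; last first.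
  by rewrite -[leRHS]mulrA; apply: ler_wpM2l; [exact: expR_ge0|exact: hX].
rewrite [leRHS]mulrDl; apply: lerD; last exact: hYm.
rewrite [leRHS]mulrDl; apply: lerD.
  rewrite -[leRHS]mulrA; apply: ler_wpM2l; first by apply: mulr_ge0 => //; exact: exprn_ge0.
  rewrite mulrDr mulr1 mulrDl; apply: lerD; [exact: hX|exact: hXY].
rewrite -[leRHS]mulrA; apply: ler_wpM2l.
  by apply: divr_ge0 => //; apply: exprn_ge0; exact: expR_ge0.
rewrite mulrDr mulr1 mulrDl; apply: lerD; [exact: hX|exact: hXY].
Qed.

Lemma beta_decay (beta s : R) K : 1 <= beta -> 0 < s -> beta * s <= 2^-1 ->
  beta ^+ K.+1 * s ^+ K.+1 <= K.+1%:R^-1.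
Proof.
move=> b1 s0 bs; rewrite -exprMn.
have bs0 : 0 <= beta * s by apply: mulr_ge0; [lra|exact: ltW].
apply: (@le_trans _ _ (2^-1 ^+ K.+1)); first by apply: lerXn2r; rewrite ?nnegrE ?invr_ge0.
rewrite exprVn lef_pV2 ?posrE ?ltr0n ?exprn_gt0 // -natrX ler_nat.
exact: ltnW (ltn_expl _ _).
Qed.

Local Notation r D := (expR (- (pi / D%:R)) : R).

(** The constant depends on D and m only: the same form serves every l in range and all weights, in
    particular the individual twists and their linear combinations. *)
Lemma dual_coef_bound (D m : nat) : (0 < D)%N -> (0 < m)%N ->
  exists Ct : R, exists K1 : nat, 0 <= Ct /\ forall K, ~~ odd K -> (K1 <= K)%N ->
  exists F a, [/\ mform K F a, a 0%N = 0 & forall l s Cc, (2 * l + 4 <= K)%N ->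
    (forall j, coprime j D -> (s j < D)%N /\ (D %| j * s j + 1)%N) ->
    (forall j, ~~ coprime j D -> Cc j = 0) ->
    cintegrable (fun t => shift_sum D F Cc t * rr (t ^+ l)) /\
    (Cintegral (fun t => shift_sum D F Cc t * rr (t ^+ l)) = 0 ->
     nm (dual_coef D m s Cc) <= weight_norm D Cc * (Ct / K%:R))].
Proof.
move=> D0 m0; have DR : 0 < D%:R :> R by rewrite ltr0n.
have mR : 0 < m%:R :> R by rewrite ltr0n.
have r0 : 0 < r D by exact: expR_gt0.
have r1 : r D < 1 by rewrite -[ltRHS]expR0 ltr_expR oppr_lt0; apply: divr_gt0 => //; exact: pi_gt0.
have [beta b1 hb] := test_forms r0 r1.
have [C [K1 hK]] := hb m.
(* N >= 4 beta^2 m gives beta s2 <= 1/2 for s2^2 = m/N, so the terms from N on contribute O(2^(-K))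
   despite the factor beta^K. *)
pose N := maxn m.+1 (Num.truncn (4 * beta ^+ 2 * m%:R)).+1.
have mN : (m < N)%N by rewrite leq_max ltnSn.
have NR : 0 < N%:R :> R by rewrite ltr0n (leq_trans _ mN).
have hN : 4 * beta ^+ 2 * m%:R <= N%:R.
  have h0 : 0 <= 4 * beta ^+ 2 * m%:R by apply: mulr_ge0; [apply: mulr_ge0 => //;
    exact: sqr_ge0|exact: ltW].
  have /andP[_ /ltW h] := truncn_itv h0; apply: le_trans h _.
  by rewrite ler_nat leq_max leqnn orbT.
have root n : (m < n)%N -> exists s : R, [/\ 0 < s, s < 1 & s ^+ 2 = m%:R / n%:R].
  move=> mn; have n0 : 0 < n%:R :> R by rewrite ltr0n (leq_trans _ mn).
  have q0 : 0 < m%:R / n%:R :> R by rewrite divr_gt0.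
  exists (Num.sqrt (m%:R / n%:R)); split; rewrite ?sqrtr_gt0 ?sqr_sqrtr ?(ltW q0) //.
  by rewrite -[ltRHS]sqrtr1 ltr_sqrt // ltr_pdivrMr // mul1r ltr_nat.
have [s1 [s10 s11 e1]] := root m.+1 (ltnSn m).
have [s2 [s20 s21 e2]] := root N mN.
have bs : beta * s2 <= 2^-1.
  have b0 : 0 <= beta by lra.
  rewrite -(@ler_pXn2r _ 2) ?nnegrE ?invr_ge0 ?mulr_ge0 ?(ltW s20) //.
  rewrite exprMn e2 mulrA ler_pdivrMr //.
  by rewrite exprVn; lra.
(* K^N comes from [low_const]; the extra power of K yields the factor 1/K. *)
have [M1 M10 hM1] := natX_decay N.+1 (ltW s10) s11.
pose x : R := 2 * pi * m%:R / D%:R.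
have x0 : 0 <= x by rewrite divr_ge0 ?mulr_ge0 ?pi_ge0 // ltW.
(* The sign of [C] is known only once a form of some weight K is at hand, while the constant must be
   non-negative beforehand. *)
pose C' := Num.max C 0.
have C'0 : 0 <= C' by rewrite le_max lexx orbT.
pose E1 : R := 1 + expR (x / s1); pose E2 : R := 1 + expR (x / s2).
have E10 : 0 <= E1 by rewrite addr_ge0 // expR_ge0.
have E20 : 0 <= E2 by rewrite addr_ge0 // expR_ge0.
pose iN : R := (r D ^+ N)^-1; have iN0 : 0 <= iN by rewrite invr_ge0 exprn_ge0 // ltW.
pose E3 : R := expR (2 * pi / D%:R); have E30 : 0 <= E3 by exact: expR_ge0.
have ex0 : 0 <= x * expR x by rewrite mulr_ge0 // expR_ge0.
exists (2 * (C' * M1 * E1 + iN * E2 + 2 * (x * expR x) + E3 * M1)), K1; split.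
  apply: mulr_ge0 => //; apply: addr_ge0; last exact: mulr_ge0.
  apply: addr_ge0; last exact: mulr_ge0.
  by apply: addr_ge0; apply: mulr_ge0 => //; exact: mulr_ge0.
move=> K oK lK; have [F [a [hF va am nr nK]]] := hK K oK lK.
have C0 : 0 <= C := absb_ge0 nK.
have eC : C' = C by rewrite /C' max_l.
exists F, a; split=> //; first exact: va.
move=> l s Cc hl hs Cc0; pose k := (K - 2 * l - 3)%N.
have eK : K = (k.+1 + l + l + 2)%N by rewrite /k; move: hl; clear; lia.
have ci : cintegrable (fun t => shift_sum D F Cc t * rr (t ^+ l)).
  have [me1 me2] := shifts_measurable D hF (va 0%N m0) Cc.
  exact: (shift_sum_cintegrable D0 eK m0 mN hF va am nr nK hs Cc0 me1 me2).
split=> // c0; have := period_bound D0 eK m0 mN hF va am nr nK hs Cc0 ci c0.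
have Bd0 : 0 <= beta ^+ K by apply: exprn_ge0; lra.
have := @majorant_int_le D m N l k (beta ^+ K) C s1 s2 Cc D0 m0 (leq_trans m0 (ltnW mN)) Bd0 C0
  s10 (ltW s11) s20 (ltW s21) e1 e2 (leq_addl _ _).
rewrite /= -eK -/x -/E1 -/E2 -/E3 => h1 h2.
set P := dilation R D K * _ in h1 h2.
have P0 : 0 < P.
  rewrite mulr_gt0 ?exprn_gt0 ?invr_gt0 // divr_gt0 ?ltr0n ?fact_gt0 //.
  by rewrite exprn_gt0 // inv_rate_gt0.
have {h1 h2}h : nm (dual_coef D m s Cc) <= 2 * (weight_norm D Cc * (C * K%:R ^+ N * (s1 ^+ K * E1) +
  beta ^+ K / r D ^+ N * (s2 ^+ K * E2) + x * expR x / (k.+1 + l)%:R + E3 * s1 ^+ K)).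
  rewrite -(ler_pM2r P0); apply: le_trans h2 _; rewrite -[leRHS]mulrA.
  by apply: ler_wpM2l h1.
apply: le_trans h _; rewrite mulrCA; apply: ler_wpM2l.
  by apply: sumr_ge0 => j _; exact: nm_ge0.
have K0 : 0 < K%:R :> R by rewrite ltr0n; move: eK; clear; lia.
rewrite -[leRHS]mulrA; apply: ler_wpM2l => //.
have sK := hM1 K.
rewrite [leRHS]mulrDl; apply: lerD; [rewrite [leRHS]mulrDl; apply: lerD; [rewrite [leRHS]mulrDl;
  apply: lerD|]|].
- have -> : C * K%:R ^+ N * (s1 ^+ K * E1) = C * E1 * (K%:R ^+ N.+1 * s1 ^+ K) / K%:R.
    by rewrite [_ ^+ N.+1]exprSr; field; rewrite gt_eqF.
  rewrite eC; apply: ler_wpM2r; first by rewrite invr_ge0 ltW.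
  by rewrite [leRHS]mulrAC; apply: ler_wpM2l => //; exact: mulr_ge0.
- have -> : beta ^+ K / r D ^+ N * (s2 ^+ K * E2) = iN * E2 * (beta ^+ K * s2 ^+ K).
    by rewrite /iN; ring.
  apply: ler_wpM2l; first exact: mulr_ge0.
  rewrite (_ : K = K.-1.+1); last by move: eK; clear; lia.
  exact: beta_decay.
- have L0 : 0 < (k.+1 + l)%:R :> R by rewrite ltr0n addSn.
  have -> : 2 * (x * expR x) / K%:R = x * expR x * (2 / K%:R) by ring.
  apply: ler_wpM2l => //.
  rewrite ler_pdivlMr // mulrC ler_pdivrMr // -natrM ler_nat eK.
  by move: hl; rewrite eK; clear; lia.
rewrite -mulrA; apply: ler_wpM2l => //; rewrite ler_pdivlMr //.
apply: le_trans sK; rewrite mulrC; apply: ler_wpM2r; first by apply: exprn_ge0; exact: ltW.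
rewrite exprS; apply: ler_peMr; first exact: ltW.
by apply: exprn_ege1; rewrite ler1n -(ltr0n R).
Qed.

End Asymptotics.

(** * Linear independence of the twisted periods *)

Lemma Cintegral_eq (R : realType) (g h : R -> CC R) : (forall t, 0 < t -> g t = h t) ->
  Cintegral g = Cintegral h.
Proof.
move=> gh; rewrite /Cintegral; congr mkC; apply: eq_Rintegral => t;
  by rewrite inE /= in_itv /= andbT => t0; rewrite gh.
Qed.

(** B i j is kappa_i w_i^(-j), so each i contributes the sum over j of (w_k/w_i)^j, a full sum of
    powers of an e-th root of unity that differs from 1 unless i = k. *)
Lemma dual_orthogonality (R : realType) (n e : nat) (w c kappa : 'I_n -> CC R)
  (B : 'I_n -> nat -> CC R) (k : 'I_n) : (0 < e)%N -> (forall i, w i ^+ e = 1) -> injective w ->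
  (forall i j, w i ^+ j * B i j = kappa i) ->
  \sum_(j < e) w k ^+ j * (\sum_i c i * B i j) = e%:R * (c k * kappa k).
Proof.
move=> e0 we wi hB.
have w0 i : w i != 0.
  by apply: contra_eq_neq (we i) => ->; rewrite expr0n gtn_eqF // eq_sym oner_eq0.
have BE i j : B i j = kappa i / w i ^+ j by rewrite -(hB i j) mulrAC mulfV ?mul1r // expf_neq0.
transitivity (\sum_(i < n) c i * kappa i * \sum_(j < e) (w k / w i) ^+ j).
  rewrite [RHS](eq_bigr (fun i => \sum_(j < e) w k ^+ j * (c i * B i j))); last first.
    by move=> i _; rewrite mulr_sumr; apply: eq_bigr => j _; rewrite BE expr_div_n; ring.
  by rewrite exchange_big; apply: eq_bigr => j _; rewrite mulr_sumr.
rewrite (bigD1 k) //= divff // [X in _ * X](eq_bigr (fun=> 1)) => [|j _]; last by rewrite expr1n.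
rewrite sumr_const card_ord big1 ?addr0 => [|i ik]; first by rewrite mulrC.
have ne : w k / w i != 1.
  apply: contraNneq ik => h; apply/eqP/wi/esym.
  by rewrite -[LHS](divfK (w0 i)) h mul1r.
rewrite sum_roots ?(negbTE ne) ?mulr0 //.
by rewrite expr_div_n !we divr1.
Qed.

(** The factor i^(l+1) collects i^l from z^l and i from dz. *)
Lemma twisted_period_eq (R : realType) (D K l : nat) (D0 : (0 < D)%N) F (a : nat -> CC R)
    (chi : int -> CC R) (hF : mform K F a) (a0 : a 0%N = 0) :
  primitive_character D chi ->
  twisted_period l chi (CuspForm (ext0_cusp hF a0)) =
  Cintegral (fun t => mkC 0 1 ^+ l.+1 * (shift_sum D F (tau D chi) t * rr (t ^+ l))).
Proof.
move=> chiP; apply: Cintegral_eq => t t0.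
rewrite (twist_eq hF a0 (z := mkC 0 t) t0 (tau_inversion D0 chiP)) -/(shift_sum D F (tau D chi) t).
by rewrite [in LHS]mkCE rmorph0 add0r exprMn rmorphXn exprS; ring.
Qed.

Theorem theorem1p4 (R : realType) (D : nat) (D_ge1 : (1 <= D)%N)
    (D_odd : odd D) (D_sqfree : squarefree D) :
  exists K0 : nat, forall K : nat, ~~ odd K -> (K0 <= K)%N ->
    forall l : nat, (3 <= l)%N -> (l <= (K - 4) %/ 2)%N ->
    forall (n : nat) (chi : 'I_n -> int -> CC R),
      (forall i, primitive_character D (chi i)) ->
      (forall i, chi i (-1) = (-1) ^+ l) ->
      (forall i j, i != j -> chi i 2 != chi j 2) ->
      linearly_independent
        (fun i : 'I_n => @twisted_period R K l (chi i)).
Proof.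
set e := totient D; have e0 : (0 < e)%N by rewrite totient_gt0.
have m0 j : (0 < 2 ^ j)%N by rewrite expn_gt0.
(* The oddness of D enters here. *)
have co j : coprime (2 ^ j) D by rewrite coprimeXl // coprime2n.
have [Ct hCt] := choice (fun j => @dual_coef_bound R D (2 ^ j) D_ge1 (m0 j)).
have {hCt}[K1 hb] := choice hCt.
pose T := \sum_(j < e) Ct j.
have T0 : 0 <= T by apply: sumr_ge0 => j _; exact: (hb j).1.
have leT (j : 'I_e) : Ct j <= T.
  by rewrite /T (bigD1 j) //= lerDl; apply: sumr_ge0 => i _; exact: (hb i).1.
have e_ge0 : 0 <= e%:R :> R by [].
(* The second argument of the maximum ensures K > e D^2 T, the constant of the final inequality S <=
   S (e D^2 T)/K. *)
exists (maxn (\max_(j < e) K1 j) (Num.truncn (e%:R * (D%:R * D%:R * T))).+1 + 4)%N.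
move=> K oK lK l l3 lh n chi chiP _ chi2 c hc.
(* l >= 3 excludes K < 4, where the truncated K - 4 would be 0. *)
have hl : (2 * l + 4 <= K)%N by move: l3 lh; clear; lia.
have K1K (j : 'I_e) : (K1 j <= K)%N.
  by apply: leq_trans lK; apply: leq_trans (leq_addr _ _); rewrite leq_max leq_bigmax.
have KR : 0 < K%:R :> R by rewrite ltr0n; move: hl; clear; lia.
have KT : e%:R * (D%:R * D%:R * T) < K%:R.
  have h0 : 0 <= e%:R * (D%:R * D%:R * T) by rewrite !mulr_ge0.
  have /andP[_ h] := truncn_itv h0; apply: lt_le_trans h _; rewrite ler_nat.
  by apply: leq_trans lK; apply: leq_trans (leq_addr _ _); rewrite leq_max leqnn orbT.
have /choice[s hs] : forall j, exists b, coprime j D -> (b < D)%N /\ (D %| j * b + 1)%N.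
  move=> j; have [cj|_] := boolP (coprime j D); last by exists 0%N.
  by have [b] := exists_neg_inv D_ge1 cj; exists b.
have /choice[kappa hk] : forall i, exists x, D%:R^-1 <= nm x /\
    forall m : nat, coprime m D ->
      chi i m * \sum_(a < D | coprime a D) tau D (chi i) a * zeta R D ^+ (m * s a) = x.
  move=> i; have [x h1 h2] := tau_twisted_sum D_ge1 D_sqfree (chiP i) hs.
  by exists x.
(* The relation is encoded in a single weight, so that the estimate is applied once, with an error
   proportional to the size of [c]. *)
pose Cc a := \sum_i c i * tau D (chi i) a.
have t0 i j : ~~ coprime j D -> tau D (chi i) j = 0.
  exact: tau_noncoprime.
have Cc0 j : ~~ coprime j D -> Cc j = 0.
  by move=> nj; rewrite /Cc big1 // => i _; rewrite t0 ?mulr0.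
pose B i j := \sum_(a < D | coprime a D) tau D (chi i) a * zeta R D ^+ (2 ^ j * s a).
have dual_coefE j : dual_coef D (2 ^ j) s Cc = \sum_i c i * B i j.
  rewrite /dual_coef /Cc (eq_bigr (fun a : 'I_D =>
    \sum_i c i * (tau D (chi i) a * zeta R D ^+ (2 ^ j * s a)))).
    by rewrite exchange_big; apply: eq_bigr => i _; rewrite mulr_sumr.
  by move=> a _; rewrite mulr_suml; apply: eq_bigr => i _; rewrite [RHS]mulrA.
have hB i j : chi i 2 ^+ j * B i j = kappa i.
  by rewrite -((hk i).2 (2 ^ j)%N (co j)) -(chiX (chiP i)).
have dual_coef_small (j : 'I_e) : nm (dual_coef D (2 ^ j) s Cc) <= weight_norm D Cc * (T / K%:R).
  have [F [a [hF a0 hFB]]] := (hb j).2 K oK (K1K j).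
  have ci i := (hFB l s (tau D (chi i)) hl hs (t0 i)).1.
  have [_ ] := hFB l s Cc hl hs Cc0.
  have -> : (fun t => shift_sum D F Cc t * rr (t ^+ l)) =
      fun t => \sum_i c i * (shift_sum D F (tau D (chi i)) t * rr (t ^+ l)).
    apply/funext => t; rewrite /shift_sum /Cc.
    rewrite (eq_bigr (fun j : 'I_D => \sum_i c i * (tau D (chi i) j * F (mkC 0 t + j%:R / D%:R)))).
      rewrite exchange_big mulr_suml; apply: eq_bigr => i _.
      by rewrite -mulr_sumr mulrA.
    by move=> j' _; rewrite mulr_suml; apply: eq_bigr => i _; rewrite [RHS]mulrA.
  rewrite (cintegral_sum (index_enum 'I_n) c ci).2 => h.
  apply: le_trans (h _) _; last first.
    apply: ler_wpM2l; first by apply: sumr_ge0 => q _; exact: nm_ge0.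
    by apply: ler_wpM2r; [rewrite invr_ge0 ltW|exact: leT].
  (* Multiplying by i^(l+1) turns the sum of real-line integrals into the relation between the
     periods themselves. *)
  have i0 : mkC 0 1 ^+ l.+1 != 0 :> CC R.
    by rewrite expf_neq0 // -nm_eq0 nm_i oner_eq0.
  apply: (mulfI i0); rewrite mulr0 mulr_sumr.
  have := congr1 (fun g => g (CuspForm (ext0_cusp hF a0))) hc.
  rewrite fct_sumE => h0; rewrite -[RHS]h0; apply: eq_bigr => i _.
  have -> : (c i *: (@twisted_period R K l (chi i) : _ -> _)) (CuspForm (ext0_cusp hF a0)) =
     c i * twisted_period l (chi i) (CuspForm (ext0_cusp hF a0)) by [].
  by rewrite (@twisted_period_eq R D K l D_ge1 F a (chi i) hF a0 (chiP i)) (cintegrableZ _ (ci i)).2 mulrCA.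
pose S := \sum_i nm (c i); have S0 : 0 <= S by apply: sumr_ge0 => i _; exact: nm_ge0.
have weight_normS : weight_norm D Cc <= D%:R * S.
  rewrite /weight_norm mulr_natl -[X in _ *+ X]card_ord -sumr_const; apply: ler_sum => j _.
  apply: le_trans (nm_sum _ _ _) _; apply: ler_sum => i _; rewrite nmM.
  by apply: ler_piMr; [exact: nm_ge0|exact: nm_tau_le1].
have c2 : coprime 2 D by exact: (co 1).
have we i : chi i 2 ^+ e = 1 by have := chi_root D_ge1 (chiP i) c2.
have wi : injective (fun i => chi i 2).
  by move=> i j hij; apply/eqP; apply: contraTT isT => /chi2; rewrite hij eqxx.
(* The values chi_i(2) are distinct e-th roots of unity, so n is bounded in terms of D alone. *)
have ne : (n <= e)%N.
  have := @max_unity_roots _ e [seq chi i 2 | i : 'I_n] e0.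
  rewrite size_map size_enum_ord; apply; last by rewrite map_inj_uniq ?enum_uniq.
  by apply/allP => _ /mapP[i _ ->]; rewrite unity_rootE we.
have ck k : nm (c k) <= D%:R * (D%:R * S * (T / K%:R)).
  have := dual_orthogonality c k e0 we wi hB.
  rewrite (eq_bigr (fun j : 'I_e => chi k 2 ^+ j * dual_coef D (2 ^ j) s Cc)) => [hd|j _];
    last by rewrite dual_coefE.
  have eR : 0 < e%:R :> R by rewrite ltr0n.
  have DR : 0 < D%:R :> R by rewrite ltr0n.
  have nk : nm (c k * kappa k) <= D%:R * S * (T / K%:R).
    rewrite -(ler_pM2l eR) -[X in X * nm _]nm_nat -nmM -hd.
    apply: le_trans (nm_sum _ _ _) _.
    have -> : e%:R * (D%:R * S * (T / K%:R)) = \sum_(j < e) D%:R * S * (T / K%:R).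
      by rewrite sumr_const card_ord mulr_natl.
    apply: ler_sum => j _; rewrite nmM nmX (nm_chi D_ge1 (chiP k) c2) expr1n mul1r;
      apply: le_trans (dual_coef_small j) _.
    by apply: ler_wpM2r weight_normS; apply: divr_ge0 => //; exact: ltW.
  rewrite -ler_pdivrMl //; apply: le_trans nk; rewrite nmM mulrC.
  by apply: ler_wpM2l; [exact: nm_ge0|exact: (hk k).1].
(* Summing the bounds for the c_k bounds S by S times a number smaller than 1, which forces S =
   0. *)
have : S <= e%:R * (D%:R * (D%:R * S * (T / K%:R))).
  apply: (@le_trans _ _ (\sum_(i < n) D%:R * (D%:R * S * (T / K%:R)))); first exact: ler_sum.
  rewrite sumr_const card_ord -[leLHS]mulr_natl; apply: ler_wpM2r; last by rewrite ler_nat.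
  apply: mulr_ge0 => //; apply: mulr_ge0; first exact: mulr_ge0.
  by apply: divr_ge0 => //; exact: ltW.
have -> : e%:R * (D%:R * (D%:R * S * (T / K%:R))) = S * (e%:R * (D%:R * D%:R * T)) / K%:R by ring.
rewrite ler_pdivlMr // => hS.
have {hS}S_eq0 : S = 0.
  apply/eqP; rewrite eq_le S0 andbT leNgt; apply/negP => Sp.
  by move: hS; rewrite ler_pM2l // leNgt KT.
move=> i; apply/eqP; rewrite -nm_eq0; apply/eqP/le_anti; rewrite nm_ge0 andbT -S_eq0.
by rewrite /S (bigD1 i) //= lerDl; apply: sumr_ge0 => j _; exact: nm_ge0.
Qed.
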